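(* Let $P:(\tilde M,\tilde g)\to(M,g)$ be a Riemannian submersion, let $p,q\in\mathbb{R}$ with $q\ge 0$, let $\tilde E^1$ be the unit horizontal bundle of $P$ equipped with its $(p,q)$-metric $\tilde{\mathbf h}$, and let $SM$ be the unit sphere bundle of $M$ equipped with its $(p,q)$-metric $\mathbf h$. Let $\tilde P:\tilde E^1\to SM$ be the restriction of the differential $P_*$. Then $\tilde P:(\tilde E^1,\tilde{\mathbf h})\to(SM,\mathbf h)$ is a Riemannian submersion if and only if the horizontal distribution $\mathcal H^P$ of $P$ is integrable. In that case, the horizontal and vertical distributions of $\tilde P$ are $\mathcal H^{\tilde P}=H'\oplus H''$ and $\mathcal V^{\tilde P}=V$.
   Context: **Horizontal and vertical bundles.** For a Riemannian submersion $Q:N_1\to N_2$, $\mathcal V^Q=\ker Q_*$ is the vertical distribution and $\mathcal H^Q=(\mathcal V^Q)^\perp$ is the horizontal distribution. **Connection map and $(p,q)$-metrics.** Let $\pi:\mathcal E\to M$ be a vector bundle over a Riemannian manifold $(M,g)$, with fibre metric $h$ and a connection $D$ compatible with $h$. The connection map $K^D:T\mathcal E\to\mathcal E$ is the smooth map which for each $\zeta\in\mathcal E$, $x=\pi(\zeta)$, is linear as a map $T_\zeta\mathcal E\to\mathcal E_x$, and which satisfies $K^D(\xi_*v)=D_v\xi$ for every $v\in TM$ and every section $\xi$ of $\mathcal E$. On vectors tangent to the fibre $\mathcal E_x$ it is the canonical isomorphism $T_\zeta\mathcal E_x\to\mathcal E_x$. For $p,q\in\mathbb R$, $q\ge0$,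 the $(p,q)$-metric on $\mathcal E$ is the Riemannian metric $$\mathbf h_{p,q}(A,B)=g(\pi_*A,\pi_*B)+\frac{1}{(1+|\zeta|^2)^p}\bigl(h(K^DA,K^DB)+q\,h(K^DA,\zeta)\,h(K^DB,\zeta)\bigr),$$ for $A,B\in T_\zeta\mathcal E$, $|\zeta|^2=h(\zeta,\zeta)$. The unit bundle is $\mathcal E^1=\{\xi\in\mathcal E:|\xi|=1\}$; the $(p,q)$-metric on $\mathcal E^1$ is the restriction of $\mathbf h_{p,q}$ to $T(\mathcal E^1)$. **The bundles involved.** $SM$ is the unit bundle of $TM$, with fibre metric $g$ and the Levi-Civita connection $\nabla$ of $g$. The unit horizontal bundle $\tilde E^1$ of $P$ is the unit bundle of $\tilde E=\mathcal H^P\to\tilde M$, with fibre metric $\tilde g$ and connection $\tilde D=\mathcal H\tilde\nabla$, where $\tilde\nabla$ is the Levi-Civita connection of $\tilde g$ and $\mathcal H$ denotes orthogonal projection onto $\mathcal H^P$. Let $\tilde\pi:\tilde E^1\to\tilde M$ be the projection; it is a Riemannian submersion for the $(p,q)$-metric, with $\mathcal H^{\tilde\pi}_\xi=T_\xi\tilde E^1\cap\ker K^{\tilde D}$. **The subbundles $H',H'',V$ of $T(\tilde E^1)$.** For $W\in T_{\tilde x}\tilde M$ and $\xi\in\tilde E^1_{\tilde x}$, $W^h=W^h_\xi\in\mathcal H^{\tilde\pi}_\xi$ is the unique vector with $\tilde\pi_*W^h=W$. For $w\in T_xM$ and $\tilde x\in P^{-1}(x)$, $\tilde w\in\mathcal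 H^P_{\tilde x}$ is the unique vector with $P_*\tilde w=w$. For $\xi\in\tilde E^1$ put - $H'_\xi=T_\xi(\tilde E^1_{\tilde\pi(\xi)})$, the tangent space of the fibre of $\tilde\pi$ through $\xi$; - $H''_\xi=\{\tilde w^h_\xi: w\in T_xM\}$, where $x=P(\tilde\pi(\xi))$ and $\tilde w$ is taken at $\tilde\pi(\xi)$; - $V_\xi=\{A\in\mathcal H^{\tilde\pi}_\xi: P_*\tilde\pi_*A=0\}$. *)

(* Defs.v *)
From HB Require Import structures.
From mathcomp Require Import all_boot all_order all_algebra.
From mathcomp Require Import all_classical all_reals all_analysis.

Set Implicit Arguments.
Unset Strict Implicit.
Unset Printing Implicit Defensive.

Import Order.TTheory GRing.Theory Num.Theory.
Import numFieldNormedType.Exports.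
Local Open Scope classical_set_scope.
Local Open Scope ring_scope.

(* For U open: f is of class C^k on U.  The step asks that every directional
   derivative x |-> 'd f x v be of class C^(k-1), which in finite dimension is
   the C^(k-1) regularity of the differential. *)
Fixpoint Ck (R : realType) (V W : normedModType R) (k : nat) (U : set V)
    (f : V -> W) : Prop :=
  match k with
  | 0 => forall x, U x -> {for x, continuous f}
  | k'.+1 => (forall x, U x -> differentiable f x) /\
             forall v : V, Ck k' U (fun x => 'd f x v)
  end.

Definition Coo (R : realType) (V W : normedModType R) (U : set V)
    (f : V -> W) : Prop := forall k, Ck k U f.

Definition Coo_at (R : realType) (V W : normedModType R) (f : V -> W)
    (a : V) : Prop := exists U : set V, [/\ open U, U a & Coo U f].

Record chart (R : realType) (T : Type) (n : nat) := Chart {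
  chart_dom : set T;
  chart_map : T -> 'rV[R]_n;
  chart_inv : 'rV[R]_n -> T }.

(* The bare data of an atlas; chart_at chooses a chart around each point, and
   the tangent space at x is R^n, a tangent vector being given by its components
   in the chart chart_at x. *)
Record charted (R : realType) (n : nat) := Charted {
  carrier :> topologicalType;
  atlas : set (chart R carrier n);
  chart_at : carrier -> chart R carrier n }.
Arguments atlas {R n} _ _.

Definition is_chart (R : realType) (T : topologicalType) (n : nat)
    (phi : chart R T n) : Prop :=
  [/\ open (chart_dom phi),
      open (chart_map phi @` chart_dom phi),
      (forall x, chart_dom phi x -> chart_inv phi (chart_map phi x) = x),
      (forall x, chart_dom phi x -> {for x, continuous (chart_map phi)}) &
      (forall x, chart_dom phi x ->
         {for chart_map phi x, continuous (chart_inv phi)})].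

Record manifold (R : realType) (n : nat) := Manifold {
  manifold_charted :> charted R n;
  manifold_hausdorff : hausdorff_space manifold_charted;
  manifold_second_countable : @second_countable manifold_charted;
  manifold_chart : forall phi, atlas manifold_charted phi -> is_chart phi;
  manifold_transition : forall phi psi,
    atlas manifold_charted phi -> atlas manifold_charted psi ->
    Coo (chart_map phi @` (chart_dom phi `&` chart_dom psi))
        (chart_map psi \o chart_inv phi);
  manifold_chart_at : forall x : manifold_charted,
    atlas manifold_charted (chart_at x) /\ chart_dom (chart_at x) x }.

Definition smooth_at (R : realType) (k l : nat) (N1 : charted R k)
    (N2 : charted R l) (F : N1 -> N2) (x : N1) : Prop :=
  {for x, continuous F} /\
  Coo_at (chart_map (chart_at (F x)) \o F \o chart_inv (chart_at x))
         (chart_map (chart_at x) x).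

Definition smooth_fun_at (R : realType) (k : nat) (N : charted R k)
    (f : N -> R) (x : N) : Prop :=
  Coo_at (f \o chart_inv (chart_at x)) (chart_map (chart_at x) x).

Definition smooth_within (R : realType) (k l : nat) (N1 : charted R k)
    (N2 : charted R l) (S : set N1) (F : N1 -> N2) : Prop :=
  forall x, S x -> exists (U : set N1) (G : N1 -> N2),
    [/\ open U, U x, (forall y, U y -> smooth_at G y) &
        (forall y, U y -> S y -> G y = F y)].

Definition dmap (R : realType) (k l : nat) (N1 : charted R k)
    (N2 : charted R l) (F : N1 -> N2) (x : N1) (v : 'rV[R]_k) : 'rV[R]_l :=
  'd (chart_map (chart_at (F x)) \o F \o chart_inv (chart_at x))
     (chart_map (chart_at x) x) v.

Definition dfun (R : realType) (k : nat) (N : charted R k) (f : N -> R)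
    (x : N) (v : 'rV[R]_k) : R :=
  'd (f \o chart_inv (chart_at x)) (chart_map (chart_at x) x) v.

(* T_x S for a submanifold S of N: velocities at time 0 of smooth curves of N
   lying in S.  With S = setT it is the whole of T_x N. *)
Definition tangent_at (R : realType) (k : nat) (N : charted R k) (S : set N)
    (x : N) : set 'rV[R]_k :=
  [set v | exists c : R -> N,
     [/\ c 0 = x,
         {for 0, continuous c} /\ Coo_at (chart_map (chart_at x) \o c) 0,
         (\forall t \near (0 : R), S (c t)) &
         derive1 (chart_map (chart_at x) \o c) 0 = v]].

Record tvec (R : realType) (n : nat) (M : charted R n) :=
  TVec { tbase : M; tvect : 'rV[R]_n }.

(* dchart phi x passes from components in chart_at x to components in phi, and
   dchart_inv phi u goes back, at the point with coordinates u in phi. *)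
Definition dchart (R : realType) (n : nat) (M : charted R n)
    (phi : chart R M n) (x : M) (v : 'rV[R]_n) : 'rV[R]_n :=
  'd (chart_map phi \o chart_inv (chart_at x)) (chart_map (chart_at x) x) v.

Definition dchart_inv (R : realType) (n : nat) (M : charted R n)
    (phi : chart R M n) (u v : 'rV[R]_n) : 'rV[R]_n :=
  'd (chart_map (chart_at (chart_inv phi u)) \o chart_inv phi) u v.

Definition tchart (R : realType) (n : nat) (M : charted R n)
    (phi : chart R M n) : chart R (tvec M) (n + n) :=
  Chart [set z | chart_dom phi (tbase z)]
    (fun z => row_mx (chart_map phi (tbase z)) (dchart phi (tbase z) (tvect z)))
    (fun w => TVec (chart_inv phi (lsubmx w))
                   (dchart_inv phi (lsubmx w) (rsubmx w))).

(* The topology making the charts tchart phi homeomorphisms onto open sets. *)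
Definition tvec_open (R : realType) (n : nat) (M : charted R n) :
    set (set (tvec M)) :=
  [set A | forall phi, atlas M phi ->
     forall z, A z -> chart_dom (tchart phi) z ->
     \forall w \near chart_map (tchart phi) z,
       forall z', chart_dom (tchart phi) z' ->
         chart_map (tchart phi) z' = w -> A z'].

Lemma tvec_openT (R : realType) (n : nat) (M : charted R n) :
  tvec_open [set: tvec M].
Proof. by move=> phi _ z _ _; near=> w. Unshelve. all: by end_near. Qed.

Lemma tvec_openI (R : realType) (n : nat) (M : charted R n) :
  setI_closed (@tvec_open R n M).
Proof.
move=> A B oA oB phi aphi z [Az Bz] dz.
apply: filterS2 (oA _ aphi _ Az dz) (oB _ aphi _ Bz dz) => w hA hB z' dz' ez'.
by split; [apply: hA | apply: hB].
Qed.

Lemma tvec_open_bigU (R : realType) (n : nat) (M : charted R n)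
    (I : Type) (f : I -> set (tvec M)) :
  (forall i, tvec_open (f i)) -> tvec_open (\bigcup_i f i).
Proof.
move=> of_ phi aphi z [i _ fz] dz.
apply: filterS (of_ i _ aphi _ fz dz) => w h z' dz' ez'.
by exists i => //; apply: h.
Qed.

HB.instance Definition _ (R : realType) (n : nat) (M : charted R n) :=
  gen_eqMixin (tvec M).
HB.instance Definition _ (R : realType) (n : nat) (M : charted R n) :=
  gen_choiceMixin (tvec M).
HB.instance Definition _ (R : realType) (n : nat) (M : charted R n) :=
  @isOpenTopological.Build (tvec M) (@tvec_open R n M)
    (@tvec_openT R n M) (@tvec_openI R n M) (@tvec_open_bigU R n M).

Definition tangent_bundle (R : realType) (n : nat) (M : charted R n) :
    charted R (n + n) :=
  @Charted R (n + n) (tvec M)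
    [set tchart phi | phi in atlas M] (fun z => tchart (chart_at (tbase z))).

Definition bundle_proj (R : realType) (n : nat) (M : charted R n)
    (z : tangent_bundle M) : M := tbase z.

Definition tangent_map (R : realType) (k l : nat) (N1 : charted R k)
    (N2 : charted R l) (F : N1 -> N2) (z : tangent_bundle N1) :
    tangent_bundle N2 :=
  @TVec R l N2 (F (bundle_proj z)) (dmap F (bundle_proj z) (tvect z)).

Definition vfield (R : realType) (n : nat) (M : charted R n) : Type :=
  M -> 'rV[R]_n.

Definition as_section (R : realType) (n : nat) (M : charted R n) (X : vfield M)
    (x : M) : tangent_bundle M := @TVec R n M x (X x).

Definition smooth_vfield_on (R : realType) (n : nat) (M : charted R n)
    (U : set M) (X : vfield M) : Prop :=
  forall x, U x -> smooth_at (as_section X) x.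

Definition smooth_fun_on (R : realType) (n : nat) (M : charted R n)
    (U : set M) (f : M -> R) : Prop := forall x, U x -> smooth_fun_at f x.

Definition vfield_rep (R : realType) (n : nat) (M : charted R n)
    (phi : chart R M n) (X : vfield M) (u : 'rV[R]_n) : 'rV[R]_n :=
  dchart phi (chart_inv phi u) (X (chart_inv phi u)).

Definition bracket (R : realType) (n : nat) (M : charted R n)
    (X Y : vfield M) (x : M) : 'rV[R]_n :=
  let phi := chart_at x in let u := chart_map phi x in
  'd (vfield_rep phi Y) u (X x) - 'd (vfield_rep phi X) u (Y x).

Definition tensor2 (R : realType) (n : nat) (N : charted R n) : Type :=
  N -> 'rV[R]_n -> 'rV[R]_n -> R.

Record riem_metric (R : realType) (n : nat) (M : charted R n) := RiemMetric {
  metric_val :> M -> 'rV[R]_n -> 'rV[R]_n -> R;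
  metric_linear : forall x a u v w,
    metric_val x (a *: u + v) w = a * metric_val x u w + metric_val x v w;
  metric_sym : forall x u v, metric_val x u v = metric_val x v u;
  metric_pos : forall x u, u != 0 -> 0 < metric_val x u u;
  metric_smooth : forall (U : set M) (X Y : vfield M), open U ->
    smooth_vfield_on U X -> smooth_vfield_on U Y ->
    smooth_fun_on U (fun x => metric_val x (X x) (Y x)) }.

(* nabla X x v stands for the covariant derivative of X at x in the direction v;
   it is constrained only on vector fields that are smooth near x. *)
Definition covariant (R : realType) (n : nat) (M : charted R n) : Type :=
  vfield M -> M -> 'rV[R]_n -> 'rV[R]_n.

Record levi_civita (R : realType) (n : nat) (M : charted R n)
    (g : riem_metric M) (nabla : covariant M) : Prop := LeviCivita {
  lc_local : forall (U : set M) (X Y : vfield M) x v, open U -> U x ->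
    smooth_vfield_on U X -> (forall y, U y -> X y = Y y) ->
    nabla X x v = nabla Y x v;
  lc_linear : forall (U : set M) (X : vfield M) x a u v, open U -> U x ->
    smooth_vfield_on U X ->
    nabla X x (a *: u + v) = a *: nabla X x u + nabla X x v;
  lc_add : forall (U : set M) (X Y : vfield M) x v, open U -> U x ->
    smooth_vfield_on U X -> smooth_vfield_on U Y ->
    nabla (fun y => X y + Y y) x v = nabla X x v + nabla Y x v;
  lc_leibniz : forall (U : set M) (f : M -> R) (X : vfield M) x v,
    open U -> U x -> smooth_fun_on U f -> smooth_vfield_on U X ->
    nabla (fun y => f y *: X y) x v = dfun f x v *: X x + f x *: nabla X x v;
  lc_smooth : forall (U : set M) (X Y : vfield M), open U ->
    smooth_vfield_on U X -> smooth_vfield_on U Y ->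
    smooth_vfield_on U (fun x => nabla X x (Y x));
  lc_metric : forall (U : set M) (X Y : vfield M) x v, open U -> U x ->
    smooth_vfield_on U X -> smooth_vfield_on U Y ->
    dfun (fun y => g y (X y) (Y y)) x v =
      g x (nabla X x v) (Y x) + g x (X x) (nabla Y x v);
  lc_torsion : forall (U : set M) (X Y : vfield M) x, open U -> U x ->
    smooth_vfield_on U X -> smooth_vfield_on U Y ->
    nabla Y x (X x) - nabla X x (Y x) = bracket X Y x }.

(* For F : N1 -> N2, a submanifold S of N1 and a metric h on S (only the values
   of h on the spaces T_x S matter): ker F_* and its orthogonal in T_x S. *)
Definition vertical (R : realType) (k l : nat) (N1 : charted R k)
    (N2 : charted R l) (S : set N1) (F : N1 -> N2) (x : N1) : set 'rV[R]_k :=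
  [set v | tangent_at S x v /\ dmap F x v = 0].

Definition horizontal (R : realType) (k l : nat) (N1 : charted R k)
    (N2 : charted R l) (S : set N1) (h : tensor2 N1) (F : N1 -> N2) (x : N1) :
    set 'rV[R]_k :=
  [set v | tangent_at S x v /\ forall w, vertical S F x w -> h x v w = 0].

(* The restriction (S1, h1) -> (S2, h2) of a map F that is smooth around S1. *)
Definition riemannian_submersion (R : realType) (k l : nat) (N1 : charted R k)
    (N2 : charted R l) (S1 : set N1) (S2 : set N2) (h1 : tensor2 N1)
    (h2 : tensor2 N2) (F : N1 -> N2) : Prop :=
  [/\ (forall x, S1 x -> smooth_at F x),
      F @` S1 = S2,
      (forall x, S1 x -> dmap F x @` tangent_at S1 x = tangent_at S2 (F x)) &
      (forall x u v, S1 x -> horizontal S1 h1 F x u -> horizontal S1 h1 F x v ->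
         h2 (F x) (dmap F x u) (dmap F x v) = h1 x u v)].

(* A subbundle of TM is given by its total space. *)
Definition subbundle (R : realType) (n : nat) (M : charted R n) : Type :=
  set (tangent_bundle M).

Definition horizontal_bundle (R : realType) (k l : nat) (N1 : charted R k)
    (N2 : charted R l) (g : riem_metric N1) (F : N1 -> N2) : subbundle N1 :=
  [set z | horizontal setT g F (bundle_proj z) (tvect z)].

(* Integrability is the existence of an injectively immersed integral manifold
   through each point, not the involutivity of E. *)
Definition integrable_subbundle (R : realType) (n : nat) (M : charted R n)
    (E : subbundle M) : Prop :=
  forall x : M, exists (k : nat) (L : manifold R k) (i : L -> M),
    [/\ injective i,
        (forall y, smooth_at i y),
        (exists y, i y = x),
        (forall y, injective (dmap i y)) &
        (forall y, range (dmap i y) = [set v | E (@TVec R n M (i y) v)])].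

Definition orth_proj (R : realType) (n : nat) (M : charted R n)
    (g : riem_metric M) (E : subbundle M) (x : M) (v : 'rV[R]_n) : 'rV[R]_n :=
  get [set w | E (@TVec R n M x w) /\
               forall u, E (@TVec R n M x u) -> g x (v - w) u = 0].

(* For E = H^P and nabla the Levi-Civita connection, X |-> H(nabla X). *)
Definition induced_connection (R : realType) (n : nat) (M : charted R n)
    (g : riem_metric M) (E : subbundle M) (nabla : covariant M) : covariant M :=
  fun X x v => orth_proj g E x (nabla X x v).

(* T E as a subset of T(TM), E being seen as a submanifold of TM. *)
Definition tangent_total (R : realType) (n : nat) (M : charted R n)
    (E : subbundle M) : set (tangent_bundle (tangent_bundle M)) :=
  [set A | E (bundle_proj A) /\ tangent_at E (bundle_proj A) (tvect A)].

(* K z A is meaningful for z in E and A tangent to E at z.  Sections are local,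
   as in the axioms of nabla. *)
Record connection_map (R : realType) (n : nat) (M : charted R n)
    (E : subbundle M) (D : covariant M)
    (K : tangent_bundle M -> 'rV[R]_(n + n) -> 'rV[R]_n) : Prop :=
  ConnectionMap {
  cm_fibre : forall z A, E z -> tangent_at E z A ->
    E (@TVec R n M (bundle_proj z) (K z A));
  cm_linear : forall z a A B, E z -> tangent_at E z A -> tangent_at E z B ->
    K z (a *: A + B) = a *: K z A + K z B;
  cm_smooth : smooth_within (tangent_total E)
    (fun A : tangent_bundle (tangent_bundle M) =>
       (@TVec R n M (bundle_proj (bundle_proj A)) (K (bundle_proj A) (tvect A))
          : tangent_bundle M));
  cm_section : forall (U : set M) (X : vfield M) x v, open U -> U x ->
    smooth_vfield_on U X -> (forall y, U y -> E (as_section X y)) ->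
    K (as_section X x) (dmap (as_section X) x v) = D X x v }.

Definition pq_metric (R : realType) (n : nat) (M : charted R n)
    (g : riem_metric M)
    (K : tangent_bundle M -> 'rV[R]_(n + n) -> 'rV[R]_n) (p q : R) :
    tensor2 (tangent_bundle M) :=
  fun z A B =>
    let x := bundle_proj z in let s := tvect z in
    g x (dmap (@bundle_proj R n M) z A) (dmap (@bundle_proj R n M) z B) +
    ((1 + g x s s) `^ p)^-1 *
      (g x (K z A) (K z B) + q * g x (K z A) s * g x (K z B) s).

Definition unit_bundle (R : realType) (n : nat) (M : charted R n)
    (g : riem_metric M) (E : subbundle M) : set (tangent_bundle M) :=
  [set z | E z /\ g (bundle_proj z) (tvect z) (tvect z) = 1].

(* Below S is meant to be the unit horizontal bundle of P : M -> N, with metric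
   h; its projection onto M is the restriction of bundle_proj. *)
Definition Hprime (R : realType) (n : nat) (M : charted R n)
    (S : set (tangent_bundle M)) (z : tangent_bundle M) : set 'rV[R]_(n + n) :=
  tangent_at (S `&` [set z' | bundle_proj z' = bundle_proj z]) z.

Definition Hsecond (R : realType) (n m : nat) (M : charted R n)
    (N : charted R m) (g : riem_metric M) (P : M -> N)
    (S : set (tangent_bundle M)) (h : tensor2 (tangent_bundle M))
    (z : tangent_bundle M) : set 'rV[R]_(n + n) :=
  [set A | exists (w : 'rV[R]_m) (wt : 'rV[R]_n),
     [/\ horizontal setT g P (bundle_proj z) wt, dmap P (bundle_proj z) wt = w,
         horizontal S h (@bundle_proj R n M) z A &
         dmap (@bundle_proj R n M) z A = wt]].

Definition Vbundle (R : realType) (n m : nat) (M : charted R n)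
    (N : charted R m) (P : M -> N) (S : set (tangent_bundle M))
    (h : tensor2 (tangent_bundle M)) (z : tangent_bundle M) :
    set 'rV[R]_(n + n) :=
  [set A | horizontal S h (@bundle_proj R n M) z A /\
           dmap P (bundle_proj z) (dmap (@bundle_proj R n M) z A) = 0].

Definition is_direct_sum (R : realType) (d : nat) (A B C : set 'rV[R]_d) :
    Prop :=
  C = [set a + b | a in A & b in B] /\ A `&` B = [set 0].

(* Main.v *)
Require Import Defs.
From HB Require Import structures.
From mathcomp Require Import all_boot all_order all_algebra.
From mathcomp Require Import all_classical all_reals all_analysis.
From mathcomp Require Import ring lra.

Set Implicit Arguments.
Unset Strict Implicit.
Unset Printing Implicit Defensive.

Import Order.TTheory GRing.Theory Num.Theory.
Import numFieldNormedType.Exports.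
Local Open Scope classical_set_scope.
Local Open Scope ring_scope.

(* In charts (matrices act on row vectors) let J be the matrix of P_* and L that of the
   horizontal lift, and write xi = s L.  A tangent vector of the unit horizontal bundle at xi is
   a pair (a, k), where a is its base velocity and k, orthogonal to s, is the covariant
   derivative of P_* xi = s along P.  The differential of tangent_map P is
   (a, k) |-> (a J, k), whereas the connection map of the horizontal bundle takes the value
   (k + s D(a)) L, where D is O'Neill's integrability tensor: skew for g and zero on horizontal a.
   Vertical vectors are the (U, 0) with U J = 0, and comparing the two metrics on the horizontal
   vectors shows that tangent_map P is a Riemannian submersion iff s D = 0 for all unit s, i.e.
   D = 0.  This says that the horizontal lifts of coordinate fields commute, which by Frobenius'
   theorem is the integrability of the distribution; leaves are built as the images of the
   time-one maps x |-> c(1) of c' = x L(c).  When D = 0, the pairs (0, k), (c L, 0) and (U, 0) are H', H''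
   and V. *)

(** * Differential calculus *)

(** On the unit bundles both metrics lose q: 1 + |xi|^2 is 2, and the value of the connection map is
    orthogonal to xi (upstairs because D is skew), so each metric is its base term plus 2^-p times
    its fibre term. For vertical W the pair (W, b) is sent to (0, b). Choosing W and b so that the
    fibre term upstairs is a prescribed s D(U) turns isometry into |W|^2 + 2^-p |s D(W)|^2 = 0, and
    this forces s D(U) = 0. Tangent vectors are components in [chart_at] of their own base point,
    and this chart may jump from point to point. A statement made at every point in its own chart
    must therefore be carried to one fixed chart before it is differentiated; in particular the
    flatness condition is shown to be independent of the charts. The skewness of D comes from
    differentiating L J = 1 and L A = G J^T, where A and G are the Gram matrices of the two base
    metrics; the symmetry of the Christoffel matrices and of second derivatives then makes D vanish
    on lifts. *)

Lemma is_diff_eps (R : realType) (V W : normedModType R) (f df : V -> W) (x : V) :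
  linear df -> continuous df ->
  (forall e, 0 < e ->
     \forall h \near (0 : V), `|f (h + x) - f x - df h| <= e * `|h|) ->
  is_diff x f df.
Proof.
move=> dl dc H.
pose dM := GRing.isLinear.Build _ _ _ _ _ dl.
pose dL : {linear V -> W} := HB.pack df dM.
have E : f \o shift x = cst (f x) + dL +o_ (0 : V) id.
  apply/eqaddoP => e e0; move: (H e e0); apply: filterS => h.
  by rewrite /= !fctE /= opprD addrA.
have D : 'd f x = dL :> (V -> W) by apply: diff_unique.
by apply: DiffDef => //; apply/diff_locallyP; rewrite D.
Qed.

Lemma diff_eps (R : realType) (V W : normedModType R) (f : V -> W) (x : V) :
  differentiable f x -> forall e, 0 < e ->
  \forall h \near (0 : V), `|f (h + x) - f x - 'd f x h| <= e * `|h|.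
Proof.
move=> /diff_locally/eqaddoP H e e0; move: (H e e0); apply: filterS => h.
by rewrite /= !fctE /= opprD addrA.
Qed.

Lemma near_shift0 (R : realType) (V : normedModType R) (x : V) (P : V -> Prop) :
  (\forall y \near x, P y) -> \forall h \near (0 : V), P (h + x).
Proof.
move=> H; have : (h + x) @[h --> (0 : V)] --> 0 + x.
  by apply: cvgD; [exact: cvg_id|exact: cvg_cst].
by rewrite add0r; apply.
Qed.

Lemma near_is_diff (R : realType) (V W : normedModType R) (f g df : V -> W)
    (x : V) : (\forall y \near x, f y = g y) -> is_diff x f df -> is_diff x g df.
Proof.
move=> fg [fd fE]; have fgx := nbhs_singleton fg.
apply: is_diff_eps; rewrite -fE.
- exact: linearP.
- exact: diff_continuous.
- move=> e e0; apply: filterS2 (diff_eps fd e0) (near_shift0 fg) => h + E.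
  by rewrite -E -fgx.
Qed.

Lemma near_differentiable (R : realType) (V W : normedModType R) (f g : V -> W)
    (x : V) : (\forall y \near x, f y = g y) -> differentiable f x ->
  differentiable g x.
Proof. by move=> fg fd; have [] := near_is_diff fg (differentiableP fd). Qed.

(** This covers non-differentiable maps as well: differentiability passes to any map equal near x,
    and where it fails ['d] takes the default value 0. *)
Lemma near_diff (R : realType) (V W : normedModType R) (f g : V -> W)
    (x : V) : (\forall y \near x, f y = g y) -> 'd f x = 'd g x :> (V -> W).
Proof.
move=> fg; have [fd|fnd] := pselect (differentiable f x).
  by have [_ <-] := near_is_diff fg (differentiableP fd).
have gnd : ~ differentiable g x.
  move=> gd; apply: fnd; apply: near_differentiable gd.
  by apply: filterS fg.
have nd0 (k : V -> W) : ~ differentiable k x -> 'd k x = 0 :> (V -> W).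
  move=> knd; rewrite /diff getPN // => l [lc lE]; apply: knd.
  have lk : k \o shift x = cst (k x) + l +o_ (0 : V) id.
    have : forall y, k y = k x + l (y - x) +o_(y \near x) (y - x).
      by move=> y; rewrite {1}lE lim_id.
    move=> H; apply/eqaddoP => e e0.
    have : k = (fun y => k x + l (y - x)) +o_x (fun y => y - x).
      by apply/funext => y; exact: H.
    move=> /eqaddoP /(_ e e0) /near_shift0; apply: filterS => h.
    by rewrite /= !fctE /= addrK opprD.
  have D := diff_unique lc lk.
  by apply/diff_locallyP; rewrite D.
by rewrite (nd0 f fnd) (nd0 g gnd).
Qed.

(** * Calculus of maps of class C^k on an open set *)

Section Ck_theory.
Variables (R : realType).
Implicit Types (V W : normedModType R) (k : nat).

Lemma Ck_ext V W k (U : set V) (f g : V -> W) : open U ->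
  (forall x, U x -> f x = g x) -> Ck k U f -> Ck k U g.
Proof.
move=> oU; elim: k f g => [|k IH] f g fg.
  move=> fc x Ux; have := fc x Ux; rewrite /prop_for /continuous_at fg //.
  apply: cvg_trans; apply: near_eq_cvg.
  by apply: filterS (open_nbhs_nbhs (conj oU Ux)) => y Uy; rewrite fg.
have nE x : U x -> \forall y \near x, f y = g y.
  move=> Ux; by apply: filterS (open_nbhs_nbhs (conj oU Ux)) => y Uy; rewrite fg.
move=> [fd fk]; split=> [x Ux|v].
  by apply: near_differentiable (fd x Ux); exact: nE.
apply: IH (fk v) => x Ux; by rewrite (near_diff (nE x Ux)).
Qed.

Lemma Ck_subset V W k (U U' : set V) (f : V -> W) : U' `<=` U ->
  Ck k U f -> Ck k U' f.
Proof.
move=> sU; elim: k f => [|k IH] f /=; first by move=> + x /sU; apply.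
by move=> [fd fk]; split=> [x /sU|v]; [exact: fd|exact/IH/fk].
Qed.

Lemma CkS V W k (U : set V) (f : V -> W) : Ck k.+1 U f -> Ck k U f.
Proof.
elim: k f => [|k IH] f [fd fk]; first by move=> x Ux; exact/differentiable_continuous/fd.
by split=> // v; exact: IH.
Qed.

Lemma Ck_cst V W k (U : set V) (c : W) : Ck k U (fun _ => c).
Proof.
elim: k c => [|k IH] c /=; first by move=> x _; exact: cst_continuous.
split=> [x _|v]; first exact: differentiable_cst.
have -> : (fun x : V => 'd (fun _ => c) x v) = (fun _ => 0).
  by apply/funext => x; rewrite (diff_cst c).
exact: IH.
Qed.

Lemma is_diff_addf V W (f g : V -> W) (x : V) :
  differentiable f x -> differentiable g x ->
  is_diff x (fun y => f y + g y) (fun h => 'd f x h + 'd g x h).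
Proof. by move=> fd gd; exact: is_diffD (differentiableP fd) (differentiableP gd). Qed.

Lemma CkD V W k (U : set V) (f g : V -> W) : open U ->
  Ck k U f -> Ck k U g -> Ck k U (fun x => f x + g x).
Proof.
move=> oU; elim: k f g => [|k IH] f g /=.
  by move=> fc gc x Ux; apply: continuousD; [exact: fc|exact: gc].
move=> [fd fk] [gd gk]; split=> [x Ux|v].
  by have [] := is_diff_addf (fd x Ux) (gd x Ux).
apply: (Ck_ext oU) (IH _ _ (fk v) (gk v)) => x Ux.
exact: (esym (congr1 (fun l : V -> W => l v) (@diff_val _ _ _ _ _ _ _ (is_diff_addf (fd x Ux) (gd x Ux))))).
Qed.

Lemma Ck_sum V W k (U : set V) (I : Type) (r : seq I) (f : I -> V -> W) :
  open U -> (forall i, Ck k U (f i)) -> Ck k U (fun x => \sum_(i <- r) f i x).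
Proof.
move=> oU fk; elim: r => [|i r IH].
  by apply: (Ck_ext oU) (Ck_cst k U 0) => x _; rewrite big_nil.
by apply: (Ck_ext oU) (CkD oU (fk i) IH) => x _; rewrite big_cons.
Qed.

Lemma is_diff_scale V W (a : V -> R) (f : V -> W) (x : V) :
  differentiable a x -> differentiable f x ->
  is_diff x (fun y => a y *: f y) (fun h => a x *: 'd f x h + 'd a x h *: f x).
Proof.
move=> ad fd.
have Sb : bilinear_for (GRing.Scale.Law.clone _ _ *:%R _)
    (GRing.Scale.Law.clone _ _ *:%R _) (@GRing.scale R W : R^o -> W -> W).
  by split=> [u'|u] b u1 u2 /=; rewrite ?scalerDl ?scalerDr !scalerA // mulrC.
pose SM := bilinear_isBilinear.Build R R^o W W _ _ (@GRing.scale R W : R^o -> W -> W) Sb.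
pose SL : {bilinear R^o -> W -> W} := HB.pack (@GRing.scale R W : R^o -> W -> W) SM.
have Sc : continuous (fun p : R * W => SL p.1 p.2) by move=> p; exact: scale_continuous.
have pd := differentiable_pair ad fd.
have -> : (fun y => a y *: f y) = (fun p : R * W => SL p.1 p.2) \o (fun y => (a y, f y)) by [].
apply: DiffDef; first exact: (differentiable_comp pd (differentiable_bilin _ Sc)).
rewrite (diff_comp pd (differentiable_bilin _ Sc)) (diff_bilin _ Sc) /=.
by apply/funext => h /=; rewrite (diff_pair ad fd).
Qed.

Lemma CkZ V W k (U : set V) (a : V -> R) (f : V -> W) : open U ->
  Ck k U a -> Ck k U f -> Ck k U (fun x => a x *: f x).
Proof.
move=> oU; elim: k a f => [|k IH] a f /=.
  by move=> ac fc x Ux; apply: continuousZ; [exact: ac|exact: fc].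
move=> [ad ak] [fd fk]; split=> [x Ux|v].
  by have [] := is_diff_scale (ad x Ux) (fd x Ux).
have aS : Ck k U a by apply: CkS; split.
have fS : Ck k U f by apply: CkS; split.
apply: (Ck_ext oU) (CkD oU (IH _ _ aS (fk v)) (IH _ _ (ak v) fS)) => x Ux.
exact: (esym (congr1 (fun l : V -> W => l v) (@diff_val _ _ _ _ _ _ _ (is_diff_scale (ad x Ux) (fd x Ux))))).
Qed.

Lemma Ck_linear_comp V W (W' : normedModType R) k (U : set V) (f : V -> W)
    (g : W -> W') : open U -> linear g -> continuous g ->
  Ck k U f -> Ck k U (g \o f).
Proof.
move=> oU gl gc.
pose gM := GRing.isLinear.Build _ _ _ _ _ gl.
pose gL : {linear W -> W'} := HB.pack g gM.
have gd x : differentiable g x by exact: (@linear_differentiable _ _ _ gL).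
have gE x : 'd g x = g :> (W -> W') by exact: (@diff_lin _ _ _ gL).
elim: k f => [|k IH] f /=.
  by move=> fc x Ux; apply: continuous_comp; [exact: fc|exact: gc].
move=> [fd fk]; split=> [x Ux|v]; first exact: differentiable_comp (fd x Ux) (gd _).
apply: (Ck_ext oU) (IH _ (fk v)) => x Ux.
by rewrite (diff_comp (fd x Ux) (gd _)) /= gE.
Qed.

Lemma Ck_linear V W k (U : set V) (g : V -> W) :
  linear g -> continuous g -> Ck k U g.
Proof.
move=> gl gc.
pose gM := GRing.isLinear.Build _ _ _ _ _ gl.
pose gL : {linear V -> W} := HB.pack g gM.
have gd x : differentiable g x by exact: (@linear_differentiable _ _ _ gL).
have gE x : 'd g x = g :> (V -> W) by exact: (@diff_lin _ _ _ gL).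
case: k => [|k] /=; first by move=> x Ux; exact: gc.
split=> [x _|v]; first exact: gd.
have -> : (fun x => 'd g x v) = (fun _ => g v) by apply/funext => x; rewrite gE.
exact: Ck_cst.
Qed.

Lemma coord_linear m n i j : linear (fun M : 'M[R]_(m, n) => M i j : R).
Proof. by move=> a M N; rewrite !mxE. Qed.

Lemma diff_row n W (g : 'rV[R]_n -> W) (y w : 'rV[R]_n) :
  'd g y w = \sum_(i < n) w 0 i *: 'd g y (delta_mx 0 i).
Proof.
rewrite {1}(row_sum_delta w) linear_sum; apply: eq_bigr => i _.
by rewrite linearZ.
Qed.

(** [Ck] speaks of ['d g y v] for fixed v only, whereas the chain rule evaluates ['d g (f x)] at a
    vector that depends on x. Expanding this vector in the standard basis separates the two
    dependences; hence rows as the middle space. *)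
Lemma Ck_comp V W n k (U : set V) (U' : set 'rV[R]_n) (f : V -> 'rV[R]_n)
    (g : 'rV[R]_n -> W) : open U -> (forall x, U x -> U' (f x)) ->
  Ck k U f -> Ck k U' g -> Ck k U (g \o f).
Proof.
move=> oU fU; elim: k g => [|k IH] g /=.
  move=> fc gc x Ux; apply: continuous_comp; first exact: fc.
  exact/gc/fU.
move=> [fd fk] [gd gk]; split=> [x Ux|v].
  by apply: differentiable_comp; [exact: fd|exact/gd/fU].
have fS : Ck k U f by apply: CkS; split.
have E x : U x -> \sum_(i <- index_enum 'I_n) ('d f x v : 'rV_n) 0 i *:
    'd g (f x) (delta_mx 0 i) = 'd (g \o f) x v.
  by move=> Ux; rewrite (diff_comp (fd x Ux) (gd _ (fU _ Ux))) /= diff_row.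
apply: (Ck_ext oU E); apply: (Ck_sum _ oU) => i; apply: (CkZ oU).
  exact: (Ck_linear_comp oU (@coord_linear 1 n 0 i) (@coord_continuous _ _ _ 0 i) (fk v)).
exact: (IH _ fS (gk _)).
Qed.

End Ck_theory.

Lemma near_open (T : topologicalType) (a : T) (P : T -> Prop) :
  (\forall x \near a, P x) -> exists B : set T, [/\ open B, B a & forall x, B x -> P x].
Proof. by rewrite /prop_near1 nbhsE => -[B [oB Ba] BP]; exists B. Qed.

Lemma near_comp (S T : topologicalType) (f : S -> T) (x : S) (P : T -> Prop) :
  {for x, continuous f} -> (\forall y \near f x, P y) -> \forall z \near x, P (f z).
Proof. by move=> fc; exact: fc. Qed.

(** * Smoothness at a point and its closure under algebraic operations *)

Section Coo_at_theory.
Variables (R : realType).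
Implicit Types (V W : normedModType R).

Lemma Coo_at_ext V W (f g : V -> W) a :
  (\forall x \near a, f x = g x) -> Coo_at f a -> Coo_at g a.
Proof.
move=> /near_open[B [oB Ba fg]] [U [oU Ua fU]].
exists (U `&` B); split=> //; first exact: openI.
move=> k; apply: (@Ck_ext R V W k _ f); first exact: openI.
  by move=> x [_ /fg].
by apply: Ck_subset (fU k) => x [].
Qed.

Lemma Coo_at_near V W (f : V -> W) a : Coo_at f a -> \forall x \near a, Coo_at f x.
Proof.
move=> [U [oU Ua fU]].
by apply: filterS (open_nbhs_nbhs (conj oU Ua)) => x Ux; exists U.
Qed.

Lemma Coo_at_differentiable V W (f : V -> W) a : Coo_at f a -> differentiable f a.
Proof. by move=> [U [oU Ua fU]]; have [fd _] := fU 1; exact: fd. Qed.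

Lemma Coo_at_continuous V W (f : V -> W) a : Coo_at f a -> {for a, continuous f}.
Proof. by move=> /Coo_at_differentiable/differentiable_continuous. Qed.

Lemma Coo_at_diff V W (f : V -> W) a v :
  Coo_at f a -> Coo_at (fun x => 'd f x v) a.
Proof.
by move=> [U [oU Ua fU]]; exists U; split=> // k; have [_] := fU k.+1; exact.
Qed.

Lemma Coo_at_cst V W (c : W) (a : V) : Coo_at (fun _ => c) a.
Proof. by exists setT; split=> //; [exact: openT|move=> k; exact: Ck_cst]. Qed.

Lemma Coo_at_linear V W (g : V -> W) a :
  linear g -> continuous g -> Coo_at g a.
Proof.
by exists setT; split=> //; [exact: openT|move=> k; exact: Ck_linear].
Qed.

Lemma Coo_at_id V (a : V) : Coo_at (fun x => x) a.
Proof. by apply: Coo_at_linear => // x; exact: cvg_id. Qed.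

Lemma Coo_at_lift2 V W (V1 W1 : normedModType R) (V2 W2 : normedModType R)
    (f : V -> W) (g : V -> W1) (h : V -> W2) a :
  (forall (U : set V) k, open U -> Ck k U f -> Ck k U g -> Ck k U h) ->
  Coo_at f a -> Coo_at g a -> Coo_at h a.
Proof.
move=> H [U [oU Ua fU]] [B [oB Ba gB]]; exists (U `&` B); split=> //.
  exact: openI.
move=> k; apply: H; first exact: openI.
  by apply: Ck_subset (fU k) => x [].
by apply: Ck_subset (gB k) => x [].
Qed.

Lemma Coo_atD V W (f g : V -> W) a :
  Coo_at f a -> Coo_at g a -> Coo_at (fun x => f x + g x) a.
Proof. by apply: Coo_at_lift2 => // U k; exact: CkD. Qed.

Lemma Coo_atZ V W (f : V -> R) (g : V -> W) a :
  Coo_at f a -> Coo_at g a -> Coo_at (fun x => f x *: g x) a.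
Proof. by apply: Coo_at_lift2 => // U k; exact: CkZ. Qed.

Lemma Coo_atM V (f g : V -> R) a :
  Coo_at f a -> Coo_at g a -> Coo_at (fun x => f x * g x) a.
Proof. exact: (@Coo_atZ V R). Qed.

Lemma Coo_at_sum V W (I : Type) (r : seq I) (P : pred I) (f : I -> V -> W) a :
  (forall i, P i -> Coo_at (f i) a) -> Coo_at (fun x => \sum_(i <- r | P i) f i x) a.
Proof.
move=> fa; elim: r => [|i r IH].
  by apply: Coo_at_ext (Coo_at_cst 0 a); near=> x; rewrite big_nil.
case Pi: (P i); last by apply: Coo_at_ext IH; near=> x; rewrite big_cons Pi.
apply: Coo_at_ext (Coo_atD (fa i Pi) IH); near=> x; by rewrite big_cons Pi.
Unshelve. all: by end_near. Qed.

Lemma Coo_at_prod V (I : Type) (r : seq I) (P : pred I) (f : I -> V -> R) a :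
  (forall i, P i -> Coo_at (f i) a) -> Coo_at (fun x => \prod_(i <- r | P i) f i x) a.
Proof.
move=> fa; elim: r => [|i r IH].
  by apply: Coo_at_ext (@Coo_at_cst V R 1 a); near=> x; rewrite big_nil.
case Pi: (P i); last by apply: Coo_at_ext IH; near=> x; rewrite big_cons Pi.
apply: Coo_at_ext (Coo_atM (fa i Pi) IH); near=> x; by rewrite big_cons Pi.
Unshelve. all: by end_near. Qed.

Lemma Coo_at_mx V m n (f : V -> 'M[R]_(m, n)) a :
  (forall i j, Coo_at (fun x => f x i j : R) a) -> Coo_at f a.
Proof.
move=> fa.
apply: (@Coo_at_ext _ _ (fun x => \sum_i \sum_j f x i j *: delta_mx i j)).
  by near=> x; rewrite -matrix_sum_delta.
apply: Coo_at_sum => i _; apply: Coo_at_sum => j _; apply: Coo_atZ => //.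
exact: Coo_at_cst.
Unshelve. all: by end_near. Qed.

Lemma Coo_at_linear_comp V W (W' : normedModType R) (f : V -> W) (g : W -> W') a :
  linear g -> continuous g -> Coo_at f a -> Coo_at (fun x => g (f x)) a.
Proof.
move=> gl gc [U [oU Ua fU]]; exists U; split=> // k.
exact: (Ck_linear_comp oU gl gc (fU k)).
Qed.

Lemma Coo_at_coord V m n (f : V -> 'M[R]_(m, n)) i j a :
  Coo_at f a -> Coo_at (fun x => f x i j : R) a.
Proof.
by apply: (@Coo_at_linear_comp _ _ _ f (fun M : 'M[R]_(m, n) => M i j : R));
  [exact: coord_linear|exact: coord_continuous].
Qed.

Lemma Coo_at_mulmx V m n p (f : V -> 'M[R]_(m, n)) (g : V -> 'M[R]_(n, p)) a :
  Coo_at f a -> Coo_at g a -> Coo_at (fun x => f x *m g x) a.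
Proof.
move=> fa ga; apply: Coo_at_mx => i j.
apply: (@Coo_at_ext _ _ (fun x => \sum_k (f x i k * g x k j))).
  by near=> x; rewrite mxE.
apply: Coo_at_sum => k _; apply: Coo_atM; exact: Coo_at_coord.
Unshelve. all: by end_near. Qed.

Lemma Coo_at_trmx V m n (f : V -> 'M[R]_(m, n)) a :
  Coo_at f a -> Coo_at (fun x => (f x)^T) a.
Proof.
move=> fa; apply: Coo_at_mx => i j.
apply: (@Coo_at_ext _ _ (fun x => f x j i)); last exact: Coo_at_coord.
by near=> x; rewrite mxE.
Unshelve. all: by end_near. Qed.

Lemma Coo_at_comp V W n (f : V -> 'rV[R]_n) (g : 'rV[R]_n -> W) a :
  Coo_at f a -> Coo_at g (f a) -> Coo_at (fun x => g (f x)) a.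
Proof.
move=> fC [U' [oU' Ua' gU]].
have : \forall x \near a, U' (f x).
  by apply: (Coo_at_continuous fC); exact: open_nbhs_nbhs.
move=> /near_open[B [oB Ba BU]]; move: fC => [U [oU Ua fU]].
exists (U `&` B); split=> //; first exact: openI.
move=> k; apply: (@Ck_comp _ _ _ _ _ _ U' f g) => //; first exact: openI.
  by move=> x [_ /BU].
by apply: Ck_subset (fU k) => x [].
Qed.

Lemma Coo_at_diff2 V W n (g : 'rV[R]_n -> W) (f w : V -> 'rV[R]_n) a :
  Coo_at g (f a) -> Coo_at f a -> Coo_at w a ->
  Coo_at (fun x => 'd g (f x) (w x)) a.
Proof.
move=> ga fa wa.
apply: (@Coo_at_ext _ _ (fun x => \sum_i w x 0 i *: 'd g (f x) (delta_mx 0 i))).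
  by near=> x; rewrite [RHS]diff_row.
apply: Coo_at_sum => i _; apply: Coo_atZ; first exact: Coo_at_coord.
by apply: (@Coo_at_comp _ _ _ f (fun y => 'd g y (delta_mx 0 i))) => //; exact: Coo_at_diff.
Unshelve. all: by end_near. Qed.

(** The derivative - f^-1 f^-1 df contains only f^-1 itself and df, so the induction on k closes. *)
Lemma Ck_inv V k (U : set V) (f : V -> R) : open U -> (forall x, U x -> f x != 0) ->
  Ck k U f -> Ck k U (fun x => (f x)^-1).
Proof.
move=> oU f0; elim: k => [|k IH].
  by move=> fc x Ux; apply: continuousV; [exact: f0|exact: fc].
move=> fk; have [fd fv] := fk; have i := IH (CkS fk).
split=> [x Ux|v]; first by apply: differentiableV; [exact: fd|exact: f0].
have E x : U x -> (- 1) *: ((f x)^-1 *: ((f x)^-1 *: ('d f x v : R))) =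
    'd (fun y => (f y)^-1 : R) x v.
  move=> Ux; apply: eq_trans _ (esym (congr1 (fun l : V -> R => l v)
    (diffV (fd x Ux) (f0 x Ux)))).
  by rewrite /GRing.scale /= -[RHS]/(- f x ^- 2 * 'd f x v) mulN1r mulrA -invfM -expr2 mulNr.
apply: (Ck_ext oU E); apply: (CkZ oU); first exact: Ck_cst.
by apply: (CkZ oU) => //; apply: (CkZ oU) => //; exact: fv.
Qed.

Lemma Coo_at_inv V (f : V -> R) a : f a != 0 -> Coo_at f a ->
  Coo_at (fun x => (f x)^-1) a.
Proof.
move=> f0 fa; have : \forall x \near a, f x != 0.
  exact: (Coo_at_continuous fa) (open_nbhs_nbhs (conj (@open_neq R 0) f0)).
move=> /near_open[B [oB Ba BU]]; move: fa => [U [oU Ua fU]].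
exists (U `&` B); split=> //; first exact: openI.
move=> k; apply: Ck_inv; first exact: openI.
  by move=> x [_ /BU].
by apply: Ck_subset (fU k) => x [].
Qed.

Lemma is_diff_sqrt (y : R) : 0 < y ->
  is_diff y (@Num.sqrt R) (fun h => h * (2 * Num.sqrt y)^-1).
Proof.
move=> y0; have [D E] := is_derive1_sqrt y0.
apply: DiffDef; first exact/derivable1_diffP.
rewrite deriv1E //; apply/funext => h; by rewrite derive1E E.
Qed.

(** The derivative - 1/2 f^-1 f^(-1/2) df again contains f^(-1/2), so the induction closes with only
    the first derivative of the square root. *)
Lemma Ck_invsqrt V k (U : set V) (f : V -> R) : open U -> (forall x, U x -> 0 < f x) ->
  Ck k U f -> Ck k U (fun x => (Num.sqrt (f x))^-1).
Proof.
move=> oU f0; have s0 x : U x -> Num.sqrt (f x) != 0.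
  by move=> Ux; rewrite gt_eqF // sqrtr_gt0 f0.
elim: k => [|k IH].
  move=> fc x Ux; apply: continuousV; first exact: s0.
  by apply: continuous_comp; [exact: fc|exact: sqrt_continuous].
move=> fk; have [fd fv] := fk; have i := IH (CkS fk).
have sd x (Ux : U x) : differentiable (fun z => Num.sqrt (f z)) x.
  apply: (differentiable_comp (fd x Ux)).
  by have [] := is_diff_sqrt (f0 x Ux).
split=> [x Ux|v]; first by apply: differentiableV; [exact: sd|exact: s0].
have E x : U x -> (- 2^-1) *: ((f x)^-1 *: ((Num.sqrt (f x))^-1 *: ('d f x v : R))) =
    'd (fun y => (Num.sqrt (f y))^-1 : R) x v.
  move=> Ux; have [sd1 sE] := is_diff_sqrt (f0 x Ux).
  have E1 : 'd (fun z => Num.sqrt (f z)) x v = 'd f x v * (2 * Num.sqrt (f x))^-1.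
    by apply: eq_trans (congr1 (fun l : V -> R => l v)
      (diff_comp (fd x Ux) sd1)) _; exact: (congr1 (fun l : R -> R => l _) sE).
  apply: eq_trans _ (esym (eq_trans (congr1 (fun l : V -> R => l v)
    (diffV (sd x Ux) (s0 x Ux)))
    (congr1 (fun t : R => - Num.sqrt (f x) ^- 2 * t) E1))).
  rewrite /GRing.scale /= sqr_sqrtr ?ltW ?f0 // invfM; ring.
apply: (Ck_ext oU E); apply: (CkZ oU); first exact: Ck_cst.
apply: (CkZ oU); last by apply: (CkZ oU) => //; exact: fv.
by apply: Ck_inv => //; [move=> x Ux; rewrite gt_eqF ?f0|exact: CkS].
Qed.

Lemma Coo_at_invsqrt V (f : V -> R) a : 0 < f a -> Coo_at f a ->
  Coo_at (fun x => (Num.sqrt (f x))^-1) a.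
Proof.
move=> f0 fa; have : \forall x \near a, 0 < f x.
  exact: (Coo_at_continuous fa) (open_nbhs_nbhs (conj (@open_gt R 0) f0)).
move=> /near_open[B [oB Ba BU]]; move: fa => [U [oU Ua fU]].
exists (U `&` B); split=> //; first exact: openI.
move=> k; apply: Ck_invsqrt; first exact: openI.
  by move=> x [_ /BU].
by apply: Ck_subset (fU k) => x [].
Qed.

Lemma Coo_at_det V n (f : V -> 'M[R]_n) a :
  Coo_at f a -> Coo_at (fun x => \det (f x)) a.
Proof.
move=> fa; apply: Coo_at_sum => s _; apply: Coo_atM; first exact: Coo_at_cst.
by apply: Coo_at_prod => i _; exact: Coo_at_coord.
Qed.

(** Cramer's formula. Invertibility is assumed near a, since [invmx] returns a singular matrix
    unchanged and the formula would fail there. *)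
Lemma Coo_at_invmx V n (f : V -> 'M[R]_n) a : (\forall x \near a, f x \in unitmx) ->
  Coo_at f a -> Coo_at (fun x => invmx (f x)) a.
Proof.
move=> fu fa; apply: (@Coo_at_ext _ _ (fun x => (\det (f x))^-1 *: \adj (f x))).
  by near=> x; rewrite /invmx (near fu x).
apply: Coo_atZ.
  apply: Coo_at_inv; last exact: Coo_at_det.
  by have := nbhs_singleton fu; rewrite unitmxE unitfE.
apply: Coo_at_mx => i j.
apply: (@Coo_at_ext _ _ (fun x => (-1) ^+ (j + i) * \det (row' j (col' i (f x))))).
  by near=> x; rewrite !mxE.
apply: Coo_atM; first exact: Coo_at_cst.
apply: Coo_at_det; apply: Coo_at_mx => k l.
apply: (@Coo_at_ext _ _ (fun x => f x (lift j k) (lift i l))).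
  by near=> x; rewrite !mxE.
exact: Coo_at_coord.
Unshelve. all: by end_near. Qed.

End Coo_at_theory.

(** * Mean value estimates, symmetry of second derivatives, Taylor bounds *)

Section mean_value.
Variable R : realType.
Implicit Types V W : normedModType R.

Lemma is_derive_line V W (f : V -> W) (p u : V) (t : R) :
  differentiable f (p + t *: u) ->
  is_derive t 1 (fun s : R => f (p + s *: u)) ('d f (p + t *: u) u).
Proof.
move=> fd.
have ld : is_diff t (fun s : R => p + s *: u) (fun h => 0 + h *: u).
  exact: is_diffD (is_diff_cst p t) (is_diff_scalel t u).
have [ld1 lE] := ld.
have cd : differentiable (fun s : R => f (p + s *: u)) t := differentiable_comp ld1 fd.
apply: DeriveDef; first exact: diff_derivable.
rewrite deriveE //.
apply: eq_trans (congr1 (fun l : R -> W => l 1) (diff_comp ld1 fd)) _ => /=.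
by congr ('d f _ _); apply: eq_trans (congr1 (fun l : R -> V => l 1) lE) _; rewrite add0r scale1r.
Qed.

Lemma MVT01 (f df : R -> R) :
  (forall t : R, 0 <= t <= 1 -> is_derive t 1 f (df t)) ->
  exists2 c, 0 <= c <= 1 & f 1 - f 0 = df c.
Proof.
move=> fd; have [] := @MVT_segment R f df 0 1 ler01.
- by move=> x; rewrite in_itv /= => /andP[x0 x1]; apply: fd; rewrite !ltW.
- apply: derivable_within_continuous => x; rewrite in_itv /= => x01.
  by have [] := fd x x01.
by move=> c; rewrite in_itv /= subr0 mulr1 => c01 ->; exists c.
Qed.

(** The mean value theorem in the direction v turns the second difference into s times an increment
    of x |-> ['d f x v], which is differentiable at a. The errors at the two end points are at most
    e s (|v| + |w|) and e s |v|, which add up to the stated constant. *)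
Lemma second_difference V (f : V -> R) (a v w : V) (e : R) :
  Coo_at f a -> 0 < e -> exists2 d, 0 < d & forall s, 0 < s < d ->
  `|f (a + s *: v + s *: w) - f (a + s *: v) - (f (a + s *: w) - f a)
    - s ^+ 2 * ('d (fun x => 'd f x v : R) a w : R)|
    <= e * (2 * `|v| + `|w|) * s ^+ 2.
Proof.
move=> fa e0; set g := fun x => 'd f x v : R.
have ga : Coo_at g a by exact: Coo_at_diff.
have : \forall h \near (0 : V), differentiable f (h + a) /\
    `|g (h + a) - g a - 'd g a h| <= e * `|h|.
  near=> h; split; near: h; last exact: diff_eps (Coo_at_differentiable ga) _ e0.
  apply: (near_shift0 (P := fun y => differentiable f y)).
  by apply: filterS (Coo_at_near fa) => y /Coo_at_differentiable.
move=> /nbhs_norm0P[d /= d0 dP].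
have vw : 0 < `|v| + `|w| + 1 by rewrite ltr_wpDl // addr_ge0.
exists (d / (`|v| + `|w| + 1)); first exact: divr_gt0.
move=> s /andP[s0 sd].
have small (c : R) (b : R) : 0 <= c <= 1 -> 0 <= b <= 1 ->
    `|c *: (s *: v) + b *: (s *: w)| < d.
  move=> /andP[c0 c1] /andP[b0 b1]; apply: le_lt_trans (ler_normD _ _) _.
  rewrite !normrZ !ger0_norm ?(ltW s0) //.
  rewrite ltr_pdivlMr // in sd; apply: le_lt_trans sd.
  rewrite !mulrDr mulr1.
  have h1 : c * (s * `|v|) <= s * `|v| by rewrite ler_piMl // mulr_ge0 // ltW.
  have h2 : b * (s * `|w|) <= s * `|w| by rewrite ler_piMl // mulr_ge0 // ltW.
  by have := ltW s0; lra.
have zz : (0 : R) <= (0 : R) <= (1 : R) by rewrite lexx ler01.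
have oo : (0 : R) <= (1 : R) <= (1 : R) by rewrite lexx ler01.
have [c c01 E] : exists2 c : R, 0 <= c <= 1 &
    f (a + s *: v + s *: w) - f (a + s *: v) - (f (a + s *: w) - f a) =
    s * (g (c *: (s *: v) + s *: w + a) - g (c *: (s *: v) + a)).
  (* The first difference in the direction w, as a function of the progress t in the direction v. *)
  have Q := @MVT01 (fun t => f (a + s *: w + t *: (s *: v)) - f (a + t *: (s *: v)))
     (fun t => s * (g (t *: (s *: v) + s *: w + a) - g (t *: (s *: v) + a))).
  case: Q => [t t01|c c01 E].
    have A1 : a + s *: w + t *: (s *: v) = t *: (s *: v) + s *: w + a.
      by rewrite addrC -addrA (addrC a).
    have A2 : a + t *: (s *: v) = t *: (s *: v) + a by rewrite addrC.
    have d1 : differentiable f (a + s *: w + t *: (s *: v)).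
      by rewrite A1 -[s *: w]scale1r; apply: (dP _ _).1; rewrite /= small.
    have d2 : differentiable f (a + t *: (s *: v)).
      rewrite A2 -[t *: (s *: v)]addr0 -(scale0r (s *: w)); apply: (dP _ _).1.
      by rewrite /= small.
    have -> : s * (g (t *: (s *: v) + s *: w + a) - g (t *: (s *: v) + a)) =
       ('d f (a + s *: w + t *: (s *: v)) (s *: v) : R) - 'd f (a + t *: (s *: v)) (s *: v).
      have gz z : ('d f z (s *: v) : R) = s * g z by exact: linearZ.
      by rewrite !gz A1 A2 mulrBr.
    exact: is_deriveB (is_derive_line d1) (is_derive_line d2).
  exists c => //; rewrite -E !scale1r !scale0r !addr0.
  by rewrite (addrAC a (s *: w)).
rewrite E.
set x := c *: (s *: v) + s *: w; set y := c *: (s *: v).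
have hx : `|g (x + a) - g a - 'd g a x| <= e * `|x|.
  by apply: (dP _ _).2; rewrite /= /x -[s *: w]scale1r small.
have hy : `|g (y + a) - g a - 'd g a y| <= e * `|y|.
  by apply: (dP _ _).2; rewrite /= -[y]addr0 -(scale0r (s *: w)) small.
have dE : 'd g a x - 'd g a y = s * 'd g a w.
  by rewrite -linearB /x addrAC subrr add0r linearZ.
have -> : s * (g (x + a) - g (y + a)) - s ^+ 2 * 'd g a w =
    s * ((g (x + a) - g a - 'd g a x) - (g (y + a) - g a - 'd g a y)).
  by rewrite expr2 -mulrA -dE; ring.
rewrite normrM (gtr0_norm s0) expr2 mulrA [leLHS]mulrC ler_pM2r //.
apply: le_trans (ler_normB _ _) _; apply: le_trans (lerD hx hy) _.
have s0' := ltW s0; move: c01 => /andP[c0 c1].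
have yv : `|y| <= s * `|v|.
  by rewrite !normrZ !ger0_norm // ler_piMl // mulr_ge0.
have xv : `|x| <= s * `|v| + s * `|w|.
  apply: le_trans (ler_normD _ _) _; apply: lerD => //.
  by rewrite normrZ ger0_norm.
rewrite -mulrDr -mulrA ler_pM2l //.
by apply: le_trans (lerD xv yv) _; lra.
Unshelve. all: by end_near. Qed.

(** The second difference is unchanged when v and w are exchanged, and it approximates both mixed
    derivatives. *)
Lemma schwarz V (f : V -> R) (a v w : V) : Coo_at f a ->
  'd (fun x => 'd f x v : R) a w = 'd (fun x => 'd f x w : R) a v :> R.
Proof.
move=> fa; apply/eqP; rewrite -subr_eq0 -normr_le0.
set X := 'd _ a w : R; set Y := 'd _ a v : R.
(* The two error constants 2|v| + |w| and 2|w| + |v| add up to 3(|v| + |w|); the summand 1 makes N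
   positive. *)
pose N := 3 * (`|v| + `|w|) + 1.
have N0 : 0 < N by rewrite /N; have := normr_ge0 v; have := normr_ge0 w; lra.
apply/ler_addgt0Pl => e e0; rewrite addr0.
have e1 : 0 < e / N by exact: divr_gt0.
have [d1 d10 H1] := second_difference v w fa e1.
have [d2 d20 H2] := second_difference w v fa e1.
pose s := Num.min d1 d2 / 2.
have m0 : 0 < Num.min d1 d2 by rewrite lt_min d10.
have s0 : 0 < s by rewrite divr_gt0.
have sm : s < Num.min d1 d2 by rewrite ltr_pdivrMr // ltr_pMr // ltr1n.
have h1 : 0 < s < d1 by rewrite s0 (lt_le_trans sm) // ge_min lexx.
have h2 : 0 < s < d2 by rewrite s0 (lt_le_trans sm) // ge_min lexx orbT.
have {H1} := H1 s h1; have {H2} := H2 s h2.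
rewrite -/X -/Y (addrAC a (s *: w)).
set D1 := _ - _ - (_ - _) => B2; set D2 := _ - _ - (_ - _) => B1.
have DE : D1 = D2 by rewrite /D1 /D2; ring.
rewrite DE in B2 => {D1 DE}.
have s20 : 0 < s ^+ 2 by rewrite exprn_gt0.
rewrite -(ler_pM2r s20).
have -> : `|X - Y| * s ^+ 2 = `|(D2 - s ^+ 2 * Y) - (D2 - s ^+ 2 * X)|.
  have -> : (D2 - s ^+ 2 * Y) - (D2 - s ^+ 2 * X) = s ^+ 2 * (X - Y) by ring.
  by rewrite normrM (gtr0_norm s20) mulrC.
apply: le_trans (ler_normB _ _) _; apply: le_trans (lerD B2 B1) _.
rewrite -mulrDl ler_pM2r // -mulrDr mulrAC ler_pdivrMr // ler_pM2l // /N.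
by lra.
Qed.

Lemma mx_norm_le m n (M : 'M[R]_(m, n)) (C : R) : 0 <= C ->
  (forall i j, `|M i j| <= C) -> `|M| <= C.
Proof.
move=> C0 H; rewrite [leLHS]/Num.Def.normr/= mx_normrE.
by apply: bigmax_le => // i _; exact: H.
Qed.

Lemma mx_coord_le m n (M : 'M[R]_(m, n)) i j : `|M i j| <= `|M|.
Proof.
rewrite [leRHS]/Num.Def.normr/= mx_normrE.
exact: (le_bigmax _ (fun ij : 'I_m * 'I_n => `|M ij.1 ij.2|) (i, j)).
Qed.

Lemma diff_linear_comp V W (W' : normedModType R) (f : V -> W) (g : W -> W')
    (x v : V) : linear g -> continuous g -> differentiable f x ->
  'd (fun y => g (f y)) x v = g ('d f x v).
Proof.
move=> gl gc fd.
pose gM := GRing.isLinear.Build _ _ _ _ _ gl.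
pose gL : {linear W -> W'} := HB.pack g gM.
have gd y : differentiable g y by exact: (@linear_differentiable _ _ _ gL).
have gE y : 'd g y = g :> (W -> W') by exact: (@diff_lin _ _ _ gL).
apply: eq_trans (congr1 (fun l : V -> W' => l v) (diff_comp fd (gd _))) _.
exact: (congr1 (fun l : W -> W' => l _) (gE _)).
Qed.

Lemma diff_coord V m n (f : V -> 'M[R]_(m, n)) x v i j : differentiable f x ->
  'd (fun y => f y i j : R) x v = ('d f x v : 'M[R]_(m, n)) i j.
Proof.
apply: (@diff_linear_comp _ _ _ f (fun M : 'M[R]_(m, n) => M i j : R)).
  exact: coord_linear.
exact: coord_continuous.
Qed.

Lemma schwarz_mx V m n (f : V -> 'M[R]_(m, n)) (a v w : V) : Coo_at f a ->
  'd (fun x => 'd f x v) a w = 'd (fun x => 'd f x w) a v.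
Proof.
move=> fa; apply/matrixP => i j.
have E u z : ('d (fun x => 'd f x u) a z : 'M[R]_(m, n)) i j =
    'd (fun x => 'd (fun y => f y i j : R) x u : R) a z.
  have d1 : differentiable (fun x => 'd f x u) a.
    exact: Coo_at_differentiable (Coo_at_diff _ fa).
  apply: eq_trans (esym (diff_coord _ _ _ d1)) _.
  apply: (congr1 (fun l : V -> R => l z)); apply: near_diff.
  apply: filterS (Coo_at_near fa) => x /Coo_at_differentiable fx.
  exact: esym (diff_coord _ _ _ fx).
rewrite !E; apply: schwarz; exact: Coo_at_coord.
Qed.

Lemma linear_row_bound n W (l : 'rV[R]_n -> W) (C : R) (h : 'rV[R]_n) :
  linear l -> (forall i, `|l (delta_mx 0 i)| <= C) -> `|l h| <= n%:R * C * `|h|.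
Proof.
move=> ll lC.
pose lM := GRing.isLinear.Build _ _ _ _ _ ll.
pose lL : {linear 'rV[R]_n -> W} := HB.pack l lM.
have -> : l h = \sum_i h 0 i *: l (delta_mx 0 i).
  rewrite {1}(row_sum_delta h) -[LHS]/(lL _) linear_sum; apply: eq_bigr => i _.
  by rewrite linearZ.
apply: le_trans (ler_norm_sum _ _ _) _.
have -> : n%:R * C * `|h| = \sum_(i < n) (`|h| * C).
  by rewrite sumr_const card_ord -[in RHS]mulr_natl mulrA mulrAC.
apply: ler_sum => i _; rewrite normrZ ler_pM //; exact: mx_coord_le.
Qed.

Lemma segment_ball n (a x y : 'rV[R]_n) (r t : R) : 0 <= t <= 1 ->
  `|x - a| < r -> `|y - a| < r -> `|x + t *: (y - x) - a| < r.
Proof.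
move=> /andP[t0 t1] xr yr.
have -> : x + t *: (y - x) - a = (1 - t) *: (x - a) + t *: (y - a).
  by rewrite !scalerBr !scalerBl !scale1r; apply/rowP => i; rewrite !mxE; ring.
apply: le_lt_trans (ler_normD _ _) _; rewrite !normrZ.
rewrite (ger0_norm t0) ger0_norm ?subr_ge0 //.
have [->|tn0] := eqVneq t 0; first by rewrite subr0 mul1r mul0r addr0.
have tp : 0 < t by rewrite lt_def tn0.
have h1 : t * `|y - a| < t * r by rewrite ltr_pM2l.
have h2 : (1 - t) * `|x - a| <= (1 - t) * r by rewrite ler_wpM2l ?subr_ge0 // ltW.
by lra.
Qed.

Lemma MVT_row n (f : 'rV[R]_n -> R) (x y : 'rV[R]_n) :
  (forall t, 0 <= t <= 1 -> differentiable f (x + t *: (y - x))) ->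
  exists2 c, 0 <= c <= 1 & f y - f x = 'd f (x + c *: (y - x)) (y - x).
Proof.
move=> fd; have [|c c01 E] := @MVT01 (fun t => f (x + t *: (y - x)))
    (fun t => 'd f (x + t *: (y - x)) (y - x)).
  by move=> t /fd; exact: is_derive_line.
by exists c => //; rewrite -E scale1r scale0r addr0 [x + _]addrC subrK.
Qed.

Lemma locally_lipschitz1 n (f : 'rV[R]_n -> R) a : Coo_at f a ->
  exists2 C, 0 <= C & exists2 r, 0 < r & forall x y,
    `|x - a| < r -> `|y - a| < r -> `|f y - f x| <= C * `|y - x|.
Proof.
move=> fa.
(* Because of the summands 1, C0 strictly exceeds every partial derivative at a in absolute value,
   and by continuity it still does so near a. *)
pose C0 : R := \sum_(i < n) (`|('d f a (delta_mx 0 i) : R)| + 1).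
have CI i : `|('d f a (delta_mx 0 i) : R)| < C0.
  rewrite /C0 (bigD1 i) //= -[X in X < _]addr0 -addrA ltrD2l.
  by rewrite ltr_pwDl // sumr_ge0 // => j _; rewrite addr_ge0.
have C00 : 0 <= C0 by apply: sumr_ge0 => i _; rewrite addr_ge0.
have : \forall x \near a, differentiable f x /\
    forall i, `|('d f x (delta_mx 0 i) : R)| < C0.
  near=> x; split; near: x.
    by apply: filterS (Coo_at_near fa) => x /Coo_at_differentiable.
  apply: filter_forall => i.
  have gc : {for a, continuous (fun x => `|('d f x (delta_mx 0 i) : R)|)}.
    apply: continuous_comp; last exact: norm_continuous.
    exact: (Coo_at_continuous (Coo_at_diff _ fa)).
  exact: gc (open_nbhs_nbhs (conj (@open_lt R C0) (CI i))).
move=> /nbhs_normP[r /= r0 rP]; exists (n%:R * C0); first by rewrite mulr_ge0.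
exists r => // x y xr yr.
have dP t : 0 <= t <= 1 -> `|a - (x + t *: (y - x))| < r.
  by move=> t01; rewrite distrC segment_ball.
have [t /dP/rP[]//|c /dP/rP[_ cC] ->] := @MVT_row n f x y.
apply: linear_row_bound; first exact: linearP.
by move=> i; exact: ltW (cC i).
Unshelve. all: by end_near. Qed.

(** Sum of the constants and minimum of the radii. It carries local estimates from the entries of a
    matrix to the matrix. *)
Lemma common_bound (I : finType) (Q : I -> R -> R -> Prop) :
  (forall i C r C' r', Q i C r -> C <= C' -> 0 < r' -> r' <= r -> Q i C' r') ->
  (forall i, exists2 C, 0 <= C & exists2 r, 0 < r & Q i C r) ->
  exists2 C, 0 <= C & exists2 r, 0 < r & forall i, Q i C r.
Proof.
move=> mono H.
have [Cf Cf0] : {Cf : I -> R & forall i, 0 <= Cf i /\ exists2 r, 0 < r & Q i (Cf i) r}.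
  apply: (choice (P := fun i C => 0 <= C /\ exists2 r, 0 < r & Q i C r)).
  by move=> i; have [C ? ?] := H i; exists C.
have [rf rf0] : {rf : I -> R & forall i, 0 < rf i /\ Q i (Cf i) (rf i)}.
  apply: (choice (P := fun i r => 0 < r /\ Q i (Cf i) r)).
  by move=> i; have [_ [r ? ?]] := Cf0 i; exists r.
exists (\sum_i Cf i); first by apply: sumr_ge0 => i _; have [] := Cf0 i.
exists (\big[Num.min/1]_i rf i).
  by apply: lt_bigmin => // i _; have [] := rf0 i.
move=> i; have [r0 q] := rf0 i; apply: mono q _ _ _.
- by rewrite (bigD1 i) //= lerDl sumr_ge0 // => j _; have [] := Cf0 j.
- by apply: lt_bigmin => // j _; have [] := rf0 j.
- exact: bigmin_le.
Qed.

Lemma locally_lipschitz n p q (f : 'rV[R]_n -> 'M[R]_(p, q)) a : Coo_at f a ->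
  exists2 C, 0 <= C & exists2 r, 0 < r & forall x y,
    `|x - a| < r -> `|y - a| < r -> `|f y - f x| <= C * `|y - x|.
Proof.
move=> fa.
have := @common_bound ('I_p * 'I_q)%type (fun ij C r => forall x y,
    `|x - a| < r -> `|y - a| < r ->
    `|f y ij.1 ij.2 - f x ij.1 ij.2| <= C * `|y - x|).
case.
- move=> ij C r C' r' H CC r0 rr x y xr yr.
  apply: le_trans (H x y _ _) _; rewrite ?(lt_le_trans _ rr) //.
  by rewrite ler_wpM2r.
- by move=> [i j]; apply: locally_lipschitz1; exact: Coo_at_coord.
move=> C C0 [r r0 H]; exists C => //; exists r => // x y xr yr.
apply: mx_norm_le; first by rewrite mulr_ge0.
by move=> i j; rewrite !mxE; exact: (H (i, j)).
Qed.

Lemma linear_sub V W (l1 l2 : {linear V -> W}) : linear (fun h => l1 h - l2 h).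
Proof.
move=> k u v; rewrite (linearP l1) (linearP l2) scalerBr.
by rewrite addrACA -opprD.
Qed.

(** The increment is ['d f z (y - x)] for some z on the segment, and the partial derivatives are
    Lipschitz near a, so the error is at most a constant times |z - x| |y - x|. *)
Lemma locally_taylor1 n (f : 'rV[R]_n -> R) a : Coo_at f a ->
  exists2 C, 0 <= C & exists2 r, 0 < r & forall x y,
    `|x - a| < r -> `|y - a| < r ->
    `|f y - f x - 'd f x (y - x)| <= C * `|y - x| ^+ 2.
Proof.
move=> fa.
have [] := @common_bound 'I_n (fun i C r => forall x y,
    `|x - a| < r -> `|y - a| < r ->
    `|('d f y (delta_mx 0 i) : R) - 'd f x (delta_mx 0 i)| <= C * `|y - x|).
- move=> i C r C' r' H CC r0 rr x y xr yr.
  apply: le_trans (H x y _ _) _; rewrite ?(lt_le_trans _ rr) //.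
  by rewrite ler_wpM2r.
- move=> i; apply: (@locally_lipschitz1 n (fun x => 'd f x (delta_mx 0 i))).
  exact: Coo_at_diff.
move=> C C0 [r r0 H]; exists (n%:R * C); first by rewrite mulr_ge0.
have : \forall x \near a, differentiable f x.
  by apply: filterS (Coo_at_near fa) => x /Coo_at_differentiable.
move=> /nbhs_normP[r1 /= r10 rP].
exists (Num.min r r1); first by rewrite lt_min r0.
move=> x y; rewrite !lt_min => /andP[xr xr1] /andP[yr yr1].
have dP t : 0 <= t <= 1 -> `|a - (x + t *: (y - x))| < r1.
  by move=> t01; rewrite distrC segment_ball.
have [t /dP/rP//|c c01 ->] := @MVT_row n f x y.
set z := x + c *: (y - x).
have zx : `|z - x| <= `|y - x|.
  rewrite /z addrAC subrr add0r normrZ; move: c01 => /andP[c0 c1].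
  by rewrite ger0_norm // ler_piMl.
have B : `|('d f z (y - x) : R) - 'd f x (y - x)| <= n%:R * (C * `|z - x|) * `|y - x|.
  apply: (@linear_row_bound n R (fun h => ('d f z h : R) - 'd f x h)).
    exact: linear_sub.
  by move=> i; apply: H => //; exact: segment_ball.
apply: le_trans B _.
rewrite expr2 !mulrA ler_wpM2r // -!mulrA !ler_wpM2l //.
Qed.

Lemma locally_taylor n p q (f : 'rV[R]_n -> 'M[R]_(p, q)) a : Coo_at f a ->
  exists2 C, 0 <= C & exists2 r, 0 < r & forall x y,
    `|x - a| < r -> `|y - a| < r ->
    `|f y - f x - 'd f x (y - x)| <= C * `|y - x| ^+ 2.
Proof.
move=> fa.
have : \forall x \near a, differentiable f x.
  by apply: filterS (Coo_at_near fa) => x /Coo_at_differentiable.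
move=> /nbhs_normP[r1 /= r10 rP].
have := @common_bound ('I_p * 'I_q)%type (fun ij C r => forall x y,
    `|x - a| < r -> `|y - a| < r ->
    `|f y ij.1 ij.2 - f x ij.1 ij.2 - 'd (fun z => f z ij.1 ij.2 : R) x (y - x)|
    <= C * `|y - x| ^+ 2).
case.
- move=> ij C r C' r' H CC r0 rr x y xr yr.
  apply: le_trans (H x y _ _) _; rewrite ?(lt_le_trans _ rr) //.
  by rewrite ler_wpM2r // exprn_ge0.
- by move=> [i j]; apply: locally_taylor1; exact: Coo_at_coord.
move=> C C0 [r r0 H]; exists C => //; exists (Num.min r r1); first by rewrite lt_min r0.
move=> x y; rewrite !lt_min => /andP[xr xr1] /andP[yr yr1].
apply: mx_norm_le; first by rewrite mulr_ge0 // exprn_ge0.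
move=> i j; have := H (i, j) x y xr yr => /=.
rewrite diff_coord; first by rewrite !mxE.
by apply: rP; rewrite /= distrC.
Qed.

End mean_value.

(** * Ordinary differential equations and the local Frobenius theorem *)

Section ode.
Variable R : realType.

Lemma is_derive_coord n (d : R -> 'rV[R]_n) (t : R) (v : 'rV[R]_n) i :
  is_derive t 1 d v -> is_derive t 1 (fun s => d s 0 i : R) (v 0 i).
Proof.
move=> [dd dE]; have H := (derivable_mxP d t 1).1 dd 0 i.
by apply: DeriveDef => //; rewrite -dE derive_mx // mxE.
Qed.

Lemma is_derive_row n (d : R -> 'rV[R]_n) (t : R) (v : 'rV[R]_n) :
  (forall i, is_derive t 1 (fun s => d s 0 i : R) (v 0 i)) -> is_derive t 1 d v.
Proof.
move=> H; have dd : derivable d t 1.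
  by apply/derivable_mxP => i j; rewrite ord1; have [] := H j.
apply: DeriveDef => //; rewrite derive_mx //; apply/rowP => i; rewrite mxE.
by have [_] := H i.
Qed.

(** In the sup norm the mean value theorem may be used coordinate by coordinate, each with its own
    intermediate point. *)
Lemma row_mean_value n (d d' : R -> 'rV[R]_n) (B : R) : 0 <= B ->
  (forall t : R, 0 <= t <= 1 -> is_derive t 1 d (d' t)) ->
  (forall t : R, 0 <= t <= 1 -> `|d' t| <= B) ->
  forall t, 0 <= t <= 1 -> `|d t - d 0| <= B.
Proof.
move=> B0 dd dB t /andP[t0 t1]; apply: mx_norm_le => // i j; rewrite ord1 !mxE.
have sub x : 0 <= x <= t -> 0 <= x <= 1.
  by move=> /andP[-> xt]; exact: le_trans t1.
have [|||c] := @MVT_segment R (fun s => d s 0 j) (fun s => d' s 0 j) 0 t.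
- by [].
- move=> x; rewrite in_itv /= => /andP[x0 xt]; apply: is_derive_coord; apply: dd.
  by apply: sub; rewrite !ltW.
- apply: derivable_within_continuous => x; rewrite in_itv /= => x01.
  by have [] := is_derive_coord j (dd x (sub x x01)).
rewrite in_itv /= subr0 => c0t ->.
rewrite normrM (ger0_norm t0) -[leRHS]mulr1 ler_pM //.
by apply: le_trans (mx_coord_le _ _ _) _; apply: dB; exact: sub.
Qed.

Lemma gronwall n (e e' : R -> 'rV[R]_n) (D : R) : e 0 = 0 ->
  (forall t : R, 0 <= t <= 1 -> is_derive t 1 e (e' t)) ->
  (forall t : R, 0 <= t <= 1 -> `|e' t| <= D + 2^-1 * `|e t|) ->
  forall t, 0 <= t <= 1 -> `|e t| <= 2 * D.
Proof.
move=> e0 de eD.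
have [|c] := @EVT_max R (fun t => `|e t|) 0 1 ler01.
  move=> x; apply: continuous_comp; last exact: norm_continuous.
  move: x; apply: derivable_within_continuous => x; rewrite in_itv /= => x01.
  by have [] := de x x01.
rewrite in_itv /= => c01 cmax.
have cm t : 0 <= t <= 1 -> `|e t| <= `|e c| by move=> t01; apply: cmax; rewrite in_itv.
have S0 : 0 <= D + 2^-1 * `|e c| by apply: le_trans (eD c c01).
have := @row_mean_value n e e' _ S0 de _ c c01; rewrite e0 subr0 => H.
have {}H : `|e c| <= D + 2^-1 * `|e c|.
  apply: H => t t01; apply: le_trans (eD t t01) _.
  by rewrite lerD2l ler_pM2l ?invr_gt0 // cm.
move=> t t01; apply: le_trans (cm t t01) _; lra.
Qed.

Lemma antiderivative (h : R -> R) : continuous h ->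
  exists2 H : R -> R, H 0 = 0 &
    forall t : R, 0 <= t <= 1 -> is_derive t 1 H (h t).
Proof.
move=> hc; pose F x := (\int[lebesgue_measure]_(t in `[(-1)%R, x]) h t)%R.
exists (fun x => F x - F 0); first by rewrite subrr.
move=> t /andP[t0 t1].
have [||||Fd FE] := @continuous_FTC1_closed R h (-1) t 2.
- by apply: le_lt_trans t1 _; rewrite ltr1n.
- apply: continuous_compact_integrable; first exact: segment_compact.
  by apply: continuous_subspaceT.
- by apply: lt_le_trans t0; rewrite ltrN10.
- exact: hc.
have : is_derive t 1 F (h t) by apply: DeriveDef; [exact: Fd|exact: eq_trans (esym (derive1E F t)) FE].
move=> Fi; have := is_deriveB Fi (is_derive_cst (F 0) t 1).
by rewrite subr0.
Qed.

Lemma row_antiderivative n (h : R -> 'rV[R]_n) (y : 'rV[R]_n) : continuous h ->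
  exists2 H : R -> 'rV[R]_n, H 0 = y &
    forall t : R, 0 <= t <= 1 -> is_derive t 1 H (h t).
Proof.
move=> hc.
have [H HP] : {H : 'I_n -> R -> R & forall i, H i 0 = 0 /\
    forall t : R, 0 <= t <= 1 -> is_derive t 1 (H i) (h t 0 i)}.
  apply: (choice (P := fun i (H : R -> R) => H 0 = 0 /\
    forall t : R, 0 <= t <= 1 -> is_derive t 1 H (h t 0 i))) => i.
  have [|H H0 Hd] := @antiderivative (fun t => h t 0 i); last by exists H.
  move=> t; apply: (@continuous_comp _ _ _ h (fun M : 'rV[R]_n => M 0 i)).
    exact: hc.
  exact: coord_continuous.
exists (fun t => \row_i (y 0 i + H i t)).
  by apply/rowP => i; rewrite mxE (HP i).1 addr0.
move=> t t01; apply: is_derive_row => i.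
have -> : (fun s => (\row_j (y 0 j + H j s)) 0 i) = (fun s => y 0 i + H i s).
  by apply/funext => s; rewrite mxE.
have := is_deriveD (is_derive_cst (y 0 i) t 1) ((HP i).2 t t01).
by rewrite add0r.
Qed.

(** The intervals of radius 2 B 2^-k around a_k are nested; the supremum of their left ends lies in
    all of them, which also gives the rate of convergence. *)
Lemma geometric_limit (a : nat -> R) (B : R) :
  (forall k, `|a k.+1 - a k| <= B * 2^-1 ^+ k) ->
  exists l, forall k, `|l - a k| <= 2 * B * 2^-1 ^+ k.
Proof.
move=> aB; pose lo k := a k - 2 * B * 2^-1 ^+ k; pose up k := a k + 2 * B * 2^-1 ^+ k.
have B0 : 0 <= B by have := aB 0%N; rewrite expr0 mulr1; apply: le_trans.
have q0 k : 0 <= B * 2^-1 ^+ k by rewrite mulr_ge0 // exprn_ge0.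
have step k : lo k <= lo k.+1 /\ up k.+1 <= up k.
  have := aB k; rewrite /lo /up exprS ler_norml => /andP[h1 h2]; split; lra.
have lomono k j : lo k <= lo (k + j)%N.
  by elim: j => [|j IH]; rewrite ?addn0 // addnS; apply: le_trans IH (step _).1.
have upmono k j : up (k + j)%N <= up k.
  by elim: j => [|j IH]; rewrite ?addn0 // addnS; apply: le_trans (step _).2 IH.
have lu k j : lo k <= up j.
  apply: le_trans (lomono k j) _; apply: le_trans (_ : _ <= up (j + k)%N) (upmono _ _).
  by rewrite addnC /lo /up; have := q0 (j + k)%N; lra.
exists (sup (range lo)) => k.
have hs : has_sup (range lo).
  by split; [exists (lo 0%N), 0%N|exists (up 0%N) => _ [j _ <-]].
have h1 : lo k <= sup (range lo) by apply: sup_upper_bound => //; exists k.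
have h2 : sup (range lo) <= up k by apply: ge_sup; [case: hs|move=> _ [j _ <-]].
by rewrite ler_norml; rewrite /lo /up in h1 h2; apply/andP; split; lra.
Qed.

Lemma le_geometric0 (x M : R) : (forall k, x <= M * 2^-1 ^+ k) -> x <= 0.
Proof.
move=> H; rewrite leNgt; apply/negP => x0.
have M0 : 0 < M by have := H 0%N; rewrite expr0 mulr1; exact: lt_le_trans.
have [k Hk] : exists k, M / x < 2 ^+ k.
  exists (Num.bound (M / x)); apply: lt_le_trans (archi_boundP _) _.
    by rewrite divr_ge0 // ltW.
  by rewrite -natrX ler_nat ltnW // ltn_expl.
have := H k; rewrite exprVn leNgt ltr_pdivrMr ?exprn_gt0 //.
by move: Hk; rewrite ltr_pdivrMr // mulrC => ->.
Qed.

Definition clamp (a b t : R) := Num.max a (Num.min t b).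

Lemma clamp_id a b t : a <= t <= b -> clamp a b t = t.
Proof. by move=> /andP[at_ tb]; rewrite /clamp min_l // max_r. Qed.

Lemma clamp_in a b t : a <= b -> a <= clamp a b t <= b.
Proof.
by move=> ab; rewrite /clamp le_max lexx /= ge_max ab ge_min lexx orbT.
Qed.

Lemma clamp_lip a b s t : a <= b -> `|clamp a b s - clamp a b t| <= `|s - t|.
Proof.
move=> ab; rewrite /clamp /Num.max /Num.min.
have := ler_norm (s - t); have := ler_norm (t - s); rewrite (distrC t s).
by case: (ltP s b) => h1; case: (ltP t b) => h2; case: ltP => h3; case: ltP => h4 h5 h6;
  rewrite ?subrr ?normr0 // ler_norml; apply/andP; split; lra.
Qed.

Lemma near_norm_le (V : normedModType R) (x : V) (e : R) : 0 < e ->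
  \forall y \near x, `|x - y| <= e.
Proof.
move=> e0; apply: (filterS _ (nbhsx_ballx x e e0)) => y.
by rewrite -ball_normE /= => /ltW.
Qed.

Lemma lipschitz1_continuous (V W : normedModType R) (f : V -> W) :
  (forall s t, `|f s - f t| <= `|s - t|) -> continuous f.
Proof.
move=> flip t; apply/cvgrPdist_le => e e0.
have : \forall s \near t, `|t - s| <= e.
  exact: near_norm_le.
by apply: filterS => s; apply: le_trans; exact: flip.
Qed.

(** With Lipschitz constant 1/2 the integral operator contracts by 1/2 in the sup norm on [0, 1].
    The whole interval is thus reached at once and the iterates converge at the rate 2^-k. *)
Lemma picard n (f : 'rV[R]_n -> 'rV[R]_n) (y : 'rV[R]_n) :
  (forall u v, `|f u - f v| <= 2^-1 * `|u - v|) ->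
  exists2 c : R -> 'rV[R]_n, c 0 = y &
    forall t : R, 0 <= t <= 1 -> is_derive t 1 c (f (c t)).
Proof.
move=> flip.
have fc : continuous f.
  apply: lipschitz1_continuous => u v; apply: le_trans (flip _ _) _.
  by rewrite ler_piMl // invf_le1 // ler1n.
(* Clamping the time to [0, 1] keeps the iterates continuous on the whole line, as
   row_antiderivative requires. *)
pose cl := clamp 0 1.
have clc : continuous cl.
  by apply: lipschitz1_continuous => s t; apply: clamp_lip; exact: ler01.
have cl01 t : 0 <= cl t <= 1 by apply: clamp_in; exact: ler01.
have clK t : 0 <= t <= 1 -> cl t = t by exact: clamp_id.
(* The integral operator T has to be total in order to be chosen; on discontinuous c its value is
   arbitrary. *)
have step (c : R -> 'rV[R]_n) : exists H : R -> 'rV[R]_n,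
    continuous c -> H 0 = y /\
    forall t : R, 0 <= t <= 1 -> is_derive t 1 H (f (c t)).
  have [cc|nc] := pselect (continuous c); last by exists c.
  have [|H H0 Hd] := @row_antiderivative n (f \o c) y; last by exists H.
  by move=> t; apply: continuous_comp; [exact: cc|exact: fc].
have [T TP] := choice step.
have Tc c : continuous c -> continuous (T c \o cl).
  move=> cc t; apply: continuous_comp; first exact: clc.
  have [_ /(_ _ (cl01 t))[Td _]] := TP c cc.
  exact/differentiable_continuous/derivable1_diffP.
pose u := fix u k := if k is k'.+1 then T (u k') \o cl else cst y.
have uc k : continuous (u k).
  by elim: k => [|k IH] /=; [move=> x; exact: cst_continuous|exact: Tc].
have cmp (c c' : R -> 'rV[R]_n) (B : R) : 0 <= B -> continuous c -> continuous c' ->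
    (forall t : R, 0 <= t <= 1 -> `|c t - c' t| <= B) ->
    forall t, `|T c (cl t) - T c' (cl t)| <= 2^-1 * B.
  move=> B0 cc cc' H t.
  have [i0 di] := TP c cc; have [j0 dj] := TP c' cc'.
  have := @row_mean_value n (fun s => T c s - T c' s)
    (fun s => f (c s) - f (c' s)) (2^-1 * B) _ _ _ (cl t) (cl01 t).
  rewrite i0 j0 subrr subr0; apply.
  - by rewrite mulr_ge0 // invr_ge0.
  - by move=> s s01; apply: is_deriveB; [exact: di|exact: dj].
  - move=> s s01; apply: le_trans (flip _ _) _.
    by rewrite ler_pM2l ?invr_gt0 // H.
pose B := `|f y|; have B0 : 0 <= B by exact: normr_ge0.
have uB k t : `|u k.+1 t - u k t| <= B * 2^-1 ^+ k.
  elim: k t => [|k IH] t.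
    rewrite expr0 mulr1 /=; have [i0 di] := TP (cst y) (uc 0%N).
    have := @row_mean_value n (T (cst y)) (fun s => f y) B _ di _ (cl t) (cl01 t).
    by rewrite i0; apply.
  rewrite exprS mulrCA; apply: cmp; [|exact: (uc k.+1)|exact: (uc k)|by move=> s _; exact: IH].
  by rewrite mulr_ge0 // exprn_ge0.
have [c cP] : {c : R -> 'rV[R]_n & forall t k, `|c t - u k t| <= 2 * B * 2^-1 ^+ k}.
  apply: (choice (P := fun t (l : 'rV[R]_n) => forall k, `|l - u k t| <= 2 * B * 2^-1 ^+ k)).
  move=> t.
  have [l lP] : {l : 'I_n -> R & forall i k, `|l i - u k t 0 i| <= 2 * B * 2^-1 ^+ k}.
    apply: (choice (P := fun i (l : R) => forall k, `|l - u k t 0 i| <= 2 * B * 2^-1 ^+ k)).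
    move=> i; apply: (@geometric_limit (fun k => u k t 0 i)) => k.
    apply: le_trans (uB k t); apply: le_trans (mx_coord_le _ 0 i).
    by rewrite !mxE.
  exists (\row_i l i) => k; apply: mx_norm_le.
    by rewrite mulr_ge0 ?mulr_ge0 ?exprn_ge0.
  by move=> i j; rewrite ord1 !mxE.
have cc : continuous c.
  move=> t; apply/cvgrPdist_le => e e0.
  have [k Hk] : exists k, 2 * B * 2^-1 ^+ k <= e / 3.
    apply: contrapT => H; have : e / 3 <= 0.
      apply: (@le_geometric0 _ (2 * B)) => k; rewrite leNgt; apply/negP => h.
      by apply: H; exists k; exact: ltW.
    by rewrite leNgt divr_gt0.
  have : \forall s \near t, `|u k t - u k s| <= e / 3.
    by have /cvgrPdist_le := uc k t; apply; rewrite divr_gt0.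
  apply: filterS => s hs.
  have -> : c t - c s = (c t - u k t) + (u k t - u k s) - (c s - u k s).
    by apply/rowP => i; rewrite !mxE; ring.
  apply: le_trans (ler_normB _ _) _; apply: le_trans (lerD (ler_normD _ _) (lexx _)) _.
  by have := cP t k; have := cP s k; lra.
have [d0 dd] := TP c cc.
exists (T c) => // t t01.
(* [T c] and c are both within a multiple of 2^-k of the iterate [u k.+1], so they agree on
   [0, 1]. *)
suff -> : T c t = c t by exact: dd.
apply/eqP; rewrite -subr_eq0 -normr_le0.
apply: (@le_geometric0 _ (4 * B)) => k.
have h := cmp c (u k) (2 * B * 2^-1 ^+ k) _ cc (uc k) _ t.
rewrite (clK t t01) in h.
have q0 : 0 <= B * 2^-1 ^+ k by rewrite mulr_ge0 ?exprn_ge0.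
have {}h : `|T c t - u k.+1 t| <= 2^-1 * (2 * B * 2^-1 ^+ k).
  by rewrite /= (clK t t01); apply: h => //; rewrite -mulrA mulr_ge0.
have -> : T c t - c t = (T c t - u k.+1 t) - (c t - u k.+1 t).
  by apply/rowP => i; rewrite !mxE; ring.
apply: le_trans (ler_normB _ _) _.
by have := cP t k.+1; rewrite exprS; lra.
Qed.

End ode.

(** * The equation 'd F x h = h L(F x) for a flat matrix field L *)

Section flat.
Variable R : realType.

Lemma linear_bound_continuous (V W : normedModType R) (l : V -> W) (C : R) :
  linear l -> (forall x, `|l x| <= C * `|x|) -> continuous l.
Proof.
move=> ll lC.
pose lM := GRing.isLinear.Build _ _ _ _ _ ll.
pose lL : {linear V -> W} := HB.pack l lM.
move=> x; apply/(@cvgrPdist_le R W) => e e0.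
pose C' := `|C| + 1.
have C'0 : 0 < C' by rewrite ltr_wpDl.
have CC' : C <= C' by apply: le_trans (ler_norm C) _; rewrite lerDl.
have eC : 0 < e / C' by rewrite divr_gt0.
apply: filterS (near_norm_le x eC) => y xy.
have -> : l x - l y = l (x - y) by rewrite -[RHS]/(lL _) linearB.
apply: le_trans (lC _) _; apply: le_trans (_ : C' * `|x - y| <= _).
  by rewrite ler_wpM2r.
by rewrite mulrC -ler_pdivlMr.
Qed.

Lemma row_linear_continuous n (W : normedModType R) (l : 'rV[R]_n -> W) :
  linear l -> continuous l.
Proof.
move=> ll; apply: (@linear_bound_continuous _ _ l
  (n%:R * \sum_i `|l (delta_mx 0 i)|)) => // x.
apply: linear_row_bound => // i.
by rewrite (bigD1 i) //= lerDl sumr_ge0.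
Qed.

Lemma mulmx_norm_le p m n (A : 'M[R]_(p, m)) (B : 'M[R]_(m, n)) :
  `|A *m B| <= m%:R * `|A| * `|B|.
Proof.
apply: mx_norm_le => [|i j]; first by rewrite !mulr_ge0.
rewrite mxE; apply: le_trans (ler_norm_sum _ _ _) _.
have -> : m%:R * `|A| * `|B| = \sum_(k < m) (`|A| * `|B|).
  by rewrite sumr_const card_ord -[in RHS]mulr_natl mulrA.
by apply: ler_sum => k _; rewrite normrM ler_pM //; exact: mx_coord_le.
Qed.

Lemma mulmxl_linear p m n (A : 'M[R]_(p, m)) :
  linear (fun B : 'M[R]_(m, n) => A *m B).
Proof. by move=> k B C; rewrite mulmxDr scalemxAr. Qed.

Lemma mulmxl_continuous p m n (A : 'M[R]_(p, m)) :
  continuous (fun B : 'M[R]_(m, n) => A *m B).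
Proof.
apply: (@linear_bound_continuous _ _ _ (m%:R * `|A|)); first exact: mulmxl_linear.
by move=> B; exact: mulmx_norm_le.
Qed.

(** For r >= 0, a 1-Lipschitz retraction onto the closed ball of the sup norm. Composing with it
    turns a field that is Lipschitz near c into a globally Lipschitz one, as [picard] demands. *)
Definition clamp_row n (c : 'rV[R]_n) (r : R) (y : 'rV[R]_n) : 'rV[R]_n :=
  \row_i clamp (c 0 i - r) (c 0 i + r) (y 0 i).

Lemma clamp_row_in n (c y : 'rV[R]_n) (r : R) : 0 <= r -> `|clamp_row c r y - c| <= r.
Proof.
move=> r0; apply: mx_norm_le => // i j; rewrite ord1 !mxE.
have /andP[] := @clamp_in R (c 0 j - r) (c 0 j + r) (y 0 j) ltac:(lra).
by rewrite ler_norml => *; apply/andP; split; lra.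
Qed.

Lemma clamp_row_lip n (c y z : 'rV[R]_n) (r : R) : 0 <= r ->
  `|clamp_row c r y - clamp_row c r z| <= `|y - z|.
Proof.
move=> r0; apply: mx_norm_le => // i j; rewrite ord1 !mxE.
apply: le_trans (clamp_lip _ _ _) _; first by lra.
by apply: le_trans (mx_coord_le _ 0 j); rewrite !mxE.
Qed.

Lemma clamp_row_id n (c y : 'rV[R]_n) (r : R) : `|y - c| <= r -> clamp_row c r y = y.
Proof.
move=> yr; apply/rowP => i; rewrite mxE clamp_id //.
have := le_trans (mx_coord_le (y - c) 0 i) yr.
by rewrite !mxE ler_norml => /andP[h1 h2]; apply/andP; split; lra.
Qed.

Lemma is_derive_comp (V W : normedModType R) (f : V -> W) (c : R -> V) (t : R) (v : V) :
  is_derive t 1 c v -> differentiable f (c t) ->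
  is_derive t 1 (fun s => f (c s)) ('d f (c t) v).
Proof.
move=> [cd cE] fd.
have cdd : differentiable c t by exact/derivable1_diffP.
have fcd : differentiable (fun s => f (c s)) t by exact: differentiable_comp cdd fd.
apply: DeriveDef; first exact: diff_derivable.
rewrite deriveE //.
apply: eq_trans (congr1 (fun l : R -> W => l 1) (diff_comp cdd fd)) _ => /=.
by rewrite -cE deriveE.
Qed.

Lemma is_derive_linear (V W : normedModType R) (l : V -> W) (c : R -> V) (t : R) (v : V) :
  linear l -> continuous l -> is_derive t 1 c v -> is_derive t 1 (fun s => l (c s)) (l v).
Proof.
move=> ll lc cd.
pose lM := GRing.isLinear.Build _ _ _ _ _ ll.
pose lL : {linear V -> W} := HB.pack l lM.
have ld x : differentiable l x by exact: (@linear_differentiable _ _ _ lL).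
have lE x : 'd l x = l :> (V -> W) by exact: (@diff_lin _ _ _ lL).
have := is_derive_comp cd (ld (c t)).
by rewrite (lE (c t)).
Qed.

Lemma is_derive_scale (V : normedModType R) (c : R -> V) (t : R) (v : V) :
  is_derive t 1 c v -> is_derive t 1 (fun s : R => s *: c s) (t *: v + c t).
Proof.
move=> [cd cE].
have cdd : differentiable c t by exact/derivable1_diffP.
have idd : differentiable (fun s : R => s) t by exact: (@ex_diff _ _ _ _ _ _ _ (is_diff_id t)).
have [d1 d2] := is_diff_scale idd cdd.
apply: DeriveDef; first exact: diff_derivable.
rewrite deriveE //; apply: eq_trans (congr1 (fun l : R -> V => l 1) d2) _ => /=.
rewrite -cE deriveE //; congr (_ + _).
rewrite -[RHS]scale1r; congr (_ *: _).
exact: (congr1 (fun l : R -> R => l 1) (@diff_val _ _ _ _ _ _ _ (is_diff_id t))).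
Qed.

(* F x is the value at time 1 of the solution c of c' = x L(c), c(0) = y0.  By flatness
   t |-> c t + t h L(c t) solves the equation for x + h up to O(|h|^2), so that Gronwall's
   lemma gives 'd F x h = h L(F x). *)
Lemma flat_section n m (L : 'rV[R]_n -> 'M[R]_(m, n)) (y0 : 'rV[R]_n)
    (N : 'rV[R]_n -> Prop) : Coo_at L y0 ->
  (\forall y \near y0, N y) ->
  (\forall y \near y0, forall a b : 'rV[R]_m,
     b *m 'd L y (a *m L y) = a *m 'd L y (b *m L y)) ->
  exists r : R, exists F : 'rV[R]_m -> 'rV[R]_n, [/\ 0 < r, F 0 = y0 &
    forall x, `|x| < r -> N (F x) /\ is_diff x F (fun h => h *m L (F x))].
Proof.
move=> LC NN flat.
have [C1 C10 [r1 r10 Llip]] := locally_lipschitz LC.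
have [C2 C20 [r2 r20 Ltay]] := locally_taylor LC.
have : \forall y \near y0, [/\ N y, differentiable L y & forall a b : 'rV[R]_m,
     b *m 'd L y (a *m L y) = a *m 'd L y (b *m L y)].
  near=> y; split; [near: y; exact: NN| |near: y; exact: flat].
  by near: y; apply: filterS (Coo_at_near LC) => y /Coo_at_differentiable.
move=> /nbhs_normP[r3 /= r30 near3].
(* Halving puts the closed ball of radius rho inside all three open balls. *)
pose rho := Num.min r1 (Num.min r2 r3) / 2.
have m0 : 0 < Num.min r1 (Num.min r2 r3) by rewrite !lt_min r10 r20.
have rho0 : 0 < rho by rewrite /rho divr_gt0.
have rhom : rho < Num.min r1 (Num.min r2 r3) by rewrite /rho ltr_pdivrMr // ltr_pMr // ltr1n.
have [l1 l2 l3] : [/\ rho < r1, rho < r2 & rho < r3].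
  by move: rhom; rewrite !lt_min => /and3P[].
have {}Llip x y : `|x - y0| <= rho -> `|y - y0| <= rho -> `|L y - L x| <= C1 * `|y - x|.
  by move=> hx hy; apply: Llip; [exact: le_lt_trans hx l1|exact: le_lt_trans hy l1].
have {}Ltay x y : `|x - y0| <= rho -> `|y - y0| <= rho ->
    `|L y - L x - 'd L x (y - x)| <= C2 * `|y - x| ^+ 2.
  by move=> hx hy; apply: Ltay; [exact: le_lt_trans hx l2|exact: le_lt_trans hy l2].
have {}near3 y : `|y - y0| <= rho -> [/\ N y, differentiable L y &
    forall a b : 'rV[R]_m, b *m 'd L y (a *m L y) = a *m 'd L y (b *m L y)].
  by move=> hy; apply: near3; rewrite /= distrC; exact: le_lt_trans hy l3.
pose M := `|L y0| + C1 * rho.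
have M0 : 0 <= M by rewrite addr_ge0 // mulr_ge0 // ltW.
have LM (y : 'rV[R]_n) : `|y - y0| <= rho -> `|L y| <= M.
  move=> hy; have := Llip y0 y; rewrite subrr normr0 => /(_ (ltW rho0) hy) H.
  have -> : L y = L y0 + (L y - L y0) by rewrite addrC subrK.
  apply: le_trans (ler_normD _ _) _; rewrite lerD2l; apply: le_trans H _.
  by rewrite ler_wpM2l.
(* m + 1 instead of m, to have a positive number even when m = 0. *)
pose mm : R := m%:R + 1.
have mm0 : 0 < mm by rewrite ltr_wpDl.
have mulB (a : 'rV[R]_m) (A : 'M[R]_(m, n)) : `|a *m A| <= mm * `|a| * `|A|.
  apply: le_trans (mulmx_norm_le _ _) _; rewrite !ler_wpM2r //.
  by rewrite /mm lerDl.
(* The first bound makes y |-> x L(K y) Lipschitz with constant 1/2 for |x| < r. The second keeps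
   solutions within rho / 3 of y0; since |h| <= 2 r, the correction w moves them by at most another
   2 rho / 3. *)
pose r := Num.min (2^-1 / (mm * (C1 + 1))) (rho / (3 * mm * (M + 1))).
have C1p : 0 < C1 + 1 by rewrite ltr_wpDl.
have Mp : 0 < M + 1 by rewrite ltr_wpDl.
have r0 : 0 < r by rewrite /r lt_min !divr_gt0 ?mulr_gt0 ?invr_gt0.
have rC : mm * r * C1 <= 2^-1.
  have : r <= 2^-1 / (mm * (C1 + 1)) by rewrite /r ge_min lexx.
  rewrite ler_pdivlMr ?mulr_gt0 // => H; apply: le_trans H.
  have : 0 <= mm * r by rewrite mulr_ge0 // ltW.
  by nra.
have rM : 3 * (mm * r * M) <= rho.
  have : r <= rho / (3 * mm * (M + 1)) by rewrite /r ge_min lexx orbT.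
  rewrite ler_pdivlMr ?mulr_gt0 // => H; apply: le_trans H.
  have : 0 <= mm * r by rewrite mulr_ge0 // ltW.
  by nra.
pose K := clamp_row y0 rho.
have Kin y : `|K y - y0| <= rho by apply: clamp_row_in; exact: ltW.
have Klip y z : `|K y - K z| <= `|y - z| by apply: clamp_row_lip; exact: ltW.
have Kid (y : 'rV[R]_n) : `|y - y0| <= rho -> K y = y by exact: clamp_row_id.
have flip (x : 'rV[R]_m) : `|x| < r -> forall u v, `|x *m L (K u) - x *m L (K v)| <= 2^-1 * `|u - v|.
  move=> xr u v; rewrite -mulmxBr; apply: le_trans (mulB _ _) _.
  have h : `|L (K u) - L (K v)| <= C1 * `|u - v|.
    by apply: le_trans (Llip _ _ (Kin _) (Kin _)) _; rewrite ler_wpM2l.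
  apply: le_trans (_ : mm * r * (C1 * `|u - v|) <= _).
    apply: ler_pM => //; first by rewrite mulr_ge0 // ltW.
    by rewrite ler_wpM2l // ltW.
  by rewrite mulrA ler_wpM2r.
have sol (x : 'rV[R]_m) : exists c : R -> 'rV[R]_n, `|x| < r -> [/\ c 0 = y0,
    (forall t : R, 0 <= t <= 1 -> `|c t - y0| <= mm * r * M) &
    forall t : R, 0 <= t <= 1 -> is_derive t 1 c (x *m L (c t))].
  have [xr|nxr] := pselect (`|x| < r); last by exists (fun _ => 0).
  have [c c0 cd] := @picard R n (fun y => x *m L (K y)) y0 (flip x xr).
  exists c => _.
  have cin (t : R) : 0 <= t <= 1 -> `|c t - y0| <= mm * r * M.
    rewrite -c0; apply: (@row_mean_value R n c _ _ _ cd).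
      by rewrite !mulr_ge0 // ltW.
    move=> s s01; apply: le_trans (mulB _ _) _; apply: ler_pM => //.
    - by rewrite mulr_ge0 // ltW.
    - by rewrite ler_wpM2l // ltW.
    - exact: LM.
  have crho t : 0 <= t <= 1 -> `|c t - y0| <= rho.
    move=> /cin; have : 0 <= mm * r * M by rewrite !mulr_ge0 // ltW.
    by move: rM; lra.
  split=> // t t01; have := cd t t01; by rewrite Kid // crho.
have [c cP] := choice sol.
have in1 : 0 <= (1 : R) <= 1 by apply/andP; split; [exact: ler01|exact: lexx].
have MM0 : 0 <= mm * r * M by rewrite !mulr_ge0 // ltW.
have crho (x : 'rV[R]_m) (t : R) : `|x| < r -> 0 <= t <= 1 -> `|c x t - y0| <= rho.
  by move=> xr t01; have [_ /(_ t t01) H _] := cP x xr; move: rM H; lra.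
exists r, (fun x => c x 1); split=> //.
  have [c0 _ cd] := cP 0 ltac:(by rewrite normr0).
  have := @row_mean_value R n (c 0) (fun t => 0 *m L (c 0 t)) 0 _ cd _ 1 in1.
  rewrite c0 => H; apply/eqP; rewrite -subr_eq0 -normr_le0; apply: H => //.
  by move=> t _; rewrite mul0mx normr0.
move=> x xr; split; first by have [] := near3 _ (crho x 1 xr in1).
apply: is_diff_eps.
- by move=> k u v; rewrite mulmxDl scalemxAl.
- by apply: row_linear_continuous => k u v; rewrite mulmxDl scalemxAl.
(* The first summand bounds the Taylor remainder of L, multiplied by h + x; the second bounds t h
   ['d L y (w t)]. Both are quadratic in h. *)
pose D := mm * r * (C2 * (mm * M) ^+ 2) + mm * ((C1 + C2 * rho) * (mm * M)).
have D0 : 0 <= D.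
  by rewrite addr_ge0 // !mulr_ge0 ?addr_ge0 ?exprn_ge0 ?mulr_ge0 // ltW.
suff main (h : 'rV[R]_m) : `|h + x| < r -> `|c (h + x) 1 - c x 1 - h *m L (c x 1)| <= 2 * D * `|h| ^+ 2.
  move=> e e0.
  have D1 : 0 < 2 * D + 1 by lra.
  have : \forall h \near (0 : 'rV[R]_m), `|h + x| < r /\ `|0 - h| <= e / (2 * D + 1).
    have H1 := near_norm_le (0 : 'rV[R]_m) (divr_gt0 e0 D1).
    have H2 : \forall y \near x, `|y| < r.
      exact: (@norm_continuous R 'rV[R]_m x _ (open_nbhs_nbhs (conj (@open_lt R r) xr))).
    near=> h; split; near: h; last exact: H1.
    exact: near_shift0 H2.
  apply: filterS => h [hxr]; rewrite sub0r normrN => he; apply: le_trans (main h hxr) _.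
  rewrite expr2 mulrA ler_wpM2r //.
  rewrite ler_pdivlMr // in he; apply: le_trans he.
  by rewrite mulrC ler_wpM2l // lerDl.
move=> hxr.
have hr : `|h| <= 2 * r.
  have -> : h = (h + x) - x by rewrite addrK.
  by apply: le_trans (ler_normB _ _) _; lra.
have [c0 cin cd] := cP x xr; have [c0' cin' cd'] := cP (h + x) hxr.
pose w t := h *m L (c x t).
pose G t := c x t + t *: w t.
have wM (t : R) : 0 <= t <= 1 -> `|w t| <= mm * M * `|h|.
  move=> t01; apply: le_trans (mulB _ _) _.
  rewrite mulrAC ler_wpM2r // ler_wpM2l ?(ltW mm0) //.
  exact: LM _ (crho x t xr t01).
have wrho (t : R) : 0 <= t <= 1 -> `|w t| <= rho - mm * r * M.
  move=> t01; apply: le_trans (wM t t01) _.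
  have : mm * M * `|h| <= mm * M * (2 * r) by rewrite ler_wpM2l // mulr_ge0 // ltW.
  by move: rM; lra.
have sw (t s : R) : 0 <= t <= 1 -> 0 <= s <= 1 -> `|c x t + s *: w t - y0| <= rho.
  move=> t01 /andP[s0 s1]; rewrite addrAC; apply: le_trans (ler_normD _ _) _.
  rewrite normrZ (ger0_norm s0).
  apply: le_trans (lerD (cin t t01) (_ : _ <= `|w t|)) _; first by rewrite ler_piMl.
  by have := wrho t t01; lra.
have wd (t : R) : 0 <= t <= 1 -> is_derive t 1 w (h *m 'd L (c x t) (x *m L (c x t))).
  move=> t01; apply: (@is_derive_linear _ _ (fun A : 'M[R]_(m, n) => h *m A)).
  - exact: mulmxl_linear.
  - exact: mulmxl_continuous.
  - apply: is_derive_comp; first exact: cd.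
    by have [] := near3 _ (crho x t xr t01).
have Gd (t : R) : 0 <= t <= 1 -> is_derive t 1 G
    (x *m L (c x t) + (t *: (h *m 'd L (c x t) (x *m L (c x t))) + w t)).
  by move=> t01; apply: is_deriveD; [exact: cd|exact: is_derive_scale (wd t t01)].
have := @gronwall R n (fun t => G t - c (h + x) t) _ (D * `|h| ^+ 2) _
  (fun t t01 => is_deriveB (Gd t t01) (cd' t t01)) _ 1 in1.
rewrite /G c0 c0' scale0r addr0 subrr scale1r => H.
rewrite -normrN -mulrA.
have -> : - (c (h + x) 1 - c x 1 - h *m L (c x 1)) = c x 1 + w 1 - c (h + x) 1.
  by rewrite /w; apply/rowP => i; rewrite !mxE; ring.
apply: H => // t t01.
have ct := crho x t xr t01; have Gt := sw t t t01 t01.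
have ct' := crho (h + x) t hxr t01.
have [_ Ld flt] := near3 _ ct.
set y := c x t in ct Gt flt Ld *; set z := y + t *: w t in Gt *.
set y' := c (h + x) t in ct' *.
(* Flatness rewrites h ['d L y (x L)] as x ['d L y (h L)], so the first-order terms assemble into (h
   + x) times the linear Taylor polynomial of L at y. What is left is quadratic in h, except (h +
   x)(L z - L y'), which is the term with factor 1/2 in [gronwall]. *)
have -> : x *m L y + (t *: (h *m 'd L y (x *m L y)) + w t) - (h + x) *m L y' =
   - ((h + x) *m (L z - L y - 'd L y (z - y)) + t *: (h *m 'd L y (w t)))
   + (h + x) *m (L z - L y').
  have -> : z - y = t *: w t by rewrite /z addrAC subrr add0r.
  rewrite linearZ /= !mulmxBr -scalemxAr !mulmxDl (flt x h).
  by rewrite -/(w t); apply/rowP => i; rewrite /w !mxE; ring.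
apply: le_trans (ler_normD _ _) _; rewrite normrN; apply: lerD.
  have t1 : 0 <= t /\ t <= 1 by apply/andP.
  have hM := wM t t01; have h0 := normr_ge0 h; have w0 := normr_ge0 (w t).
  have zy : `|z - y| <= `|w t|.
    by rewrite /z addrAC subrr add0r normrZ ger0_norm ?ler_piMl; case: t1.
  have A1 : `|(h + x) *m (L z - L y - 'd L y (z - y))| <= mm * r * (C2 * (mm * M) ^+ 2) * `|h| ^+ 2.
    apply: le_trans (mulB _ _) _.
    have B1 : `|L z - L y - 'd L y (z - y)| <= C2 * ((mm * M) ^+ 2 * `|h| ^+ 2).
      apply: le_trans (Ltay _ _ ct Gt) _; rewrite ler_wpM2l // -exprMn.
      by rewrite lerXn2r // ?nnegrE ?mulr_ge0 //; [exact: ltW|exact: le_trans zy hM].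
    rewrite -[leRHS]mulrA -[X in _ <= _ * X]mulrA; apply: ler_pM => //.
      by rewrite mulr_ge0 // ltW.
    by rewrite ler_wpM2l // ltW.
  (* The differential is the increment of L minus its Taylor remainder, so the two constants already
     at hand bound it. *)
  have dLw : `|'d L y (w t)| <= (C1 + C2 * rho) * (mm * M * `|h|).
    have yw : `|y + w t - y0| <= rho.
      have := sw t 1 t01; rewrite scale1r; apply; exact: in1.
    have e1 := Llip _ _ ct yw; have e2 := Ltay _ _ ct yw.
    have E : y + w t - y = w t by rewrite addrAC subrr add0r.
    rewrite E in e1 e2.
    have -> : 'd L y (w t) = (L (y + w t) - L y) - (L (y + w t) - L y - 'd L y (w t)).
      by rewrite opprB addrC subrK.
    apply: le_trans (ler_normB _ _) _; apply: le_trans (lerD e1 e2) _.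
    have := wrho t t01 => wr.
    have h1 : C2 * `|w t| ^+ 2 <= C2 * rho * `|w t|.
      rewrite expr2 mulrA ler_wpM2r // ler_wpM2l //; lra.
    apply: le_trans (lerD (lexx _) h1) _; rewrite -mulrDl ler_wpM2l //.
    by rewrite addr_ge0 // mulr_ge0 // ltW.
  have A2 : `|t *: (h *m 'd L y (w t))| <= mm * ((C1 + C2 * rho) * (mm * M)) * `|h| ^+ 2.
    rewrite normrZ ger0_norm; last by case: t1.
    apply: le_trans (_ : 1 * `|h *m 'd L y (w t)| <= _).
      by rewrite ler_wpM2r //; case: t1.
    rewrite mul1r; apply: le_trans (mulB _ _) _.
    apply: le_trans (_ : mm * `|h| * ((C1 + C2 * rho) * (mm * M * `|h|)) <= _).
      by rewrite ler_wpM2l // mulr_ge0 // ltW.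
    by rewrite expr2 le_eqVlt; apply/orP; left; apply/eqP; ring.
  apply: le_trans (ler_normD _ _) _; apply: le_trans (lerD A1 A2) _.
  by rewrite -mulrDl.
rewrite -/z -/y.
have := flip (h + x) hxr z y'; rewrite !Kid // mulmxBr.
Unshelve. all: by end_near. Qed.

End flat.

(** * Charts and smooth maps *)

Section charts.
Variables (R : realType) (n : nat) (M : manifold R n).
Implicit Types (phi psi chi : chart R M n) (x y : M).

Definition at_chart phi x := atlas M phi /\ chart_dom phi x.

Lemma at_chart_at x : at_chart (chart_at x) x.
Proof. exact: manifold_chart_at. Qed.

Lemma chart_mapK phi x : at_chart phi x -> chart_inv phi (chart_map phi x) = x.
Proof. by move=> [/manifold_chart[_ _ K _ _] dx]; exact: K. Qed.

Lemma near_at_chart phi x : at_chart phi x -> \forall y \near x, at_chart phi y.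
Proof.
move=> [aphi dx]; have [od _ _ _ _] := manifold_chart aphi.
by apply: filterS (open_nbhs_nbhs (conj od dx)) => y dy.
Qed.

Lemma near_chart_inv phi x (P : M -> Prop) : at_chart phi x ->
  (\forall y \near x, P y) -> \forall u \near chart_map phi x, P (chart_inv phi u).
Proof.
move=> [aphi dx] Px; have [_ _ K _ ic] := manifold_chart aphi.
have := ic x dx; rewrite /prop_for /continuous_at K // => c.
exact: c Px.
Qed.

Lemma near_chart_map phi x (P : 'rV[R]_n -> Prop) : at_chart phi x ->
  (\forall u \near chart_map phi x, P u) -> \forall y \near x, P (chart_map phi y).
Proof.
move=> [aphi dx] Px; have [_ _ _ mc _] := manifold_chart aphi.
exact: (mc x dx) Px.
Qed.

Lemma near_chart_invK phi x : at_chart phi x -> \forall u \near chart_map phi x,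
  at_chart phi (chart_inv phi u) /\ chart_map phi (chart_inv phi u) = u.
Proof.
move=> [aphi dx]; have [_ oi K _ _] := manifold_chart aphi.
have ix : (chart_map phi @` chart_dom phi) (chart_map phi x) by exists x.
by apply: filterS (open_nbhs_nbhs (conj oi ix)) => _ [y dy <-]; rewrite K.
Qed.

Definition transition phi psi := chart_map psi \o chart_inv phi.

Lemma transition_smooth phi psi x : at_chart phi x -> at_chart psi x ->
  Coo_at (transition phi psi) (chart_map phi x).
Proof.
move=> cphi cpsi; exists (chart_map phi @` (chart_dom phi `&` chart_dom psi)); split.
- rewrite openE => _ [y [dy1 dy2] <-].
  have h1 : at_chart phi y by split=> //; case: cphi.
  have h2 : at_chart psi y by split=> //; case: cpsi.
  apply: filterS2 (near_chart_invK h1) (near_chart_inv h1 (near_at_chart h2)).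
  by move=> u [[_ d1] E] [_ d2]; exists (chart_inv phi u).
- by exists x => //; split; [case: cphi|case: cpsi].
- by apply: manifold_transition; [case: cphi|case: cpsi].
Qed.

Definition dtransition phi psi x (v : 'rV[R]_n) : 'rV[R]_n :=
  'd (transition phi psi) (chart_map phi x) v.

Lemma dtransition_comp phi psi chi x v : at_chart phi x -> at_chart psi x ->
  at_chart chi x -> dtransition psi chi x (dtransition phi psi x v) = dtransition phi chi x v.
Proof.
move=> cphi cpsi cchi.
have d1 := Coo_at_differentiable (transition_smooth cphi cpsi).
have E : transition phi psi (chart_map phi x) = chart_map psi x.
  by rewrite /transition /= chart_mapK.
have d2 : differentiable (transition psi chi) (transition phi psi (chart_map phi x)).
  rewrite E; exact: Coo_at_differentiable (transition_smooth cpsi cchi).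
apply: eq_trans (_ : _ = 'd (transition psi chi \o transition phi psi) (chart_map phi x) v) _.
  apply: eq_trans (esym (congr1 (fun l : 'rV_n -> 'rV_n => l v) (diff_comp d1 d2))).
  by rewrite /dtransition /= E.
apply: (congr1 (fun l : 'rV_n -> 'rV_n => l v)); apply: near_diff.
apply: filterS (near_chart_inv cphi (near_at_chart cpsi)) => u cu.
by rewrite /transition /= chart_mapK.
Qed.

Lemma dtransition_id phi x v : at_chart phi x -> dtransition phi phi x v = v.
Proof.
move=> cphi; rewrite /dtransition.
apply: eq_trans (congr1 (fun l : 'rV_n -> 'rV_n => l v) (near_diff (g := id) _)) _.
  by apply: filterS (near_chart_invK cphi) => u [_ E].
exact: (congr1 (fun l : 'rV_n -> 'rV_n => l v) (@diff_val _ _ _ _ _ _ _ (is_diff_id _))).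
Qed.

Lemma dtransitionK phi psi x v : at_chart phi x -> at_chart psi x ->
  dtransition psi phi x (dtransition phi psi x v) = v.
Proof. by move=> h1 h2; rewrite dtransition_comp // dtransition_id. Qed.

Lemma dchartE phi x v : dchart phi x v = dtransition (chart_at x) phi x v.
Proof. by []. Qed.

Lemma dchart_invE phi x v : at_chart phi x ->
  dchart_inv phi (chart_map phi x) v = dtransition phi (chart_at x) x v.
Proof. by move=> cx; rewrite /dchart_inv chart_mapK. Qed.

End charts.

(** * Topology and charts of the tangent bundle *)

Section tangent_bundle_charts.
Variables (R : realType) (n : nat) (M : manifold R n).
Implicit Types (phi psi : chart R M n).

(** [tvec_open] tests a set in every chart of the atlas, so a single chart containing the nearby
    values suffices to test continuity into the bundle. *)
Lemma tangent_bundle_continuous (T : topologicalType) (F : T -> tangent_bundle M)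
    (t : T) phi : at_chart phi (tbase (F t)) ->
  (\forall s \near t, chart_dom phi (tbase (F s))) ->
  {for t, continuous (fun s => chart_map (tchart phi) (F s))} ->
  {for t, continuous F}.
Proof.
move=> [aphi dt] near_dom Fc A.
rewrite nbhsE => -[B [oB Bt] BA].
have tB : tvec_open B := oB.
have nB := Fc _ (tB phi aphi _ Bt dt).
apply: filterS2 near_dom nB => s ds; rewrite /= => h.
by apply: BA; apply: h.
Qed.

Lemma tchart_transition phi psi (z : tangent_bundle M) :
  at_chart phi (tbase z) -> at_chart psi (tbase z) ->
  chart_map (tchart psi) z =
  row_mx (transition phi psi (lsubmx (chart_map (tchart phi) z)))
    ('d (transition phi psi) (lsubmx (chart_map (tchart phi) z))
       (rsubmx (chart_map (tchart phi) z))).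
Proof.
move=> h1 h2; rewrite /= row_mxKl row_mxKr /transition /= chart_mapK //; congr row_mx.
rewrite !dchartE -[RHS]/(dtransition phi psi (tbase z) _).
by rewrite dtransition_comp //; exact: at_chart_at.
Qed.

Lemma lsubmx_linear p q : linear (fun w : 'rV[R]_(p + q) => lsubmx w : 'rV[R]_p).
Proof. by move=> k u v; apply/rowP => i; rewrite !mxE. Qed.

Lemma rsubmx_linear p q : linear (fun w : 'rV[R]_(p + q) => rsubmx w : 'rV[R]_q).
Proof. by move=> k u v; apply/rowP => i; rewrite !mxE. Qed.

Lemma lsubmx_continuous p q : continuous (fun w : 'rV[R]_(p + q) => lsubmx w : 'rV[R]_p).
Proof. by apply: row_linear_continuous; exact: lsubmx_linear. Qed.

Lemma rsubmx_continuous p q : continuous (fun w : 'rV[R]_(p + q) => rsubmx w : 'rV[R]_q).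
Proof. by apply: row_linear_continuous; exact: rsubmx_linear. Qed.

Lemma near_lsubmx p q (w : 'rV[R]_(p + q)) (P : 'rV[R]_p -> Prop) :
  (\forall u \near (lsubmx w : 'rV[R]_p), P u) -> \forall w' \near w, P (lsubmx w').
Proof. exact: (@lsubmx_continuous p q w). Qed.

Lemma Coo_at_lsubmx (V : normedModType R) p q (f : V -> 'rV[R]_(p + q)) x :
  Coo_at f x -> Coo_at (fun y => lsubmx (f y) : 'rV[R]_p) x.
Proof.
exact: (Coo_at_linear_comp (@lsubmx_linear p q) (@lsubmx_continuous p q)).
Qed.

Lemma Coo_at_rsubmx (V : normedModType R) p q (f : V -> 'rV[R]_(p + q)) x :
  Coo_at f x -> Coo_at (fun y => rsubmx (f y) : 'rV[R]_q) x.
Proof.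
exact: (Coo_at_linear_comp (@rsubmx_linear p q) (@rsubmx_continuous p q)).
Qed.

Lemma Coo_at_row_mx (V : normedModType R) p q (f : V -> 'rV[R]_p) (g : V -> 'rV[R]_q) x :
  Coo_at f x -> Coo_at g x -> Coo_at (fun y => row_mx (f y) (g y)) x.
Proof.
move=> fc gc; apply: Coo_at_mx => i j; rewrite ord1.
case: (split_ordP j) => k ->.
  by apply: Coo_at_ext (Coo_at_coord 0 k fc); near=> y; rewrite row_mxEl.
by apply: Coo_at_ext (Coo_at_coord 0 k gc); near=> y; rewrite row_mxEr.
Unshelve. all: by end_near. Qed.

Lemma near_tbase_chart phi (z : tangent_bundle M) : at_chart phi (tbase z) ->
  \forall z' \near z, at_chart phi (tbase z').
Proof.
move=> cz; have [aphi dz] := cz.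
have oB : tvec_open [set z' : tvec M | at_chart phi (tbase z')].
  move=> psi apsi z' cz' dz'.
  have c2 : at_chart psi (tbase z') by [].
  have := near_chart_inv c2 (near_at_chart cz').
  move=> H; have : \forall w \near chart_map (tchart psi) z', at_chart phi (chart_inv psi (lsubmx w)).
    by apply: (near_lsubmx (P := fun u => at_chart phi (chart_inv psi u))); rewrite /= row_mxKl.
  apply: filterS => w; rewrite /= => cw z1 dz1 E.
  by move: cw; rewrite -E row_mxKl chart_mapK.
have : open ([set z' | at_chart phi (tbase z')] : set (tangent_bundle M)) by exact: oB.
by move=> o; exact: open_nbhs_nbhs (conj o cz).
Qed.

Lemma tbase_continuous (z : tangent_bundle M) :
  {for z, continuous (@bundle_proj R n M)}.
Proof.
move=> A; rewrite nbhsE => -[B [oB Bz] BA].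
have tB : tvec_open [set z' : tvec M | B (tbase z')].
  move=> psi apsi z' Bz' dz'.
  have c2 : at_chart psi (tbase z') by [].
  have := near_chart_inv c2 (open_nbhs_nbhs (conj oB Bz')).
  move=> H; have : \forall w \near chart_map (tchart psi) z', B (chart_inv psi (lsubmx w)).
    by apply: (near_lsubmx (P := fun u => B (chart_inv psi u))); rewrite /= row_mxKl.
  apply: filterS => w; rewrite /= => cw z1 dz1 E.
  by move: cw; rewrite -E row_mxKl chart_mapK.
have o : open ([set z' | B (tbase z')] : set (tangent_bundle M)) := tB.
by apply: filterS (open_nbhs_nbhs (conj o Bz)) => z' /BA.
Qed.

(** Openness of the preimage has to be tested in every chart psi; there it follows from the
    continuity of the change of charts of the tangent bundle. *)
Lemma tchart_continuous phi (z : tangent_bundle M) : at_chart phi (tbase z) ->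
  {for z, continuous (chart_map (tchart phi))}.
Proof.
move=> cz A; rewrite nbhsE => -[B [oB Bz] BA].
have tB : tvec_open [set z' : tvec M | at_chart phi (tbase z') /\ B (chart_map (tchart phi) z')].
  move=> psi apsi z' [cz' Bz'] dz'.
  have c2 : at_chart psi (tbase z') by [].
  (* The change of charts from [tchart psi] to [tchart phi]. *)
  pose g (w : 'rV[R]_(n + n)) := row_mx (transition psi phi (lsubmx w))
    ('d (transition psi phi) (lsubmx w) (rsubmx w)).
  have gE : g (chart_map (tchart psi) z') = chart_map (tchart phi) z'.
    exact: esym (tchart_transition c2 cz').
  have gC : Coo_at g (chart_map (tchart psi) z').
    have lC : Coo_at (fun w : 'rV[R]_(n + n) => lsubmx w : 'rV[R]_n) (chart_map (tchart psi) z').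
      by apply: Coo_at_lsubmx; exact: Coo_at_id.
    have tC : Coo_at (transition psi phi) (lsubmx (chart_map (tchart psi) z')).
      by rewrite /= row_mxKl; exact: transition_smooth.
    apply: Coo_at_row_mx; first exact: Coo_at_comp tC.
    by apply: Coo_at_diff2 => //; apply: Coo_at_rsubmx; exact: Coo_at_id.
  have nB : \forall w \near chart_map (tchart psi) z', B (g w).
    by apply: (Coo_at_continuous gC); rewrite gE; exact: open_nbhs_nbhs.
  have nC : \forall w \near chart_map (tchart psi) z', at_chart phi (chart_inv psi (lsubmx w)).
    apply: (near_lsubmx (P := fun u => at_chart phi (chart_inv psi u))); rewrite /= row_mxKl.
    exact: near_chart_inv c2 (near_at_chart cz').
  apply: filterS2 nB nC => w h1 h2 z1 dz1 E.
  have c1 : at_chart phi (tbase z1).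
    by move: h2; rewrite -E /= row_mxKl chart_mapK.
  by split=> //; rewrite (tchart_transition (phi := psi)) // E.
have o : open ([set z' | at_chart phi (tbase z') /\ B (chart_map (tchart phi) z')] :
   set (tangent_bundle M)) := tB.
by apply: filterS (open_nbhs_nbhs (conj o (conj cz Bz))) => z' [_ /BA].
Qed.

End tangent_bundle_charts.

(** * Product rules and Jacobians of matrix-valued maps *)

Section matrix_calculus.
Variable R : realType.
Implicit Types V W : normedModType R.

Lemma diff_compE V W (U : normedModType R) (f : U -> V) (g : V -> W) (x h : U) :
  differentiable f x -> differentiable g (f x) ->
  'd (fun y => g (f y)) x h = 'd g (f x) ('d f x h).
Proof. by move=> fd gd; exact: (congr1 (fun l : U -> W => l h) (diff_comp fd gd)). Qed.

Lemma diff_congr V W (f : V -> W) (x y u v : V) : x = y -> u = v ->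
  'd f x u = 'd f y v.
Proof. by move=> -> ->. Qed.

Lemma diff_cstE V W (c : W) (x h : V) : 'd (fun _ : V => c) x h = 0.
Proof. exact: (congr1 (fun l : V -> W => l h) (diff_cst c x)). Qed.

Lemma near_diffE V W (f g : V -> W) (x h : V) :
  (\forall y \near x, f y = g y) -> 'd f x h = 'd g x h.
Proof. by move=> /near_diff E; exact: (congr1 (fun l : V -> W => l h) E). Qed.

Lemma diff_addE V W (f g : V -> W) (x h : V) :
  differentiable f x -> differentiable g x ->
  'd (fun y => f y + g y) x h = 'd f x h + 'd g x h.
Proof.
move=> fd gd; exact: (congr1 (fun l : V -> W => l h) (@diff_val _ _ _ _ _ _ _ (is_diff_addf fd gd))).
Qed.

Lemma diff_scaleE V W (a : V -> R) (f : V -> W) (x h : V) :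
  differentiable a x -> differentiable f x ->
  'd (fun y => a y *: f y) x h = a x *: 'd f x h + 'd a x h *: f x.
Proof.
move=> fd gd; exact: (congr1 (fun l : V -> W => l h) (@diff_val _ _ _ _ _ _ _ (is_diff_scale fd gd))).
Qed.

Lemma diff_sumE V W (I : Type) (r : seq I) (f : I -> V -> W) (x h : V) :
  (forall i, Coo_at (f i) x) ->
  'd (fun y => \sum_(i <- r) f i y) x h = \sum_(i <- r) 'd (f i) x h.
Proof.
move=> fd; elim: r => [|i r IH].
  rewrite big_nil; apply: eq_trans (diff_cstE 0 x h); apply: near_diffE.
  by near=> y; rewrite big_nil.
rewrite big_cons -IH; apply: eq_trans (diff_addE h _ _).
- by apply: near_diffE; near=> y; rewrite big_cons.
- exact: Coo_at_differentiable (fd i).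
- by apply: Coo_at_differentiable; exact: Coo_at_sum.
Unshelve. all: by end_near. Qed.

Lemma diff_mulmx V p q r (A : V -> 'M[R]_(p, q)) (B : V -> 'M[R]_(q, r)) (x h : V) :
  Coo_at A x -> Coo_at B x ->
  'd (fun y => A y *m B y) x h = 'd A x h *m B x + A x *m 'd B x h.
Proof.
move=> Ax Bx; apply/matrixP => i j.
apply: eq_trans (esym (diff_coord _ _ _ (Coo_at_differentiable (Coo_at_mulmx Ax Bx)))) _.
rewrite !mxE -big_split /=.
apply: eq_trans (_ : _ = 'd (fun y => \sum_k A y i k * B y k j : R) x h) _.
  by apply: near_diffE; near=> y; rewrite mxE.
apply: eq_trans (diff_sumE _ _ _) _.
  by move=> k; apply: Coo_atM; exact: Coo_at_coord.
apply: eq_bigr => k _.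
apply: eq_trans (diff_scaleE _ _ _) _.
- exact: Coo_at_differentiable (Coo_at_coord i k Ax).
- exact: Coo_at_differentiable (Coo_at_coord k j Bx).
apply: eq_trans (addrC _ _) _; congr (_ + _).
- congr (_ * _); exact: diff_coord (Coo_at_differentiable Ax).
- congr (_ * _); exact: diff_coord (Coo_at_differentiable Bx).
Unshelve. all: by end_near. Qed.

Lemma diff_trmx V p q (A : V -> 'M[R]_(p, q)) (x h : V) : Coo_at A x ->
  'd (fun y => (A y)^T) x h = ('d A x h)^T.
Proof.
move=> Ax; apply/matrixP => i j.
apply: eq_trans (esym (diff_coord _ _ _ (Coo_at_differentiable (Coo_at_trmx Ax)))) _.
rewrite mxE; apply: eq_trans (diff_coord _ _ _ (Coo_at_differentiable Ax)).
by apply: near_diffE; near=> y; rewrite mxE.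
Unshelve. all: by end_near. Qed.

Lemma diff_mulmxl V p q r (a : 'M[R]_(p, q)) (B : V -> 'M[R]_(q, r)) (x h : V) :
  Coo_at B x -> 'd (fun y => a *m B y) x h = a *m 'd B x h.
Proof.
move=> Bx; apply: (@diff_linear_comp _ _ _ _ B (fun M => a *m M)).
- exact: mulmxl_linear.
- exact: mulmxl_continuous.
- exact: Coo_at_differentiable Bx.
Qed.

Lemma diff_row_mx V p q (f : V -> 'rV[R]_p) (g : V -> 'rV[R]_q) (x h : V) :
  Coo_at f x -> Coo_at g x ->
  'd (fun y => row_mx (f y) (g y)) x h = row_mx ('d f x h) ('d g x h).
Proof.
move=> fx gx.
have C := Coo_at_differentiable (Coo_at_row_mx fx gx).
rewrite -[LHS]hsubmxK; congr row_mx.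
- apply: eq_trans (esym (diff_linear_comp h (@lsubmx_linear R p q) (@lsubmx_continuous R p q) C)) _.
  by apply: near_diffE; near=> y; rewrite row_mxKl.
- apply: eq_trans (esym (diff_linear_comp h (@rsubmx_linear R p q) (@rsubmx_continuous R p q) C)) _.
  by apply: near_diffE; near=> y; rewrite row_mxKr.
Unshelve. all: by end_near. Qed.

Lemma diff_linearE V W (l : V -> W) (x h : V) : linear l -> continuous l ->
  'd l x h = l h.
Proof.
move=> ll lc.
pose lM := GRing.isLinear.Build _ _ _ _ _ ll.
pose lL : {linear V -> W} := HB.pack l lM.
exact: (congr1 (fun k : V -> W => k h) (@diff_lin _ _ _ lL x lc)).
Qed.

Lemma diff_idE V (x h : V) : 'd (fun y : V => y) x h = h.
Proof. by apply: diff_linearE => // y; exact: cvg_id. Qed.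

Definition Jac k l (f : 'rV[R]_k -> 'rV[R]_l) (u : 'rV[R]_k) : 'M[R]_(k, l) :=
  lin1_mx ('d f u).

Lemma JacE k l (f : 'rV[R]_k -> 'rV[R]_l) u v : 'd f u v = v *m Jac f u.
Proof. by rewrite mul_rV_lin1. Qed.

Lemma Jac_smooth k l (f : 'rV[R]_k -> 'rV[R]_l) u : Coo_at f u -> Coo_at (Jac f) u.
Proof.
move=> fu; apply: Coo_at_mx => i j.
apply: Coo_at_ext (Coo_at_coord 0 j (Coo_at_diff (delta_mx 0 i) fu)).
by near=> w; rewrite mxE.
Unshelve. all: by end_near. Qed.

Lemma Jac_schwarz k l (f : 'rV[R]_k -> 'rV[R]_l) u v w : Coo_at f u ->
  v *m 'd (Jac f) u w = w *m 'd (Jac f) u v.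
Proof.
move=> fu; rewrite -!(diff_mulmxl _ _ (Jac_smooth fu)).
have E a b : 'd (fun y => a *m Jac f y) u b = 'd (fun y => 'd f y a) u b.
  by apply: near_diffE; near=> y; rewrite JacE.
apply: eq_trans (E v w) _; apply: eq_trans _ (esym (E w v)); exact: schwarz_mx.
Unshelve. all: by end_near. Qed.

Lemma diff_mulmx_row V j k l (w : V -> 'rV[R]_k) (g : V -> 'rV[R]_j) (B : 'rV[R]_j -> 'M[R]_(k, l)) x h :
  Coo_at w x -> Coo_at g x -> Coo_at B (g x) ->
  'd (fun y => w y *m B (g y)) x h = 'd w x h *m B (g x) + w x *m 'd B (g x) ('d g x h).
Proof.
move=> wx gx Bx; apply: eq_trans (diff_mulmx _ wx (Coo_at_comp gx Bx)) _.
congr (_ + _ *m _).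
exact: diff_compE (Coo_at_differentiable gx) (Coo_at_differentiable Bx).
Qed.

End matrix_calculus.

(** * Smooth maps and their differentials in arbitrary charts *)

Section smooth_maps.
Variables (R : realType) (k l : nat) (N1 : manifold R k) (N2 : manifold R l).
Variable F : N1 -> N2.

Definition local_rep (phi : chart R N1 k) (psi : chart R N2 l) :=
  chart_map psi \o F \o chart_inv phi.

Lemma near_chart_image (phi : chart R N1 k) (psi : chart R N2 l) x :
  {for x, continuous F} -> at_chart phi x -> at_chart psi (F x) ->
  \forall u \near chart_map phi x, at_chart psi (F (chart_inv phi u)).
Proof.
move=> Fc cphi cpsi; apply: (near_chart_inv (P := fun y => at_chart psi (F y)) cphi).
exact: Fc (near_at_chart cpsi).
Qed.

Lemma near_local_rep_change (phi phi' : chart R N1 k) (psi psi' : chart R N2 l) x :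
  {for x, continuous F} -> at_chart phi x -> at_chart psi (F x) ->
  at_chart phi' x ->
  \forall u \near chart_map phi' x,
    transition psi psi' (local_rep phi psi (transition phi' phi u)) = local_rep phi' psi' u.
Proof.
move=> Fc c1 c2 c1'.
apply: filterS2 (near_chart_inv c1' (near_at_chart c1)) (near_chart_image Fc c1' c2).
by move=> u h1 h2; rewrite /local_rep /transition /= chart_mapK // chart_mapK.
Qed.

Lemma local_rep_smooth (phi phi' : chart R N1 k) (psi psi' : chart R N2 l) x :
  {for x, continuous F} -> at_chart phi x -> at_chart psi (F x) ->
  at_chart phi' x -> at_chart psi' (F x) ->
  Coo_at (local_rep phi psi) (chart_map phi x) ->
  Coo_at (local_rep phi' psi') (chart_map phi' x).
Proof.
move=> Fc c1 c2 c1' c2' rC.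
have E1 : transition phi' phi (chart_map phi' x) = chart_map phi x.
  by rewrite /transition /= chart_mapK.
have E2 : local_rep phi psi (chart_map phi x) = chart_map psi (F x).
  by rewrite /local_rep /= chart_mapK.
apply: Coo_at_ext (near_local_rep_change psi' Fc c1 c2 c1') _.
apply: (@Coo_at_comp _ _ _ _ (fun u => local_rep phi psi (transition phi' phi u))).
  by apply: Coo_at_comp; [exact: transition_smooth|rewrite E1].
by rewrite E1 E2; exact: transition_smooth.
Qed.

Lemma diff_local_rep (phi phi' : chart R N1 k) (psi psi' : chart R N2 l) x v :
  {for x, continuous F} -> at_chart phi x -> at_chart psi (F x) ->
  at_chart phi' x -> at_chart psi' (F x) ->
  Coo_at (local_rep phi psi) (chart_map phi x) ->
  'd (local_rep phi' psi') (chart_map phi' x) v =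
  dtransition psi psi' (F x)
    ('d (local_rep phi psi) (chart_map phi x) (dtransition phi' phi x v)).
Proof.
move=> Fc c1 c2 c1' c2' rC.
have E1 : transition phi' phi (chart_map phi' x) = chart_map phi x.
  by rewrite /transition /= chart_mapK.
have E2 : local_rep phi psi (chart_map phi x) = chart_map psi (F x).
  by rewrite /local_rep /= chart_mapK.
apply: eq_trans (esym (near_diffE v (near_local_rep_change psi' Fc c1 c2 c1'))) _.
have d1 := Coo_at_differentiable (transition_smooth c1' c1).
have d2 : differentiable (local_rep phi psi) (transition phi' phi (chart_map phi' x)).
  by rewrite E1; exact: Coo_at_differentiable.
have d12 : differentiable (fun u => local_rep phi psi (transition phi' phi u)) (chart_map phi' x).
  exact: differentiable_comp d1 d2.
have d3 : differentiable (transition psi psi') (local_rep phi psi (transition phi' phi (chart_map phi' x))).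
  by rewrite E1 E2; exact: Coo_at_differentiable (transition_smooth c2 c2').
apply: eq_trans (diff_compE v d12 d3) _; apply: diff_congr; first by rewrite E1 E2.
by apply: eq_trans (diff_compE v d1 d2) _; exact: diff_congr.
Qed.

Lemma smooth_at_local_rep (phi : chart R N1 k) (psi : chart R N2 l) x :
  smooth_at F x -> at_chart phi x -> at_chart psi (F x) ->
  Coo_at (local_rep phi psi) (chart_map phi x).
Proof.
move=> [Fc FC] c1 c2.
exact: (local_rep_smooth Fc (at_chart_at x) (at_chart_at (F x)) c1 c2 FC).
Qed.

Lemma diff_local_rep_dmap (phi : chart R N1 k) (psi : chart R N2 l) x v :
  smooth_at F x -> at_chart phi x -> at_chart psi (F x) ->
  'd (local_rep phi psi) (chart_map phi x) v =
  dtransition (chart_at (F x)) psi (F x) (dmap F x (dtransition phi (chart_at x) x v)).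
Proof.
move=> [Fc FC] c1 c2.
exact: (diff_local_rep v Fc (at_chart_at x) (at_chart_at (F x)) c1 c2 FC).
Qed.

(** [tangent_map] differentiates in charts that move with the base point. The chain rule through the
    transitions brings these differentials into the fixed pair phi, psi. *)
Lemma tangent_map_local (phi : chart R N1 k) (psi : chart R N2 l) (z : tangent_bundle N1) :
  (forall y, smooth_at F y) -> at_chart phi (tbase z) -> at_chart psi (F (tbase z)) ->
  \forall w \near chart_map (tchart phi) z,
    chart_map (tchart psi) (tangent_map F (chart_inv (tchart phi) w)) =
    row_mx (local_rep phi psi (lsubmx w)) ('d (local_rep phi psi) (lsubmx w) (rsubmx w)).
Proof.
move=> Fs c1 c2.
have : \forall u \near chart_map phi (tbase z), [/\ at_chart phi (chart_inv phi u),
    chart_map phi (chart_inv phi u) = u & at_chart psi (F (chart_inv phi u))].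
  have [Fc _] := Fs (tbase z).
  by apply: filterS2 (near_chart_invK c1) (near_chart_image Fc c1 c2) => u [].
move=> H.
have : \forall w \near chart_map (tchart phi) z, [/\ at_chart phi (chart_inv phi (lsubmx w)),
    chart_map phi (chart_inv phi (lsubmx w)) = lsubmx w & at_chart psi (F (chart_inv phi (lsubmx w)))].
  apply: (near_lsubmx (P := fun u => [/\ at_chart phi (chart_inv phi u),
    chart_map phi (chart_inv phi u) = u & at_chart psi (F (chart_inv phi u))])).
  by rewrite /= row_mxKl.
apply: filterS => w [h1 E h2] /=; congr row_mx.
set y := chart_inv phi (lsubmx w) in h1 E h2 *.
rewrite dchartE; apply: eq_trans (_ : _ = 'd (local_rep phi psi) (chart_map phi y) (rsubmx w)) _; last exact: diff_congr.
apply: eq_trans _ (esym (diff_local_rep_dmap _ (Fs y) h1 h2)).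
have := dchart_invE (rsubmx w) h1; rewrite E => Ez.
exact: (congr1 (fun t => dtransition (chart_at (F y)) psi (F y) (dmap F y t)) Ez).
Unshelve. all: by end_near. Qed.

End smooth_maps.

(** * Vector fields as sections of the tangent bundle *)

Section fields.
Variables (R : realType) (n : nat) (M : manifold R n).
Implicit Types (phi psi : chart R M n).

(** Near the points of the domain of phi this inverts [vfield_rep phi]. It is how maps on R^n become
    test fields for the axioms of the metric, of [nabla] and of the connection map. *)
Definition chart_field phi (f : 'rV[R]_n -> 'rV[R]_n) : vfield M :=
  fun y => dchart_inv phi (chart_map phi y) (f (chart_map phi y)).

Lemma chart_fieldE phi f y : at_chart phi y ->
  chart_field phi f y = dtransition phi (chart_at y) y (f (chart_map phi y)).
Proof. by move=> cy; rewrite /chart_field dchart_invE. Qed.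

Lemma near_chart_field_rep phi psi f x : at_chart phi x -> at_chart psi x ->
  \forall u \near chart_map psi x, vfield_rep psi (chart_field phi f) u =
    'd (transition phi psi) (transition psi phi u) (f (transition psi phi u)).
Proof.
move=> c1 c2.
apply: filterS2 (near_chart_inv c2 (near_at_chart c1)) (near_chart_inv c2 (near_at_chart c2)).
move=> u h1 h2; rewrite /vfield_rep dchartE chart_fieldE //.
by rewrite dtransition_comp //; exact: at_chart_at.
Qed.

Lemma vfield_rep_chart_field phi f x : at_chart phi x ->
  \forall u \near chart_map phi x, vfield_rep phi (chart_field phi f) u = f u.
Proof.
move=> c1; apply: filterS2 (near_chart_field_rep f c1 c1) (near_chart_invK c1).
move=> u -> [h E]; have T : transition phi phi u = u := E.
rewrite T; apply: eq_trans (_ : _ = dtransition phi phi (chart_inv phi u) (f u)) _.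
  by apply: diff_congr => //; rewrite E.
exact: dtransition_id.
Qed.

Lemma as_section_smooth (X : vfield M) x psi : at_chart psi x ->
  Coo_at (vfield_rep psi X) (chart_map psi x) ->
  {for x, continuous (as_section X)}.
Proof.
move=> c1 XC.
apply: (@tangent_bundle_continuous R n M _ (as_section X) x psi) => //.
  by apply: filterS (near_at_chart c1) => y [].
have gC : Coo_at (fun u => row_mx u (vfield_rep psi X u)) (chart_map psi x).
  by apply: Coo_at_row_mx => //; exact: Coo_at_id.
have mc : {for x, continuous (chart_map psi)}.
  by have [ap dx] := c1; have [_ _ _ mc _] := manifold_chart ap; exact: mc.
have cc : {for x, continuous ((fun u => row_mx u (vfield_rep psi X u)) \o chart_map psi)}.
  by apply: continuous_comp => //; exact: Coo_at_continuous gC.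
have E : \forall y \near x, ((fun u => row_mx u (vfield_rep psi X u)) \o chart_map psi) y =
    chart_map (tchart psi) (as_section X y).
  by apply: filterS (near_at_chart c1) => y cy /=; rewrite /vfield_rep chart_mapK.
rewrite /prop_for /continuous_at -(nbhs_singleton E).
by apply: cvg_trans cc; exact: near_eq_cvg.
Qed.

Lemma near_section_rep (X : vfield M) x :
  \forall u \near chart_map (chart_at x) x,
   (chart_map (@chart_at _ _ (tangent_bundle M) (as_section X x)) \o as_section X \o chart_inv (chart_at x)) u =
   row_mx u (vfield_rep (chart_at x) X u).
Proof.
by apply: filterS (near_chart_invK (at_chart_at x)) => u [h E] /=; rewrite E.
Qed.

(** In the tangent charts a section reads u |-> (u, X(u)), so only the second component carries a
    condition. *)
Lemma smooth_sectionP (X : vfield M) x :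
  smooth_at (as_section X) x <-> Coo_at (vfield_rep (chart_at x) X) (chart_map (chart_at x) x).
Proof.
split=> [[Xc XC]|XC].
  have := Coo_at_rsubmx (Coo_at_ext (near_section_rep X x) XC).
  by apply: Coo_at_ext; near=> u; rewrite row_mxKr.
split; first exact: as_section_smooth (at_chart_at x) XC.
apply: (Coo_at_ext (f := fun u => row_mx u (vfield_rep (chart_at x) X u))).
  by apply: filterS (near_section_rep X x) => u ->.
by apply: Coo_at_row_mx => //; exact: Coo_at_id.
Unshelve. all: by end_near. Qed.

Lemma chart_field_smooth phi f x : at_chart phi x -> Coo_at f (chart_map phi x) ->
  smooth_at (as_section (chart_field phi f)) x.
Proof.
move=> c1 fC; apply/smooth_sectionP.
have c2 := at_chart_at x.
have tC := transition_smooth c2 c1.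
have E : transition (chart_at x) phi (chart_map (chart_at x) x) = chart_map phi x.
  by rewrite /transition /= chart_mapK.
apply: (Coo_at_ext (f := fun u => 'd (transition phi (chart_at x)) (transition (chart_at x) phi u)
   (f (transition (chart_at x) phi u)))).
  by apply: filterS (near_chart_field_rep f c1 c2) => u ->.
apply: Coo_at_diff2 => //; first by rewrite E; exact: transition_smooth.
by apply: Coo_at_comp => //; rewrite E.
Qed.

Lemma dmap_section (X : vfield M) x v : smooth_at (as_section X) x ->
  dmap (as_section X) x v =
  row_mx v ('d (vfield_rep (chart_at x) X) (chart_map (chart_at x) x) v).
Proof.
move=> /smooth_sectionP XC.
apply: eq_trans (near_diffE v (near_section_rep X x)) _.
apply: eq_trans (diff_row_mx v (Coo_at_id _) XC) _.
exact: (congr1 (fun t => row_mx t _) (diff_idE _ _)).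
Qed.

Lemma dmap_bundle_proj (z : tangent_bundle M) A :
  dmap (@bundle_proj R n M) z A = lsubmx A.
Proof.
apply: eq_trans (near_diffE A (g := fun w : 'rV[R]_(n + n) => lsubmx w) _) _.
  have H := near_chart_invK (at_chart_at (tbase z)).
  have : \forall w \near chart_map (tchart (chart_at (tbase z))) z,
      chart_map (chart_at (tbase z)) (chart_inv (chart_at (tbase z)) (lsubmx w)) = lsubmx w.
    apply: (near_lsubmx (P := fun u => chart_map (chart_at (tbase z)) (chart_inv (chart_at (tbase z)) u) = u)).
    by rewrite /= row_mxKl; apply: filterS H => u [].
  by apply: filterS => w.
by apply: diff_linearE; [exact: lsubmx_linear|exact: lsubmx_continuous].
Qed.

End fields.

(** * Metrics, connections and submersions in coordinates *)

Section bilinear_forms.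
Variable R : realType.

Definition form n (A : 'M[R]_n) (a b : 'rV[R]_n) : R := (a *m A *m b^T) 0 0.

Definition posdef n (A : 'M[R]_n) := A^T = A /\ forall a, a != 0 -> 0 < form A a a.

Section form_theory.
Variables (n : nat) (A : 'M[R]_n).

Lemma form_delta_r a j : form A a (delta_mx 0 j) = (a *m A) 0 j.
Proof. by rewrite /form trmx_delta -colE mxE. Qed.

Lemma form_delta_l i b : form A (delta_mx 0 i) b = (A *m b^T) i 0.
Proof. by rewrite /form -rowE -row_mul mxE. Qed.

Lemma formDl a b c : form A (a + b) c = form A a c + form A b c.
Proof. by rewrite /form !mulmxDl mxE. Qed.

Lemma formDr a b c : form A a (b + c) = form A a b + form A a c.
Proof. by rewrite /form linearD /= mulmxDr mxE. Qed.

Lemma formNl a c : form A (- a) c = - form A a c.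
Proof. by rewrite /form !mulNmx mxE. Qed.

Lemma formNr a c : form A a (- c) = - form A a c.
Proof. by rewrite /form linearN /= mulmxN mxE. Qed.

Lemma formBl a b c : form A (a - b) c = form A a c - form A b c.
Proof. by rewrite formDl formNl. Qed.

Lemma formBr a b c : form A a (b - c) = form A a b - form A a c.
Proof. by rewrite formDr formNr. Qed.

Lemma formZl k a c : form A (k *: a) c = k * form A a c.
Proof. by rewrite /form -!scalemxAl mxE. Qed.

Lemma form0l c : form A 0 c = 0.
Proof. by rewrite /form !mul0mx mxE. Qed.

Lemma form0r c : form A c 0 = 0.
Proof. by rewrite /form trmx0 mulmx0 mxE. Qed.

Lemma form_sym a b : A^T = A -> form A a b = form A b a.
Proof.
move=> As; have E : (b *m A *m a^T)^T = a *m A *m b^T.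
  by rewrite !trmx_mul trmxK As mulmxA.
by rewrite /form -E mxE.
Qed.

Lemma form_eq0 a : posdef A -> form A a a = 0 -> a = 0.
Proof.
move=> [_ Ap] E; apply/eqP; apply: contraT => /Ap; by rewrite E ltxx.
Qed.

Lemma form_ge0 a : posdef A -> 0 <= form A a a.
Proof.
by move=> [_ Ap]; have [->|/Ap/ltW//] := eqVneq a 0; rewrite form0l.
Qed.

Lemma posdef_unit : posdef A -> A \in unitmx.
Proof.
move=> Ap; rewrite -row_free_unit -kermx_eq0; apply/eqP/row_matrixP => i.
rewrite row0; apply: form_eq0 Ap _.
by rewrite /form -row_mul mulmx_ker row0 mul0mx mxE.
Qed.

Lemma form_nondegenerate a : posdef A -> (forall b, form A a b = 0) -> a = 0.
Proof. by move=> Ap H; apply: form_eq0. Qed.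

End form_theory.

Lemma form_mul n m (A : 'M[R]_n) (B : 'M[R]_(m, n)) a b :
  form A (a *m B) (b *m B) = form (B *m A *m B^T) a b.
Proof. by rewrite /form trmx_mul !mulmxA. Qed.

Lemma posdef_inv n (A : 'M[R]_n) : posdef A -> posdef (invmx A).
Proof.
move=> Ap; have Au := posdef_unit Ap; have [As Ap'] := Ap.
have iA : (invmx A)^T = invmx A by rewrite trmx_inv As.
split=> // a a0; have -> : form (invmx A) a a = form A (a *m invmx A) (a *m invmx A).
  by rewrite form_mul iA mulVmx // mul1mx.
apply: Ap'; apply: contra a0 => /eqP E; apply/eqP.
by rewrite -[a](mulmxKV Au) E mul0mx.
Qed.

Section lift.
Variables (n m : nat) (J : 'M[R]_(n, m)) (A : 'M[R]_n).
Hypothesis Ap : posdef A.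
Hypothesis Jsurj : forall b : 'rV[R]_m, exists a : 'rV[R]_n, a *m J = b.

(** A weighted pseudo-inverse of J: the rows of J^T A^-1 are A-orthogonal to all U with U J = 0, and
    the first factor normalizes them. Being an explicit formula, it depends smoothly on J and A. *)
Definition lift_matrix : 'M[R]_(m, n) :=
  invmx (J^T *m invmx A *m J) *m J^T *m invmx A.

Lemma posdef_pushforward : posdef (J^T *m invmx A *m J).
Proof.
have [iA ip] := posdef_inv Ap; split; first by rewrite !trmx_mul trmxK iA mulmxA.
move=> a a0; rewrite -[J in _ *m J]trmxK -form_mul; apply: ip.
apply: contra a0 => /eqP E; apply/eqP.
(* Definiteness: if a J^T = 0 and a = b J, then a a^T = a J^T b^T = 0. *)
have [b bE] := Jsurj a.
suff : a *m a^T = 0.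
  move=> /matrixP/(_ 0 0); rewrite !mxE => /eqP.
  rewrite psumr_eq0 => [/allP H|i _]; last by rewrite !mxE -expr2 sqr_ge0.
  apply/rowP => i; rewrite mxE; apply/eqP.
  by have := H i (mem_index_enum i); rewrite /= !mxE mulf_eq0 orbb.
by rewrite -{2}bE trmx_mul mulmxA E mul0mx.
Qed.

Lemma lift_matrixK : lift_matrix *m J = 1%:M.
Proof.
rewrite /lift_matrix; set S := invmx _; rewrite -!mulmxA (mulmxA J^T).
by rewrite mulVmx //; exact: posdef_unit posdef_pushforward.
Qed.

Lemma lift_matrix_horizontal a U : U *m J = 0 -> form A (a *m lift_matrix) U = 0.
Proof.
move=> UJ; rewrite /form /lift_matrix; set S := invmx _.
rewrite !mulmxA mulmxKV ?posdef_unit // -!mulmxA -trmx_mul UJ trmx0 !mulmx0.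
by rewrite mxE.
Qed.

Lemma horizontal_lift_matrix h : (forall U, U *m J = 0 -> form A h U = 0) ->
  h = h *m J *m lift_matrix.
Proof.
move=> hh; apply/eqP; rewrite -subr_eq0; apply/eqP; apply: form_eq0 Ap _.
have V : (h - h *m J *m lift_matrix) *m J = 0.
  by rewrite mulmxBl -(mulmxA _ lift_matrix) lift_matrixK mulmx1 subrr.
by rewrite formBl hh // lift_matrix_horizontal // subrr.
Qed.

(** The part b - b J L of a vector b is vertical, hence orthogonal to lifts, and <a L, b> = <a L, b
    J L> = G(a, b J). *)
Lemma lift_matrix_isometry (G : 'M[R]_m) : G^T = G ->
  (forall a b, form A (a *m lift_matrix) (b *m lift_matrix) = form G a b) ->
  lift_matrix *m A = G *m J^T.
Proof.
move=> Gs iso; apply/row_matrixP => i; apply/rowP => j.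
rewrite !rowE mulmxA -form_delta_r.
set a := delta_mx 0 i; set b := delta_mx 0 j.
have V : (b - b *m J *m lift_matrix) *m J = 0.
  by rewrite mulmxBl -(mulmxA _ lift_matrix) lift_matrixK mulmx1 subrr.
have := lift_matrix_horizontal a V; rewrite formBr iso => /eqP; rewrite subr_eq0 => /eqP.
by rewrite {2}/form trmx_mul !mulmxA => ->; rewrite /b trmx_delta -colE mxE.
Qed.

End lift.
End bilinear_forms.

(** * Smooth sections and coordinate fields *)

Section sections.
Variables (R : realType) (n : nat) (M : manifold R n).
Implicit Types (phi psi : chart R M n) (X Y : vfield M).

Lemma smooth_sectionD X Y y : smooth_at (as_section X) y -> smooth_at (as_section Y) y ->
  smooth_at (as_section (fun z => X z + Y z)) y.
Proof.
move=> /smooth_sectionP XC /smooth_sectionP YC; apply/smooth_sectionP.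
apply: Coo_at_ext (Coo_atD XC YC); near=> u.
by rewrite /vfield_rep /dchart linearD.
Unshelve. all: by end_near. Qed.

Lemma smooth_sectionZ (f : M -> R) X y : smooth_fun_at f y -> smooth_at (as_section X) y ->
  smooth_at (as_section (fun z => f z *: X z)) y.
Proof.
move=> fC /smooth_sectionP XC; apply/smooth_sectionP.
apply: Coo_at_ext (Coo_atZ fC XC); near=> u.
by rewrite /vfield_rep /dchart linearZ.
Unshelve. all: by end_near. Qed.

Lemma smooth_section0 y : smooth_at (as_section (fun _ : M => 0)) y.
Proof.
apply/smooth_sectionP; apply: Coo_at_ext (Coo_at_cst 0 _); near=> u.
by rewrite /vfield_rep /dchart linear0.
Unshelve. all: by end_near. Qed.

Lemma vfield_rep_smooth phi X y : at_chart phi y -> smooth_at (as_section X) y ->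
  Coo_at (vfield_rep phi X) (chart_map phi y).
Proof.
move=> c1 /smooth_sectionP XC; have c2 := at_chart_at y.
have E : transition phi (chart_at y) (chart_map phi y) = chart_map (chart_at y) y.
  by rewrite /transition /= chart_mapK.
apply: (Coo_at_ext (f := fun u => 'd (transition (chart_at y) phi) (transition phi (chart_at y) u)
   (vfield_rep (chart_at y) X (transition phi (chart_at y) u)))).
  apply: filterS2 (near_chart_inv c1 (near_at_chart c1)) (near_chart_inv c1 (near_at_chart c2)).
  move=> u h1 h2; set z := chart_inv phi u in h1 h2.
  rewrite /vfield_rep /transition /= -/z chart_mapK //.
  rewrite !dchartE -[LHS]/(dtransition (chart_at y) phi z _).
  by rewrite dtransition_comp //; exact: at_chart_at.
have tC := transition_smooth c1 c2.
apply: Coo_at_diff2 => //; first by rewrite E; exact: transition_smooth.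
by apply: Coo_at_comp => //; rewrite E.
Qed.

Lemma smooth_fun_of_rep phi (h : 'rV[R]_n -> R) (f : M -> R) y : at_chart phi y ->
  (\forall z \near y, f z = h (chart_map phi z)) -> Coo_at h (chart_map phi y) ->
  smooth_fun_at f y.
Proof.
move=> c1 fh hC; have c2 := at_chart_at y.
have E : transition (chart_at y) phi (chart_map (chart_at y) y) = chart_map phi y.
  by rewrite /transition /= chart_mapK.
apply: (Coo_at_ext (f := fun u => h (transition (chart_at y) phi u))).
  by apply: filterS (near_chart_inv c2 fh) => u /= ->.
by apply: Coo_at_comp; [exact: transition_smooth|rewrite E].
Qed.

Lemma near_chart_field_smooth phi f x : at_chart phi x -> Coo_at f (chart_map phi x) ->
  \forall y \near x, smooth_at (as_section (@chart_field _ _ M phi f)) y.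
Proof.
move=> c1 fC; apply: filterS2 (near_at_chart c1) (near_chart_map c1 (Coo_at_near fC)).
by move=> y cy fy; exact: chart_field_smooth.
Qed.

Lemma chart_field_at x f :
  @chart_field _ _ M (chart_at x) f x = f (chart_map (chart_at x) x).
Proof.
apply: eq_trans (chart_fieldE f (at_chart_at x)) _.
exact: dtransition_id (at_chart_at x).
Qed.

Definition coord_field phi (i : 'I_n) : vfield M := chart_field phi (fun _ => delta_mx 0 i).

Lemma coord_field_smooth phi i y : at_chart phi y -> smooth_at (as_section (coord_field phi i)) y.
Proof. by move=> c1; apply: chart_field_smooth => //; exact: Coo_at_cst. Qed.

Lemma coord_field_expansion phi X y : at_chart phi y ->
  X y = \sum_i (dchart phi y (X y)) 0 i *: coord_field phi i y.
Proof.
move=> c1; have c2 := at_chart_at y.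
transitivity (dtransition phi (chart_at y) y (dchart phi y (X y))).
  by rewrite dchartE dtransitionK.
rewrite {1}(row_sum_delta (dchart phi y (X y))) /dtransition linear_sum.
by apply: eq_bigr => i _; rewrite linearZ /= /coord_field chart_fieldE.
Qed.

End sections.

(** * Christoffel and Gram matrices *)

Section levi_civita_coordinates.
Variables (R : realType) (n : nat) (M : manifold R n).
Variables (g : riem_metric M) (nabla : covariant M).
Hypothesis nablaP : levi_civita g nabla.

(* Row i is the covariant derivative of the i-th coordinate field. *)
Definition christoffel (x : M) (v : 'rV[R]_n) : 'M[R]_n :=
  \matrix_(i, j) nabla (coord_field (chart_at x) i) x v 0 j.

Lemma near_chart_open (phi : chart R M n) x (Q : M -> Prop) : at_chart phi x ->
  (\forall y \near x, Q y) ->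
  exists U : set M, [/\ open U, U x & forall y, U y -> at_chart phi y /\ Q y].
Proof.
move=> c1 Qx.
have : \forall y \near x, at_chart phi y /\ Q y.
  by apply: filterS2 (near_at_chart c1) Qx.
by move=> /near_open.
Qed.

Lemma nabla0 x v : nabla (fun _ => 0) x v = 0.
Proof.
have zs : smooth_vfield_on setT (fun _ : M => 0 : 'rV[R]_n).
  by move=> y _; exact: smooth_section0.
have fs : smooth_fun_on setT (fun _ : M => 0 : R).
  by move=> y _; exact: Coo_at_cst.
have E := lc_leibniz nablaP v openT I fs zs (x := x).
have -> : (fun _ : M => 0) = (fun y : M => (0 : R) *: (0 : 'rV[R]_n)).
  by apply/funext => y; rewrite scaler0.
by apply: eq_trans E _; rewrite scale0r addr0 scaler0.
Qed.

(** Locality and the Leibniz rule applied to the expansion of X in the coordinate fields on a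
    neighbourhood of x. *)
Lemma nabla_coordinates X x v : (\forall y \near x, smooth_at (as_section X) y) ->
  nabla X x v = 'd (vfield_rep (chart_at x) X) (chart_map (chart_at x) x) v +
    X x *m christoffel x v.
Proof.
move=> Xs; have c0 := at_chart_at x; set phi := chart_at x.
have [U [oU Ux UP]] := near_chart_open c0 Xs.
pose f (i : 'I_n) (y : M) : R := dchart phi y (X y) 0 i.
have fs i : smooth_fun_on U (f i).
  move=> y /UP[cy Xy].
  apply: (smooth_fun_of_rep (phi := phi) (h := fun u => vfield_rep phi X u 0 i)) => //.
    by apply: filterS (near_at_chart cy) => z cz; rewrite /vfield_rep chart_mapK.
  by apply: Coo_at_coord; exact: vfield_rep_smooth.
have Es i : smooth_vfield_on U (coord_field phi i).
  by move=> y /UP[cy _]; exact: coord_field_smooth.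
have fEs i : smooth_vfield_on U (fun y => f i y *: coord_field phi i y).
  by move=> y Uy; apply: smooth_sectionZ; [exact: fs|exact: Es].
(* The axiom [lc_add] treats two fields at a time and wants both smooth, so the expansion is handled
   through its partial sums. *)
pose S (r : seq 'I_n) (y : M) := \sum_(i <- r) f i y *: coord_field phi i y.
have Scons i r : S (i :: r) = (fun y => f i y *: coord_field phi i y + S r y).
  by apply/funext => y; rewrite /S big_cons.
have S0 : S [::] = (fun _ => 0) by apply/funext => y; rewrite /S big_nil.
have Ss r : smooth_vfield_on U (S r).
  elim: r => [|i r IH] y Uy; first by rewrite S0; exact: smooth_section0.
  by rewrite Scons; apply: smooth_sectionD; [exact: fEs|exact: IH].
have SE r : nabla (S r) x v = \sum_(i <- r) (dfun (f i) x v *: coord_field phi i x +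
    f i x *: nabla (coord_field phi i) x v).
  elim: r => [|i r IH]; first by rewrite S0 nabla0 big_nil.
  rewrite Scons (lc_add nablaP _ oU Ux (fEs i) (Ss r)) big_cons -IH; congr (_ + _).
  exact: (lc_leibniz nablaP _ oU Ux (fs i) (Es i)).
have XS y : U y -> X y = S (index_enum 'I_n) y.
  by move=> /UP[cy _]; exact: coord_field_expansion.
have XsU : smooth_vfield_on U X by move=> y /UP[].
rewrite (lc_local nablaP _ oU Ux XsU XS) SE big_split /=; congr (_ + _).
  have XC : Coo_at (vfield_rep phi X) (chart_map phi x).
    by apply: vfield_rep_smooth => //; have [] := UP x Ux.
  rewrite [RHS]row_sum_delta; apply: eq_bigr => i _.
  congr (_ *: _); last exact: chart_field_at.
  apply: eq_trans _ (diff_coord _ 0 i (Coo_at_differentiable XC)).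
  by apply: near_diffE; apply: filterS (near_chart_invK c0) => u [h E].
apply/rowP => j; rewrite summxE mxE; apply: eq_bigr => i _.
by rewrite !mxE /f dchartE dtransition_id.
Qed.

Lemma christoffel_linear x : linear (christoffel x).
Proof.
move=> a u v; have c0 := at_chart_at x.
have [U [oU Ux UP]] := near_chart_open c0 (near_at_chart c0).
apply/matrixP => i j; rewrite !mxE.
have Es : smooth_vfield_on U (coord_field (chart_at x) i).
  by move=> y /UP[cy _]; exact: coord_field_smooth.
by rewrite (lc_linear nablaP _ _ _ oU Ux Es) !mxE.
Qed.

Lemma nabla_chart_field x (f : 'rV[R]_n -> 'rV[R]_n) v :
  Coo_at f (chart_map (chart_at x) x) ->
  nabla (chart_field (chart_at x) f) x v =
    'd f (chart_map (chart_at x) x) v + f (chart_map (chart_at x) x) *m christoffel x v.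
Proof.
move=> fC; have c0 := at_chart_at x.
have E1 := near_diffE v (vfield_rep_chart_field f c0).
have E2 := @chart_field_at _ _ M x f.
have S := near_chart_field_smooth c0 fC.
have H := nabla_coordinates v S.
rewrite E2 in H.
rewrite {}H.
exact: (congr1 (fun a => a + f (chart_map (chart_at x) x) *m christoffel x v) E1).
Qed.

(** Vanishing torsion, tested on the two fields with constant components a and b in the chart at x,
    whose bracket is 0. *)
Lemma christoffel_sym x a b : b *m christoffel x a = a *m christoffel x b.
Proof.
have c0 := at_chart_at x.
pose A c := chart_field (chart_at x) (fun _ : 'rV[R]_n => c).
have [U [oU Ux UP]] := near_chart_open c0 (near_at_chart c0).
have As c : smooth_vfield_on U (A c).
  by move=> y /UP[cy _]; apply: chart_field_smooth => //; exact: Coo_at_cst.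
have Ax c : A c x = c by exact: chart_field_at.
have rep c v : 'd (vfield_rep (chart_at x) (A c)) (chart_map (chart_at x) x) v = 0.
  apply: eq_trans (diff_cstE c (chart_map (chart_at x) x) v).
  by apply: near_diffE; exact: vfield_rep_chart_field.
have nE c v : nabla (A c) x v = c *m christoffel x v.
  apply: eq_trans (nabla_chart_field v (Coo_at_cst c _)) _.
  exact: eq_trans (congr1 (fun t => t + c *m christoffel x v) (diff_cstE _ _ _)) (add0r _).
have bE : bracket (A a) (A b) x = 0.
  exact: eq_trans (congr2 (fun s t => s - t) (rep b _) (rep a _)) (subrr 0).
have T := lc_torsion nablaP oU Ux (As a) (As b).
by rewrite !nE bE !Ax in T; apply/eqP; rewrite -subr_eq0; apply/eqP.
Qed.

Definition gram (phi : chart R M n) (u : 'rV[R]_n) : 'M[R]_n :=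
  \matrix_(i, j) g (chart_inv phi u) (dchart_inv phi u (delta_mx 0 i))
    (dchart_inv phi u (delta_mx 0 j)).

Lemma metric0 x w : g x 0 w = 0.
Proof. by have := metric_linear g x (-1) 0 0 w; rewrite scaler0 addr0 mulN1r addNr. Qed.

Lemma metricD x u v w : g x (u + v) w = g x u w + g x v w.
Proof. by have := metric_linear g x 1 u v w; rewrite scale1r mul1r. Qed.

Lemma metricZ x a u w : g x (a *: u) w = a * g x u w.
Proof. by have := metric_linear g x a u 0 w; rewrite addr0 metric0 addr0. Qed.

Lemma metric_sum x (I : Type) (r : seq I) (f : I -> 'rV[R]_n) w :
  g x (\sum_(i <- r) f i) w = \sum_(i <- r) g x (f i) w.
Proof.
by elim: r => [|i r IH]; rewrite ?big_nil ?metric0 // !big_cons metricD IH.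
Qed.

Lemma gram_form phi x a b : at_chart phi x ->
  g x (dtransition phi (chart_at x) x a) (dtransition phi (chart_at x) x b) =
  form (gram phi (chart_map phi x)) a b.
Proof.
move=> c1.
have dE c : dtransition phi (chart_at x) x c =
    \sum_i c 0 i *: dchart_inv phi (chart_map phi x) (delta_mx 0 i).
  rewrite {1}(row_sum_delta c) /dtransition linear_sum; apply: eq_bigr => i _.
  by rewrite linearZ /= dchart_invE.
rewrite /form mxE; rewrite !dE metric_sum.
rewrite (eq_bigr (fun i => \sum_j a 0 i * gram phi (chart_map phi x) i j * b 0 j)); last first.
  move=> i _; rewrite metricZ Defs.metric_sym metric_sum mulr_sumr; apply: eq_bigr => j _.
  by rewrite metricZ Defs.metric_sym !mxE chart_mapK //; ring.
rewrite exchange_big /=; apply: eq_bigr => j _.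
by rewrite !mxE mulr_suml.
Qed.

Lemma gram_form_at x a b : g x a b = form (gram (chart_at x) (chart_map (chart_at x) x)) a b.
Proof.
by rewrite -gram_form ?dtransition_id //; exact: at_chart_at.
Qed.

Lemma gram_sym phi u : (gram phi u)^T = gram phi u.
Proof. by apply/matrixP => i j; rewrite !mxE Defs.metric_sym. Qed.

Lemma near_gram x i j : \forall u \near chart_map (chart_at x) x,
  gram (chart_at x) u i j = g (chart_inv (chart_at x) u)
    (coord_field (chart_at x) i (chart_inv (chart_at x) u))
    (coord_field (chart_at x) j (chart_inv (chart_at x) u)).
Proof.
apply: filterS (near_chart_invK (at_chart_at x)) => u [h E].
by rewrite mxE /coord_field /chart_field E.
Qed.

Lemma gram_smooth x : Coo_at (gram (chart_at x)) (chart_map (chart_at x) x).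
Proof.
have c0 := at_chart_at x.
have [U [oU Ux UP]] := near_chart_open c0 (near_at_chart c0).
have Es i : smooth_vfield_on U (coord_field (chart_at x) i).
  by move=> y /UP[cy _]; exact: coord_field_smooth.
apply: Coo_at_mx => i j.
have := metric_smooth g oU (Es i) (Es j) Ux.
by apply: Coo_at_ext; apply: filterS (near_gram x i j) => u ->.
Qed.

(** Compatibility with the metric, tested on pairs of coordinate fields. *)
Lemma gram_deriv x v : 'd (gram (chart_at x)) (chart_map (chart_at x) x) v =
  christoffel x v *m gram (chart_at x) (chart_map (chart_at x) x) +
  gram (chart_at x) (chart_map (chart_at x) x) *m (christoffel x v)^T.
Proof.
have c0 := at_chart_at x.
have [U [oU Ux UP]] := near_chart_open c0 (near_at_chart c0).
have Es i : smooth_vfield_on U (coord_field (chart_at x) i).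
  by move=> y /UP[cy _]; exact: coord_field_smooth.
have Ex i : coord_field (chart_at x) i x = delta_mx 0 i by exact: chart_field_at.
apply/matrixP => i j.
apply: eq_trans (esym (diff_coord _ _ _ (Coo_at_differentiable (gram_smooth x)))) _.
apply: eq_trans (near_diffE v (near_gram x i j)) _.
apply: eq_trans (lc_metric nablaP v oU Ux (Es i) (Es j)) _.
rewrite !Ex [in RHS]mxE; set A := gram _ _.
have rowE k : nabla (coord_field (chart_at x) k) x v = row k (christoffel x v).
  by apply/rowP => l; rewrite !mxE.
rewrite !rowE !gram_form_at -/A form_delta_r form_delta_l -row_mul mxE.
by congr (_ + _); rewrite !mxE; apply: eq_bigr => k _; rewrite !mxE.
Qed.

End levi_civita_coordinates.

Lemma diff_affine (R : realType) (W : normedModType R) (a v : W) (t : R) :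
  'd (fun s : R => a + s *: v) t 1 = v.
Proof.
apply: eq_trans (diff_addE (f := fun _ : R => a) (g := fun s : R => s *: v) _ _ _) _.
- exact: Coo_at_differentiable (Coo_at_cst _ _).
- by apply: Coo_at_differentiable; apply: Coo_atZ; [exact: Coo_at_id|exact: Coo_at_cst].
rewrite diff_cstE add0r.
apply: eq_trans (diff_scaleE (a := fun s : R => s) (f := fun _ : R => v) _ _ _) _.
- exact: Coo_at_differentiable (Coo_at_id _).
- exact: Coo_at_differentiable (Coo_at_cst _ _).
by rewrite diff_cstE scaler0 add0r diff_idE scale1r.
Qed.

Lemma Coo_at_affine (R : realType) (W : normedModType R) (a v : W) (t : R) :
  Coo_at (fun s : R => a + s *: v) t.
Proof.
apply: Coo_atD; first exact: Coo_at_cst.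
by apply: Coo_atZ; [exact: Coo_at_id|exact: Coo_at_cst].
Qed.

Lemma Coo_at_translate_mx (R : realType) n m (c : 'rV[R]_m) (N : 'M[R]_(n, m)) x :
  Coo_at (fun u : 'rV[R]_n => c + u *m N) x.
Proof.
apply: Coo_atD; first exact: Coo_at_cst.
by apply: Coo_at_mulmx; [exact: Coo_at_id|exact: Coo_at_cst].
Qed.

Lemma diff_translate_mx (R : realType) n m (c : 'rV[R]_m) (N : 'M[R]_(n, m)) x h :
  'd (fun u : 'rV[R]_n => c + u *m N) x h = h *m N.
Proof.
have l : linear (fun u : 'rV[R]_n => u *m N).
  by move=> k u v; rewrite mulmxDl scalemxAl.
have C : Coo_at (fun u : 'rV[R]_n => u *m N) x.
  by apply: Coo_at_linear => //; exact: row_linear_continuous.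
apply: eq_trans (diff_addE h (Coo_at_differentiable (Coo_at_cst c x)) (Coo_at_differentiable C)) _.
apply: eq_trans (congr2 +%R (diff_cstE c x h) (diff_linearE x h l (row_linear_continuous l))) _.
exact: add0r.
Qed.

(** * Tangent vectors through curves of coordinates *)

Section tangent_curves.
Variables (R : realType) (n : nat) (M : manifold R n).

Lemma derive1_diff (W : normedModType R) (c : R -> W) (t : R) :
  differentiable c t -> derive1 c t = 'd c t 1.
Proof. exact: derive1E'. Qed.

Lemma tangent_at_setT (x : M) v : tangent_at setT x v.
Proof.
have c0 := at_chart_at x; set phi := chart_at x in c0 *; set u0 := chart_map phi x.
pose W (t : R) := u0 + t *: v.
have WC (t : R) : Coo_at W t by exact: Coo_at_affine.
have W0 : W 0 = u0 by rewrite /W scale0r addr0.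
have Wc := Coo_at_continuous (WC 0).
have E : \forall t \near (0 : R), W t = chart_map phi (chart_inv phi (W t)).
  have H := near_chart_invK c0.
  have : \forall t \near (0 : R), at_chart phi (chart_inv phi (W t)) /\ chart_map phi (chart_inv phi (W t)) = W t.
    apply: (Wc (fun u => at_chart phi (chart_inv phi u) /\ chart_map phi (chart_inv phi u) = u)).
    by rewrite W0.
  by apply: filterS => t [_ ->].
have fC : Coo_at (fun t => chart_map phi (chart_inv phi (W t))) 0 by exact: Coo_at_ext E (WC 0).
exists (fun t => chart_inv phi (W t)); split.
- by rewrite W0 chart_mapK.
- split; last exact: fC.
  have [ap dx] := c0; have [_ _ _ _ ic] := manifold_chart ap.
  by apply: (@continuous_comp _ _ _ W (chart_inv phi)) => //; rewrite W0; exact: ic.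
- by near=> t.
have E1 : 'd W 0 1 = 'd (fun t => chart_map phi (chart_inv phi (W t))) 0 1.
  exact: near_diffE E.
apply: eq_trans (derive1_diff (Coo_at_differentiable fC)) _.
apply: eq_trans (esym E1) _; exact: diff_affine.
Unshelve. all: by end_near. Qed.

Implicit Types (z : tangent_bundle M).

Lemma tchart_mapK phi z : at_chart phi (tbase z) ->
  chart_inv (tchart phi) (chart_map (tchart phi) z) = z.
Proof.
case: z => x v /= c1; rewrite /= row_mxKl row_mxKr chart_mapK //; congr TVec.
rewrite dchart_invE // dchartE; apply: dtransitionK => //; exact: at_chart_at.
Qed.

Lemma near_tchart_invK phi z : at_chart phi (tbase z) ->
  \forall w \near chart_map (tchart phi) z,
    at_chart phi (tbase (chart_inv (tchart phi) w)) /\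
    chart_map (tchart phi) (chart_inv (tchart phi) w) = w.
Proof.
move=> c1.
have : \forall w \near chart_map (tchart phi) z, at_chart phi (chart_inv phi (lsubmx w)) /\
   chart_map phi (chart_inv phi (lsubmx w)) = lsubmx w.
  apply: (near_lsubmx (P := fun u => at_chart phi (chart_inv phi u) /\ chart_map phi (chart_inv phi u) = u)).
  by rewrite /= row_mxKl; exact: near_chart_invK.
apply: filterS => w [h E]; split=> //=.
rewrite E -[RHS]hsubmxK; congr row_mx.
set y := chart_inv phi (lsubmx w) in h E *.
have := dchart_invE (rsubmx w) h; rewrite E => ->; rewrite dchartE.
by apply: dtransitionK => //; exact: at_chart_at.
Qed.

Definition tcoord z := chart_map (tchart (chart_at (tbase z))) z.
Definition of_tcoord z := chart_inv (tchart (chart_at (tbase z))).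

Lemma tcoordE z : tcoord z = row_mx (chart_map (chart_at (tbase z)) (tbase z)) (tvect z).
Proof.
rewrite /tcoord /= dchartE; congr row_mx.
by apply: dtransition_id; exact: at_chart_at.
Qed.

(** Curves in the bundle are exchanged for curves W of coordinates, for which smoothness already
    contains the continuity required by [tangent_at]. *)
Lemma tangent_atP (E : set (tangent_bundle M)) z A : tangent_at E z A <->
  exists W : R -> 'rV[R]_(n + n), [/\ Coo_at W 0, W 0 = tcoord z, 'd W 0 1 = A &
    \forall t \near (0 : R), E (of_tcoord z (W t))].
Proof.
have c1 := at_chart_at (tbase z).
split=> [[c [c0 [cc cC] cE cA]]|[W [WC W0 WA WE]]].
  exists (fun t => chart_map (tchart (chart_at (tbase z))) (c t)); split=> //.
  - by rewrite c0.
  - by rewrite -cA; apply: esym; exact: derive1_diff (Coo_at_differentiable cC).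
  - have H : \forall t \near (0 : R), at_chart (chart_at (tbase z)) (tbase (c t)).
      apply: (cc (fun z' => at_chart (chart_at (tbase z)) (tbase z'))).
      by rewrite c0; exact: near_tbase_chart.
    by apply: filterS2 H cE => t h; rewrite /of_tcoord tchart_mapK.
have Wc := Coo_at_continuous WC.
have H : \forall t \near (0 : R), at_chart (chart_at (tbase z)) (tbase (of_tcoord z (W t))) /\
    chart_map (tchart (chart_at (tbase z))) (of_tcoord z (W t)) = W t.
  apply: (Wc (fun w => at_chart (chart_at (tbase z)) (tbase (of_tcoord z w)) /\
    chart_map (tchart (chart_at (tbase z))) (of_tcoord z w) = w)).
  by rewrite W0; exact: near_tchart_invK.
have E0 : of_tcoord z (W 0) = z by rewrite W0 /of_tcoord tchart_mapK.
have EW : \forall t \near (0 : R), W t = chart_map (tchart (chart_at (tbase z))) (of_tcoord z (W t)).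
  by apply: filterS H => t [_ ->].
have fC : Coo_at (fun t => chart_map (tchart (chart_at (tbase z))) (of_tcoord z (W t))) 0.
  exact: Coo_at_ext EW WC.
exists (fun t => of_tcoord z (W t)); split=> //.
  split; last exact: fC.
  apply: (@tangent_bundle_continuous _ _ M _ (fun t => of_tcoord z (W t)) 0 (chart_at (tbase z))).
  - by rewrite E0.
  - by apply: filterS H => t [[_ h] _].
  - exact: Coo_at_continuous fC.
have E1 : 'd W 0 1 = 'd (fun t => chart_map (tchart (chart_at (tbase z))) (of_tcoord z (W t))) 0 1.
  exact: near_diffE EW.
apply: eq_trans (derive1_diff (Coo_at_differentiable fC)) _.
exact: eq_trans (esym E1) WA.
Qed.

End tangent_curves.

(** * Connection maps on a subbundle spanned by a moving frame *)

Section frame.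
Variables (R : realType) (n m : nat) (M : manifold R n).
Variables (E : subbundle M) (z : tangent_bundle M).
Local Notation x := (tbase z).
Local Notation phi := (chart_at (tbase z)).
Local Notation u0 := (chart_map (chart_at (tbase z)) (tbase z)).
Variables (L : 'rV[R]_n -> 'M[R]_(m, n)) (s : 'rV[R]_m).
Hypothesis LC : Coo_at L u0.
Hypothesis zE : tvect z = s *m L u0.
Hypothesis EL : \forall u \near u0, forall c : 'rV[R]_m,
  E (@TVec R n M (chart_inv phi u) (dchart_inv phi u (c *m L u))).

(* The velocity of t |-> (a_t, b_t L(a_t)) when a_0 = u0, b_0 = s, and a, b are the
   velocities of a_t, b_t. *)
Definition frame_vect a (b : 'rV[R]_m) := row_mx a (s *m 'd L u0 a + b *m L u0).

Lemma frame_vect_linear k a b a' b' :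
  frame_vect (k *: a + a') (k *: b + b') = k *: frame_vect a b + frame_vect a' b'.
Proof.
rewrite /frame_vect scale_row_mx add_row_mx; congr row_mx.
rewrite linearP mulmxDr !mulmxDl -scalemxAr -scalemxAl scalerDr.
by rewrite addrACA.
Qed.

Lemma frame_curve (a : R -> 'rV[R]_n) (b : R -> 'rV[R]_m) : Coo_at a 0 -> Coo_at b 0 ->
  a 0 = u0 -> b 0 = s ->
  let W t := row_mx (a t) (b t *m L (a t)) in
  [/\ Coo_at W 0, W 0 = tcoord z, 'd W 0 1 = frame_vect ('d a 0 1) ('d b 0 1) &
    \forall t \near (0 : R), E (of_tcoord z (W t))].
Proof.
move=> aC bC a0 b0 W.
have La : Coo_at L (a 0) by rewrite a0.
have LaC : Coo_at (fun t => L (a t)) 0 by exact: Coo_at_comp.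
have WC : Coo_at W 0 by apply: Coo_at_row_mx => //; exact: Coo_at_mulmx.
split=> //.
- by rewrite /W a0 b0 tcoordE zE.
- have E1 := diff_mulmx_row (1 : R) bC aC La.
  have E2 : 'd L (a 0) ('d a 0 1) = 'd L u0 ('d a 0 1) by exact: diff_congr.
  rewrite E2 b0 a0 addrC in E1.
  apply: eq_trans (diff_row_mx (1 : R) aC (Coo_at_mulmx bC LaC)) _.
  exact: (congr1 (row_mx _) E1).
- have : \forall t \near (0 : R), forall c : 'rV[R]_m,
      E (@TVec R n M (chart_inv phi (a t)) (dchart_inv phi (a t) (c *m L (a t)))).
    apply: (near_comp (P := fun u => forall c : 'rV[R]_m,
      E (@TVec R n M (chart_inv phi u) (dchart_inv phi u (c *m L u))))
      (Coo_at_continuous aC)).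
    by rewrite a0.
  by apply: filterS => t h; rewrite /of_tcoord /= row_mxKl row_mxKr; exact: h.
Qed.

Lemma tangent_frame_vect a b : tangent_at E z (frame_vect a b).
Proof.
apply/tangent_atP.
have [W1 W2 W3 W4] := frame_curve (Coo_at_affine u0 a 0) (Coo_at_affine s b 0)
  ltac:(by rewrite /= scale0r addr0) ltac:(by rewrite /= scale0r addr0).
exists (fun t => row_mx (u0 + t *: a) ((s + t *: b) *m L (u0 + t *: a))); split=> //.
by apply: eq_trans W3 _; congr frame_vect; exact: diff_affine.
Qed.

Variables (D : covariant M) (K : tangent_bundle M -> 'rV[R]_(n + n) -> 'rV[R]_n).
Variables (H : 'rV[R]_n -> 'rV[R]_n) (G : 'rV[R]_n -> 'M[R]_n).
Hypothesis KP : connection_map E D K.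
Hypothesis Hlin : linear H.
Hypothesis Glin : linear G.
Hypothesis zn0 : tvect z != 0.
Hypothesis DH : forall f a, Coo_at f u0 ->
  D (chart_field phi f) x a = H ('d f u0 a + f u0 *m G a).

(** The affine coefficients b(u) = s + (u - u0) N have value s and derivative a N along a, so the
    section b L passes through z with exactly this frame vector as its velocity along a, and
    [cm_section] applies. *)
Lemma connection_map_section a (N : 'M[R]_(n, m)) :
  K z (frame_vect a (a *m N)) =
  H (s *m 'd L u0 a + (a *m N) *m L u0 + tvect z *m G a).
Proof.
have c0 := at_chart_at x.
pose b u := s - u0 *m N + u *m N.
have bC : Coo_at b u0 by exact: Coo_at_translate_mx.
have b0 : b u0 = s by rewrite /b subrK.
have db : 'd b u0 a = a *m N by exact: diff_translate_mx.
pose f u := b u *m L u.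
have fC : Coo_at f u0 by exact: Coo_at_mulmx.
have f0 : f u0 = tvect z by rewrite /f b0 zE.
have df : 'd f u0 a = s *m 'd L u0 a + (a *m N) *m L u0.
  have E1 := diff_mulmx a bC LC; rewrite b0 addrC in E1; apply: eq_trans E1 _.
  exact: (congr1 (fun t => s *m 'd L u0 a + t *m L u0) db).
have [U [oU Ux UP]] := near_open (filterI (near_at_chart c0) (filterI
   (near_chart_field_smooth c0 fC) (near_chart_map c0 EL))).
have Xs : smooth_vfield_on U (chart_field phi f) by move=> y /UP[_ []].
have XE y : U y -> E (as_section (chart_field phi f) y).
  move=> /UP[cy [_ h]]; have := h (b (chart_map phi y)); rewrite chart_mapK //.
have zX : as_section (chart_field phi f) x = z.
  by rewrite /as_section chart_field_at f0; case: (z).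
have := cm_section KP a oU Ux Xs XE.
rewrite zX (DH a fC) f0.
suff -> : dmap (as_section (chart_field phi f)) x a = frame_vect a (a *m N).
  by move=> ->; congr (H (_ + _)).
apply: eq_trans (dmap_section _ (Xs x Ux)) _; congr row_mx.
apply: eq_trans (near_diffE a (vfield_rep_chart_field f c0)) _.
exact: df.
Qed.

(* cm_section only gives K on velocities of sections: if a != 0, every b is the derivative
   along a of some function of u; a = 0 is a difference of two such vectors. *)
Lemma connection_map_frame a b :
  K z (frame_vect a b) = H (s *m 'd L u0 a + b *m L u0 + tvect z *m G a).
Proof.
have pinv (c : 'rV[R]_n) : c != 0 -> c *m (pinvmx c *m b) = b.
  move=> c0; rewrite mulmxA; suff -> : c *m pinvmx c = 1%:M by rewrite mul1mx.
  apply: mulmxVp; rewrite /row_free eqn_leq rank_leq_row /= lt0n mxrank_eq0 //.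
have [a0|a0] := eqVneq a 0; last first.
  by rewrite -[in LHS](pinv a a0) connection_map_section pinv.
have Ez : E z.
  have := nbhs_singleton EL s; rewrite -zE chart_mapK ?dchart_invE; try exact: at_chart_at.
  by rewrite dtransition_id; [case: (z)|exact: at_chart_at].
(* [tvect z] serves as a base velocity known to be nonzero. *)
have -> : frame_vect a b = (-1) *: frame_vect (tvect z) 0 + frame_vect (tvect z) b.
  by rewrite -frame_vect_linear scaleN1r addNr scaler0 add0r a0.
rewrite (cm_linear KP _ Ez (tangent_frame_vect _ _) (tangent_frame_vect _ _)).
have E1 := connection_map_section (tvect z) 0; rewrite mulmx0 mul0mx addr0 in E1.
have E2 := connection_map_section (tvect z) (pinvmx (tvect z) *m b); rewrite pinv // in E2.
rewrite {}E1 {}E2 -Hlin; congr H.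
have G0 : G 0 = 0 by have := Glin (-1) 0 0; rewrite scaler0 addr0 scaleN1r addNr.
have L0 : 'd L u0 0 = 0 by exact: linear0.
rewrite a0 G0 L0 !mulmx0 addr0 add0r scaleN1r.
by apply/rowP => i; rewrite !mxE; ring.
Qed.

End frame.

(** * Algebra of O'Neill's tensor *)

Section integrability_tensor.
Variables (R : realType) (n m : nat).
Variables (J : 'M[R]_(n, m)) (L : 'M[R]_(m, n)) (A : 'M[R]_n) (G : 'M[R]_m).
Variables (DJ : 'rV[R]_n -> 'M[R]_(n, m)) (DL : 'rV[R]_n -> 'M[R]_(m, n)).
Variables (CA : 'rV[R]_n -> 'M[R]_n) (CG : 'rV[R]_m -> 'M[R]_m).
Hypotheses (Ap : posdef A) (Gp : posdef G).
Hypothesis LJ : L *m J = 1%:M.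
Hypothesis LA : L *m A = G *m J^T.
Hypothesis dLJ : forall v, DL v *m J + L *m DJ v = 0.
Hypothesis dLA : forall v, DL v *m A + L *m (CA v *m A + A *m (CA v)^T) =
  (CG (v *m J) *m G + G *m (CG (v *m J))^T) *m J^T + G *m (DJ v)^T.
Hypothesis CAS : forall a b, b *m CA a = a *m CA b.
Hypothesis CGS : forall a b, b *m CG a = a *m CG b.
Hypothesis DJS : forall a b, b *m DJ a = a *m DJ b.
Hypotheses (CAlin : linear CA) (CGlin : linear CG) (DJlin : linear DJ).

(* J and L stand for the differential of P and the horizontal lift, DJ and DL for their
   derivatives, CA and CG for the Christoffel matrices.  For a section s L of the horizontal
   bundle, s (oneill v) is the difference between P_* (nablat_v (s L)) and the derivative of s
   along P in the direction v; for v vertical it is dual to half the curvature of the distribution. *)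
Definition oneill (v : 'rV[R]_n) : 'M[R]_m := L *m CA v *m J - L *m DJ v - CG (v *m J).

Lemma oneill_linear : linear oneill.
Proof.
move=> k u v; rewrite /oneill CAlin DJlin mulmxDl -scalemxAl CGlin.
rewrite !mulmxDr !mulmxDl -!scalemxAr -!scalemxAl !scalerBr.
by apply/matrixP => i j; rewrite !mxE; ring.
Qed.

Lemma gram_mul_lift_tr : A *m L^T = J *m G.
Proof.
have [As _] := Ap; have [Gs _] := Gp.
by rewrite -[A]As -[G]Gs -trmx_mul LA trmx_mul trmxK.
Qed.

Lemma jac_tr_mul_lift_tr : J^T *m L^T = 1%:M.
Proof. by rewrite -trmx_mul LJ trmx1. Qed.

(** Multiplying the derivative of L A = G J^T on the right by L^T, and using DL J = - L DJ, leaves X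
    + X^T = c + c^T + e + e^T; and D(v) G is X - c - e. *)
Lemma oneill_skew v : oneill v *m G + G *m (oneill v)^T = 0.
Proof.
have [As _] := Ap; have [Gs _] := Gp.
set c := L *m DJ v *m G; set X := L *m CA v *m J *m G; set e := CG (v *m J) *m G.
have XT : L *m (A *m (CA v)^T) *m L^T = X^T.
  by rewrite /X !trmx_mul Gs !mulmxA -LA.
have X1 : L *m (CA v *m A) *m L^T = X by rewrite /X -!mulmxA gram_mul_lift_tr.
have cT : G *m (DJ v)^T *m L^T = c^T by rewrite /c !trmx_mul Gs !mulmxA.
have eT : G *m (CG (v *m J))^T = e^T by rewrite /e trmx_mul Gs.
have c1 : DL v *m A *m L^T = - c.
  rewrite -mulmxA gram_mul_lift_tr mulmxA /c -mulNmx; congr (_ *m _).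
  by apply/eqP; rewrite -addr_eq0 dLJ.
have := congr1 (fun Y : 'M[R]_(m, n) => Y *m L^T) (dLA v) => /=.
rewrite 2!mulmxDl c1 mulmxDr mulmxDl X1 XT -mulmxA jac_tr_mul_lift_tr mulmx1 eT cT -/e => E.
have -> : oneill v *m G = X - c - e by rewrite /oneill !mulmxBl.
have -> : G *m (oneill v)^T = (X - c - e)^T.
  by rewrite -[G in LHS]Gs -trmx_mul /oneill !mulmxBl.
apply/matrixP => i j; have := congr1 (fun Y : 'M[R]_m => Y i j) E => /=.
by rewrite !mxE; lra.
Qed.

Lemma form_oneill_skew v (s c : 'rV[R]_m) : form G s (c *m oneill v) = - form G c (s *m oneill v).
Proof.
have [Gs _] := Gp.
rewrite (form_sym c _ Gs) /form trmx_mul !mulmxA.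
have -> : s *m G *m (oneill v)^T *m c^T = s *m (G *m (oneill v)^T) *m c^T by rewrite !mulmxA.
have /eqP := oneill_skew v; rewrite addrC addr_eq0 => /eqP ->.
by rewrite mulmxN mulNmx mxE !mulmxA.
Qed.

(** The trilinear form <b D(c L), d> is symmetric in b, c (no torsion, symmetric second derivatives
    of P) and antisymmetric in b, d. Alternating the two symmetries shows that it equals its own
    opposite, as in the uniqueness of the Levi-Civita connection. *)
Lemma oneill_lift (a s : 'rV[R]_m) : s *m oneill (a *m L) = 0.
Proof.
have sym (b c : 'rV[R]_m) : b *m oneill (c *m L) = c *m oneill (b *m L).
  rewrite /oneill !mulmxBr -!(mulmxA _ L J) LJ !mulmx1 (CGS c b).
  rewrite !mulmxA (CAS (c *m L) (b *m L)) (DJS (c *m L) (b *m L)).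
  by [].
apply: form_eq0 Gp _.
pose p (b c d : 'rV[R]_m) := form G (b *m oneill (c *m L)) d.
have [Gs _] := Gp.
have p1 b c d : p b c d = p c b d by rewrite /p sym.
have p2 b c d : p b c d = - p d c b.
  by rewrite /p (form_sym _ _ Gs) form_oneill_skew (form_sym _ _ Gs).
suff z b c d : p b c d = 0 by exact: z.
have E : p b c d = - p b c d.
  by rewrite {1}p1 p2 p1 p2 opprK p1 p2.
by lra.
Qed.

(** The derivative of L A = G J^T along d L, paired with b and U, expresses <b, d D(U)>, because U J
    = 0 removes all terms ending in J^T. Subtracting the same identity with b and d exchanged
    cancels the symmetric Christoffel terms, and skewness doubles the left side. On the right stands
    the bracket of the lifts of the constant fields c and s. *)
Lemma oneill_vertical U (s c : 'rV[R]_m) : U *m J = 0 ->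
  2 * form G s (c *m oneill U) = - form A (s *m DL (c *m L) - c *m DL (s *m L)) U.
Proof.
move=> UJ; have [As _] := Ap; have [Gs _] := Gp.
have CG0 : CG 0 = 0 by have := CGlin (-1) 0 0; rewrite scaler0 addr0 scaleN1r addNr.
have half (b d : 'rV[R]_m) : form G b (d *m oneill U) =
    - form A (b *m DL (d *m L)) U - form A (b *m L *m CA (d *m L)) U.
  have -> : d *m oneill U = U *m CA (d *m L) *m J - U *m DJ (d *m L).
    rewrite /oneill UJ CG0 subr0 mulmxBr !mulmxA.
    by rewrite (CAS U (d *m L)) (DJS U (d *m L)).
  have := congr1 (fun X : 'M[R]_(m, n) => (b *m X *m U^T) 0 0) (dLA (d *m L)) => /=.
  have Z (X : 'M[R]_m) : b *m (X *m J^T) *m U^T = 0.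
    by rewrite -!mulmxA -trmx_mul UJ trmx0 !mulmx0.
  rewrite [in X in _ = X]mulmxDr [in X in _ = X]mulmxDl Z add0r.
  rewrite !mulmxDr !mulmxDl [LHS]mxE [X in _ + X = _]mxE.
  have -> : (b *m (DL (d *m L) *m A) *m U^T) 0 0 = form A (b *m DL (d *m L)) U.
    by rewrite /form !mulmxA.
  have -> : (b *m (L *m (CA (d *m L) *m A)) *m U^T) 0 0 = form A (b *m L *m CA (d *m L)) U.
    by rewrite /form !mulmxA.
  have -> : (b *m (L *m (A *m (CA (d *m L))^T)) *m U^T) 0 0 = form G b (U *m CA (d *m L) *m J).
    by rewrite /form !trmx_mul !mulmxA -(mulmxA b L A) LA !mulmxA.
  have -> : (b *m (G *m (DJ (d *m L))^T) *m U^T) 0 0 = form G b (U *m DJ (d *m L)).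
    by rewrite /form !trmx_mul !mulmxA.
  by rewrite formBr; lra.
have h1 := half s c; have h2 := half c s.
have sk := form_oneill_skew U s c.
have sy : form A (s *m L *m CA (c *m L)) U = form A (c *m L *m CA (s *m L)) U.
  by rewrite (CAS (c *m L) (s *m L)).
by rewrite formBl; lra.
Qed.

(** If D = 0, the bracket B of two lifts is vertical because DJ is symmetric, and [oneill_vertical]
    with U = B gives <B, B> = 0. Conversely [oneill_vertical] kills D on vertical vectors and
    [oneill_lift] on lifts, and these span. *)
Lemma oneill0P : (forall v, oneill v = 0) <->
  (forall s c : 'rV[R]_m, s *m DL (c *m L) = c *m DL (s *m L)).
Proof.
split=> [H s c|H v].
  apply/eqP; rewrite -subr_eq0; apply/eqP; apply: form_eq0 Ap _.
  set B := _ - _; have BJ : B *m J = 0.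
    have E (a : 'rV[R]_n) : DL a *m J = - (L *m DJ a) by apply/eqP; rewrite -addr_eq0 dLJ.
    rewrite /B mulmxBl -!mulmxA !E !mulmxN !mulmxA (DJS (c *m L) (s *m L)).
    by rewrite subrr.
  have := oneill_vertical s c BJ; rewrite -/B H mulmx0 form0r mulr0.
  by move/eqP; rewrite eq_sym oppr_eq0 => /eqP.
have V (U : 'rV[R]_n) : U *m J = 0 -> oneill U = 0.
  move=> UJ; apply/row_matrixP => i; rewrite row0 rowE; apply: form_eq0 Gp _.
  have := oneill_vertical (delta_mx 0 i *m oneill U) (delta_mx 0 i) UJ.
  by rewrite H subrr form0l oppr0; lra.
have vE : v = 1 *: (v - v *m J *m L) + (v *m J) *m L by rewrite scale1r subrK.
rewrite vE oneill_linear scale1r V ?add0r.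
  by apply/row_matrixP => i; rewrite row0 rowE oneill_lift.
by rewrite mulmxBl -(mulmxA _ L) LJ mulmx1 subrr.
Qed.

Variables (s : 'rV[R]_m) (k : R).
Hypothesis k0 : 0 < k.

(** The premise is norm preservation on those horizontal vectors (W, b) of the tangent map whose
    base velocity W is vertical: the image is (0, b), and the inner condition on U is
    horizontality. *)
Lemma oneill_isometry :
  (forall W b, W *m J = 0 -> form G s b = 0 ->
    (forall U, U *m J = 0 ->
      form A W U + k * form G (b + s *m oneill W) (s *m oneill U) = 0) ->
    k * form G b b = form A W W + k * form G (b + s *m oneill W) (b + s *m oneill W)) ->
  forall v, s *m oneill v = 0.
Proof.
move=> iso; have [As _] := Ap; have [Gs _] := Gp.
have ss v : form G s (s *m oneill v) = 0.
  by have := form_oneill_skew v s s; lra.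
have lT : linear (fun v => s *m oneill v).
  by move=> a u v; rewrite oneill_linear mulmxDr scalemxAr.
pose tM := GRing.isLinear.Build _ _ _ _ _ lT.
pose tL : {linear 'rV[R]_n -> 'rV[R]_m} := HB.pack (fun v => s *m oneill v) tM.
(* As a matrix, v |-> s D(v) can be transposed, so that functionals of U built from it are
   represented by vectors through A^-1. *)
pose T := lin1_mx tL.
have TE v : v *m T = s *m oneill v by rewrite mul_rV_lin1.
have V0 (U0 : 'rV[R]_n) : U0 *m J = 0 -> s *m oneill U0 = 0.
  move=> U0J; set eta := s *m oneill U0.
  (* W is the vertical vector with <W, U> = - k <eta, s (oneill U)> for U vertical; the
     horizontality of (W, b) is then automatic, and b is chosen so that its K-part is eta. *)
  pose W' := - (k *: (eta *m G *m T^T *m invmx A)).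
  pose W := W' - W' *m J *m L.
  have WJ : W *m J = 0 by rewrite /W mulmxBl -(mulmxA _ L) LJ mulmx1 subrr.
  have WU (U : 'rV[R]_n) : U *m J = 0 -> form A W U = - (k * form G eta (s *m oneill U)).
    move=> UJ; rewrite /W formBl.
    have -> : form A (W' *m J *m L) U = 0.
      by rewrite /form -(mulmxA _ L) LA !mulmxA -mulmxA -trmx_mul UJ trmx0 mulmx0 mxE.
    rewrite subr0 /W' formNl formZl; congr (- (_ * _)).
    by rewrite /form mulmxKV ?posdef_unit // -TE trmx_mul !mulmxA.
  pose b := eta - s *m oneill W.
  have be : b + s *m oneill W = eta by rewrite /b subrK.
  have := iso W b WJ; rewrite be formBr !ss subrr => /(_ erefl) H.
  have {}H : k * form G b b = form A W W + k * form G eta eta.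
    by apply: H => U UJ; rewrite WU // addNr.
  have WW := WU W WJ.
  have sym : form G (s *m oneill W) eta = form G eta (s *m oneill W) by exact: form_sym.
  have q1 : 0 <= form G (s *m oneill W) (s *m oneill W) by exact: form_ge0.
  have q2 : 0 <= form A W W by exact: form_ge0.
  have q3 : 0 <= k * form G (s *m oneill W) (s *m oneill W) by rewrite mulr_ge0 // ltW.
  rewrite /b (formBl G) !(formBr G) sym !mulrBr in H.
  (* Since <W, W> = - k <eta, s D(W)> by [WW], the identity [H] reduces to <W, W> + k |s D(W)|^2 =
     0. *)
  have W0 : W = 0 by apply: form_eq0 Ap _; lra.
  have := WU U0 U0J; rewrite W0 form0l => /eqP.
  rewrite eq_sym oppr_eq0 mulf_eq0 (gt_eqF k0) /= => /eqP.
  exact: form_eq0.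
move=> v; have -> : v = (v - v *m J *m L) + (v *m J) *m L by rewrite subrK.
have := oneill_linear 1 (v - v *m J *m L) ((v *m J) *m L); rewrite !scale1r => ->.
rewrite mulmxDr oneill_lift addr0 V0 //.
by rewrite mulmxBl -(mulmxA _ L) LJ mulmx1 subrr.
Qed.

End integrability_tensor.

Lemma mulmx_sum_solve (R : realType) n m (c : 'rV[R]_m) (A S : 'M[R]_m)
    (L' B D L : 'M[R]_(m, n)) (T U : 'M[R]_n) :
  A *m L' + S *m B = D *m T + L *m U ->
  c *m S *m B = c *m D *m T + c *m L *m U - c *m A *m L'.
Proof. by move=> E; rewrite -!mulmxA -mulmxDr -E mulmxDr addrC addKr. Qed.

(** * Jacobian and horizontal lift of a Riemannian submersion *)

Section submersion.
Variables (R : realType) (n m : nat) (Mt : manifold R n) (M : manifold R m).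
Variables (gt : riem_metric Mt) (g : riem_metric M) (P : Mt -> M).
Hypothesis hP : riemannian_submersion setT setT gt g P.
Implicit Types (phi : chart R Mt n) (psi : chart R M m) (x : Mt).

Lemma submersion_smooth x : smooth_at P x.
Proof. by have [H _ _ _] := hP; exact: H. Qed.

Definition jac_rep phi psi := Jac (local_rep P phi psi).
Definition lift_rep phi psi u := lift_matrix (jac_rep phi psi u) (gram gt phi u).

Definition chart_pair phi psi x := at_chart phi x /\ at_chart psi (P x).

Lemma chart_pair_at x : chart_pair (chart_at x) (chart_at (P x)) x.
Proof. by split; exact: at_chart_at. Qed.

Lemma jac_repE phi psi x (v : 'rV[R]_n) : chart_pair phi psi x ->
  v *m jac_rep phi psi (chart_map phi x) =
  dtransition (chart_at (P x)) psi (P x) (dmap P x (dtransition phi (chart_at x) x v)).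
Proof.
by move=> [c1 c2]; rewrite -JacE; exact: diff_local_rep_dmap (submersion_smooth x) c1 c2.
Qed.

Lemma dtransition_eq0 k (N : manifold R k) (phi psi : chart R N k) (y : N) v :
  at_chart phi y -> at_chart psi y -> dtransition phi psi y v = 0 -> v = 0.
Proof.
move=> c1 c2 E; rewrite -[v](dtransitionK v c1 c2) E.
exact: linear0.
Qed.

Lemma gram_posdef k (N : manifold R k) (h : riem_metric N) (phi : chart R N k) (y : N) :
  at_chart phi y -> posdef (gram h phi (chart_map phi y)).
Proof.
move=> c1; split=> [|a a0]; first exact: gram_sym.
rewrite -gram_form //; apply: metric_pos; apply: contra a0 => /eqP E.
by apply/eqP; exact: dtransition_eq0 c1 (at_chart_at y) E.
Qed.

Lemma jac_rep_surj phi psi x : chart_pair phi psi x ->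
  forall b : 'rV[R]_m, exists a : 'rV[R]_n, a *m jac_rep phi psi (chart_map phi x) = b.
Proof.
move=> cp b; have [c1 c2] := cp; have [_ _ H _] := hP.
have := H x I; move=> /seteqP[_ /(_ (dtransition psi (chart_at (P x)) (P x) b))].
case; first exact: tangent_at_setT.
move=> v _ E; exists (dtransition (chart_at x) phi x v).
rewrite jac_repE //.
have -> : dtransition phi (chart_at x) x (dtransition (chart_at x) phi x v) = v.
  exact: dtransitionK (at_chart_at x) c1.
by rewrite E; exact: dtransitionK c2 (at_chart_at (P x)).
Qed.

Lemma horizontalP phi psi x (v : 'rV[R]_n) : chart_pair phi psi x ->
  horizontal setT gt P x (dtransition phi (chart_at x) x v) <->
  forall U : 'rV[R]_n, U *m jac_rep phi psi (chart_map phi x) = 0 ->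
    form (gram gt phi (chart_map phi x)) v U = 0.
Proof.
move=> cp; have [c1 c2] := cp; have c0 := at_chart_at x.
split=> [[_ H] U UJ|H].
  rewrite -gram_form //; apply: H; split; first exact: tangent_at_setT.
  rewrite jac_repE // in UJ.
  exact: dtransition_eq0 (at_chart_at (P x)) c2 UJ.
split=> [|w [_ wV]]; first exact: tangent_at_setT.
rewrite -[w](dtransitionK w c0 c1) gram_form //; apply: H.
rewrite jac_repE //.
have -> : dtransition phi (chart_at x) x (dtransition (chart_at x) phi x w) = w.
  exact: dtransitionK c0 c1.
by rewrite wV; exact: linear0.
Qed.

Lemma lift_repK phi psi x : chart_pair phi psi x ->
  lift_rep phi psi (chart_map phi x) *m jac_rep phi psi (chart_map phi x) = 1%:M.
Proof.
move=> cp; apply: lift_matrixK; last exact: jac_rep_surj.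
by have [c1 _] := cp; exact: gram_posdef.
Qed.

Lemma horizontal_lift phi psi x (a : 'rV[R]_m) : chart_pair phi psi x ->
  horizontal setT gt P x
    (dtransition phi (chart_at x) x (a *m lift_rep phi psi (chart_map phi x))).
Proof.
move=> cp; apply/(horizontalP _ cp) => U UJ; apply: lift_matrix_horizontal => //.
by have [c1 _] := cp; exact: gram_posdef.
Qed.

Lemma horizontal_liftE phi psi x (v : 'rV[R]_n) : chart_pair phi psi x ->
  horizontal setT gt P x (dtransition phi (chart_at x) x v) <->
  v = v *m jac_rep phi psi (chart_map phi x) *m lift_rep phi psi (chart_map phi x).
Proof.
move=> cp; split=> [/(horizontalP _ cp) H|->]; last exact: horizontal_lift.
apply: horizontal_lift_matrix H; last exact: jac_rep_surj.
by have [c1 _] := cp; exact: gram_posdef.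
Qed.

Lemma lift_rep_isometry phi psi x : chart_pair phi psi x ->
  lift_rep phi psi (chart_map phi x) *m gram gt phi (chart_map phi x) =
  gram g psi (chart_map psi (P x)) *m (jac_rep phi psi (chart_map phi x))^T.
Proof.
move=> cp; have [c1 c2] := cp; apply: lift_matrix_isometry.
- exact: gram_posdef.
- exact: jac_rep_surj.
- exact: gram_sym.
move=> a b; rewrite -/(lift_rep phi psi (chart_map phi x)) -!gram_form //.
have [_ _ _ iso] := hP.
rewrite -(iso x _ _ I (horizontal_lift a cp) (horizontal_lift b cp)).
have E (c : 'rV[R]_m) : dmap P x (dtransition phi (chart_at x) x (c *m lift_rep phi psi (chart_map phi x))) =
    dtransition psi (chart_at (P x)) (P x) c.
  rewrite -[LHS](dtransitionK _ (at_chart_at (P x)) c2) -jac_repE // -mulmxA lift_repK //.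
  by rewrite mulmx1.
by rewrite !E.
Qed.

(** The lift is intrinsic: the vector on the right is horizontal and projects to the transformed a,
    which determines it. *)
Lemma lift_rep_change phi phi' psi psi' x (a : 'rV[R]_m) : chart_pair phi psi x -> chart_pair phi' psi' x ->
  dtransition psi psi' (P x) a *m lift_rep phi' psi' (chart_map phi' x) =
  dtransition phi phi' x (a *m lift_rep phi psi (chart_map phi x)).
Proof.
move=> cp cp'; have [c1 c2] := cp; have [c1' c2'] := cp'.
set v := a *m _; set w := dtransition phi phi' x v.
have wv : dtransition phi' (chart_at x) x w = dtransition phi (chart_at x) x v.
  exact: dtransition_comp c1 c1' (at_chart_at x).
have hw : horizontal setT gt P x (dtransition phi' (chart_at x) x w).
  by rewrite wv; exact: horizontal_lift.
have -> : dtransition psi psi' (P x) a = w *m jac_rep phi' psi' (chart_map phi' x).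
  rewrite jac_repE // wv.
  have E : a = v *m jac_rep phi psi (chart_map phi x) by rewrite /v -mulmxA lift_repK // mulmx1.
  rewrite {1}E jac_repE //.
  exact: dtransition_comp (at_chart_at (P x)) c2 c2'.
by apply: esym; apply/(horizontal_liftE _ cp').
Qed.

Lemma near_chart_pair phi psi x : chart_pair phi psi x ->
  \forall u \near chart_map phi x, [/\ chart_pair phi psi (chart_inv phi u),
    chart_map phi (chart_inv phi u) = u &
    chart_map psi (P (chart_inv phi u)) = local_rep P phi psi u].
Proof.
move=> [c1 c2]; have [Pc _] := submersion_smooth x.
by apply: filterS2 (near_chart_invK c1) (near_chart_image Pc c1 c2) => u [h1 E] h2.
Qed.

Lemma local_rep_at phi psi x : at_chart phi x ->
  local_rep P phi psi (chart_map phi x) = chart_map psi (P x).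
Proof. by move=> c1; rewrite /local_rep /= chart_mapK. Qed.

Lemma local_rep_Coo phi psi x : chart_pair phi psi x ->
  Coo_at (local_rep P phi psi) (chart_map phi x).
Proof. by move=> [c1 c2]; exact: smooth_at_local_rep (submersion_smooth x) c1 c2. Qed.

Lemma jac_rep_Coo phi psi x : chart_pair phi psi x ->
  Coo_at (jac_rep phi psi) (chart_map phi x).
Proof. by move=> /local_rep_Coo; exact: Jac_smooth. Qed.

Lemma lift_rep_Coo phi psi x : chart_pair phi psi x ->
  Coo_at (gram gt phi) (chart_map phi x) -> Coo_at (lift_rep phi psi) (chart_map phi x).
Proof.
move=> cp AC; have JC := jac_rep_Coo cp.
have nA : \forall u \near chart_map phi x, posdef (gram gt phi u) /\
    (forall b : 'rV[R]_m, exists a : 'rV[R]_n, a *m jac_rep phi psi u = b).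
  apply: filterS (near_chart_pair cp) => u [h E _]; rewrite -E.
  by split; [exact: gram_posdef (proj1 h)|exact: jac_rep_surj h].
have iA : Coo_at (fun u => invmx (gram gt phi u)) (chart_map phi x).
  apply: Coo_at_invmx => //; apply: filterS nA => u [h _]; exact: posdef_unit h.
have JT := Coo_at_trmx JC.
apply: (Coo_at_mulmx (Coo_at_mulmx _ JT) iA).
apply: (Coo_at_invmx (f := fun u => (jac_rep phi psi u)^T *m invmx (gram gt phi u) *m jac_rep phi psi u)).
  by apply: filterS nA => u [h1 h2]; apply: posdef_unit; exact: posdef_pushforward.
exact: Coo_at_mulmx (Coo_at_mulmx JT iA) JC.
Qed.

(* The horizontal lifts of the coordinate fields commute. *)
Definition lift_flat phi psi u := forall a b : 'rV[R]_m,
  b *m 'd (lift_rep phi psi) u (a *m lift_rep phi psi u) =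
  a *m 'd (lift_rep phi psi) u (b *m lift_rep phi psi u).

(** Differentiating (Jac sig)(f) L'(tau) = L (Jac tau) along lifts produces the two flatness
    expressions together with second derivatives of tau and sig. The latter are symmetric in the two
    directions and cancel when these are exchanged. *)
Lemma lift_flat_change phi phi' psi psi' x : chart_pair phi psi x -> chart_pair phi' psi' x ->
  Coo_at (lift_rep phi psi) (chart_map phi x) ->
  Coo_at (lift_rep phi' psi') (chart_map phi' x) ->
  lift_flat phi psi (chart_map phi x) -> lift_flat phi' psi' (chart_map phi' x).
Proof.
move=> cp cp' LC LC' flat; have [c1 c2] := cp; have [c1' c2'] := cp'.
set u0 := chart_map phi x in LC flat *; set u0' := chart_map phi' x in LC' *.
pose f := local_rep P phi psi; pose tau := transition phi phi'; pose sig := transition psi psi'.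
pose L := lift_rep phi psi; pose L' := lift_rep phi' psi'.
have f0 : f u0 = chart_map psi (P x) by exact: local_rep_at.
have t0 : tau u0 = u0' by rewrite /tau /transition /= chart_mapK.
have tauC : Coo_at tau u0 by exact: transition_smooth.
have sigC : Coo_at sig (f u0) by rewrite f0; exact: transition_smooth.
have fC : Coo_at f u0 by exact: local_rep_Coo.
have TC := Jac_smooth tauC; have SC := Jac_smooth sigC.
have SfC : Coo_at (fun u => Jac sig (f u)) u0 by exact: Coo_at_comp.
have LtC : Coo_at L' (tau u0) by rewrite t0.
have LtC' : Coo_at (fun u => L' (tau u)) u0 by exact: Coo_at_comp.
have E : \forall u \near u0, Jac sig (f u) *m L' (tau u) = L u *m Jac tau u.
  have [Pc _] := submersion_smooth x.
  apply: filterS3 (near_chart_pair cp) (near_chart_inv c1 (near_at_chart c1'))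
    (near_chart_image Pc c1 c2') => u [h Eu Efu] h1 h2.
  set z := chart_inv phi u in h Eu Efu h1 h2.
  have tz : tau u = chart_map phi' z by [].
  apply/row_matrixP => i; rewrite !rowE (mulmxA _ (Jac sig (f u))) (mulmxA _ (L u)) tz.
  have e1 : delta_mx 0 i *m Jac sig (f u) = dtransition psi psi' (P z) (delta_mx 0 i).
    by rewrite -JacE; apply: diff_congr => //; rewrite Efu.
  have e2 (v : 'rV[R]_n) : v *m Jac tau u = dtransition phi phi' z v.
    by rewrite -JacE; apply: diff_congr => //; rewrite Eu.
  rewrite e1 e2; have -> : L u = L (chart_map phi z) by rewrite Eu.
  exact: lift_rep_change.
have dE (v : 'rV[R]_n) : 'd (Jac sig) (f u0) (v *m Jac f u0) *m L' (tau u0) +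
     Jac sig (f u0) *m 'd L' (tau u0) (v *m Jac tau u0) =
   'd L u0 v *m Jac tau u0 + L u0 *m 'd (Jac tau) u0 v.
  have h1 := diff_mulmx v SfC LtC'.
  have h2 := diff_mulmx v LC TC.
  have h3 := near_diffE v E.
  have h4 := diff_compE v (Coo_at_differentiable fC) (Coo_at_differentiable SC).
  have h5 := diff_compE v (Coo_at_differentiable tauC) (Coo_at_differentiable LtC).
  have h4' := eq_trans h4 (diff_congr (Jac sig) (erefl (f u0)) (JacE f u0 v)).
  have h5' := eq_trans h5 (diff_congr L' (erefl (tau u0)) (JacE tau u0 v)).
  apply: eq_trans (eq_trans (esym h1) (eq_trans h3 h2)).
  apply: (congr2 (fun (X : 'M[R]_m) (Y : 'M[R]_(m, n)) => X *m L' (tau u0) + Jac sig (f u0) *m Y)).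
    exact: esym h4'.
  exact: esym h5'.
have LJ : L u0 *m Jac f u0 = 1%:M by exact: lift_repK.
have key (a b : 'rV[R]_m) : b *m Jac sig (f u0) *m 'd L' (tau u0) (a *m L u0 *m Jac tau u0) =
    a *m Jac sig (f u0) *m 'd L' (tau u0) (b *m L u0 *m Jac tau u0).
  have half (c d : 'rV[R]_m) : c *m Jac sig (f u0) *m 'd L' (tau u0) (d *m L u0 *m Jac tau u0) =
      c *m 'd L u0 (d *m L u0) *m Jac tau u0 + (c *m L u0) *m 'd (Jac tau) u0 (d *m L u0)
      - c *m 'd (Jac sig) (f u0) d *m L' (tau u0).
    have e : d *m L u0 *m Jac f u0 = d by rewrite -mulmxA LJ mulmx1.
    have := dE (d *m L u0); rewrite e; exact: mulmx_sum_solve.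
  rewrite !half (flat a b) (Jac_schwarz _ _ tauC); congr (_ - _ *m _).
  exact: Jac_schwarz.
have LL (c : 'rV[R]_m) : (c *m Jac sig (f u0)) *m L' (tau u0) = c *m L u0 *m Jac tau u0.
  by have := nbhs_singleton E => E0; rewrite -mulmxA E0 mulmxA.
have sS (c : 'rV[R]_m) : exists d, d *m Jac sig (f u0) = c.
  exists (dtransition psi' psi (P x) c).
  rewrite -JacE; apply: eq_trans (_ : _ = dtransition psi psi' (P x) (dtransition psi' psi (P x) c)) _.
    by apply: diff_congr.
  exact: dtransitionK.
move=> a' b'; have [a <-] := sS a'; have [b <-] := sS b'.
rewrite -t0 -!/(L' _) !LL.
exact: key.
Qed.

Lemma lift_rep_Coo_at x :
  Coo_at (lift_rep (chart_at x) (chart_at (P x))) (chart_map (chart_at x) x).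
Proof. by apply: lift_rep_Coo (chart_pair_at x) _; exact: gram_smooth. Qed.

(** The hypothesis uses at each point the chart of that point; [flat_section] needs the condition on
    a neighbourhood in one chart. *)
Lemma near_lift_flat x :
  (forall z, lift_flat (chart_at z) (chart_at (P z)) (chart_map (chart_at z) z)) ->
  \forall u \near chart_map (chart_at x) x, lift_flat (chart_at x) (chart_at (P x)) u.
Proof.
move=> flat; have LC := lift_rep_Coo_at x.
apply: filterS2 (near_chart_pair (chart_pair_at x)) (Coo_at_near LC) => u [h E _] LCu.
rewrite -E in LCu *.
exact: lift_flat_change (chart_pair_at _) h (lift_rep_Coo_at _) LCu (flat _).
Qed.

End submersion.

(** * Integrability of the horizontal distribution *)

Section second_countable_row.
Variables (R : realType) (n : nat).

Lemma rational_row_approx (x : 'rV[R]_n) (e : R) : 0 < e ->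
  exists q : 'rV[rat]_n, `|x - map_mx ratr q| < e.
Proof.
move=> e0.
have [q qP] : {q : 'I_n -> rat & forall i, `|x 0 i - ratr (q i)| <= e / 2}.
  apply: (choice (P := fun i (q : rat) => `|x 0 i - ratr q| <= e / 2)) => i.
  have [|q] := @rat_in_itvoo R (x 0 i - e / 2) (x 0 i + e / 2); first by lra.
  rewrite in_itv /= => /andP[h1 h2]; exists q.
  by rewrite ler_norml; apply/andP; split; lra.
exists (\row_i q i).
apply: (@le_lt_trans _ _ (e / 2)); last by lra.
apply: mx_norm_le => [|i j]; first by lra.
by rewrite ord1 !mxE.
Qed.

Lemma set_type_second_countable (B : set 'rV[R]_n) : @second_countable (set_type B).
Proof.
pose bl (qk : 'rV[rat]_n * nat) : set (set_type B) :=
  [set z | `|set_val z - map_mx ratr qk.1| < qk.2.+1%:R^-1].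
exists (range bl).
  apply: (card_le_trans (card_image_le _ _)); exact: countableP.
split=> [_ [qk _ <-]|x U].
  have o : open [set y : 'rV[R]_n | `|y - map_mx ratr qk.1| < qk.2.+1%:R^-1].
    have -> : [set y : 'rV[R]_n | `|y - map_mx ratr qk.1| < qk.2.+1%:R^-1] =
        (fun y => `|y - map_mx ratr qk.1|) @^-1` [set t | t < qk.2.+1%:R^-1] by [].
    apply: open_comp; last exact: open_lt.
    move=> y _; apply: continuous_comp; last exact: norm_continuous.
    by apply: continuousB; [exact: cvg_id|exact: cst_continuous].
  exact: (@open_comp _ _ (set_val : set_type B -> 'rV[R]_n) _ (fun y _ => @initial_continuous _ _ _ y) o).
move=> [_ /= [[W oW <- /= Wx sWU]]].
have /nbhs_normP[e /= e0 eW] := open_nbhs_nbhs (conj oW Wx).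
have [k k0 ke] : exists2 k : nat, (0 : R) < k.+1%:R^-1 & k.+1%:R^-1 < e / 2.
  exists (Num.bound (2 / e)); first by rewrite invr_gt0.
  have H : 2 / e < (Num.bound (2 / e)).+1%:R.
    apply: lt_trans (archi_boundP _) _; first by rewrite divr_ge0 // ltW.
    by rewrite ltr_nat.
  have -> : e / 2 = (2 / e)^-1 by rewrite invf_div.
  by rewrite ltf_pV2 // posrE ?divr_gt0.
have [q qx] := rational_row_approx (set_val x) k0.
exists (bl (q, k)); first by split => //; exists (q, k).
move=> z /= qz; apply: sWU; apply: eW => /=.
have -> : set_val x - set_val z = (set_val x - map_mx ratr q) - (set_val z - map_mx ratr q).
  by rewrite opprB addrA subrK.
have {}qz : `|set_val z - map_mx ratr q| < k.+1%:R^-1 := qz.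
apply: le_lt_trans (ler_normB _ _) _; apply: lt_trans (ltrD qx qz) _.
by move: ke; set t := _^-1; lra.
Qed.

Lemma set_type_hausdorff (B : set 'rV[R]_n) : hausdorff_space (set_type B).
Proof.
rewrite open_hausdorff => x y xy.
have xy' : set_val x != set_val y.
  by apply: contra xy => /eqP E; apply/eqP; exact: val_inj.
have := @norm_hausdorff R 'rV[R]_n; rewrite open_hausdorff => /(_ _ _ xy').
move=> [[/= C D]]; rewrite !inE => -[Cx Dy] [oC oD CD].
have vc : continuous (set_val : set_type B -> 'rV[R]_n) by exact: initial_continuous.
exists (set_val @^-1` C, set_val @^-1` D); rewrite /= ?inE //.
split.
- exact: (open_comp (fun y _ => vc y) oC).
- exact: (open_comp (fun y _ => vc y) oD).
- by rewrite -preimage_setI CD preimage_set0.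
Qed.

End second_countable_row.

(** * Open subsets of R^n as manifolds *)

Section open_manifold.
Variables (R : realType) (n : nat) (B : set 'rV[R]_n) (x0 : set_type B).
Hypothesis oB : open B.

(** The inverse is total, with the default value x0 outside B; only its values on the open image B
    matter. *)
Definition open_chart : chart R (set_type B) n :=
  Chart setT set_val (insubd x0).

Definition open_charted : charted R n :=
  @Charted R n (set_type B) [set open_chart] (fun _ => open_chart).

Lemma open_chart_invK u : B u -> set_val (insubd x0 u : set_type B) = u.
Proof. by move=> Bu; apply: insubdK; exact: mem_set. Qed.

Lemma open_chart_image : chart_map open_chart @` setT = B.
Proof.
apply/seteqP; split=> [_ [z _ <-]|u Bu]; first exact: set_valP.
by exists (insubd x0 u) => //; exact: open_chart_invK.
Qed.

Lemma open_chart_is_chart : is_chart open_chart.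
Proof.
split=> [||z _|z _|z _].
- exact: openT.
- by rewrite [X in open X]open_chart_image.
- by apply: val_inj; apply: open_chart_invK; exact: set_valP.
- exact: initial_continuous.
move=> U; rewrite /= valKd => -[_ /= [[W oW <- /= Wx sWU]]].
have BW : open_nbhs (set_val z) (B `&` W) by split; [exact: openI|split => //; exact: set_valP].
apply: filterS (open_nbhs_nbhs BW) => u [Bu Wu]; apply: sWU => /=.
by rewrite open_chart_invK.
Qed.

Definition open_manifold : manifold R n.
Proof.
apply: (@Manifold R n open_charted).
- exact: set_type_hausdorff.
- exact: set_type_second_countable.
- by move=> phi ->; exact: open_chart_is_chart.
- move=> phi psi -> ->; rewrite setIid [X in Coo X]open_chart_image => k.
  apply: (@Ck_ext _ _ _ k B id) => //; last by apply: Ck_linear => // y; exact: cvg_id.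
  by move=> u Bu; rewrite /= open_chart_invK.
- by move=> x; split.
Defined.

End open_manifold.

Lemma mulmx_projected (R : realType) k n m (v : 'rV[R]_k) (d : 'rV[R]_m) (X Y : 'M[R]_(k, n))
    (Q Q' : 'M[R]_n) (L L' : 'M[R]_(m, n)) (J J' : 'M[R]_(n, m)) :
  X = X *m Q + Y *m Q' -> Q' = J' *m L + J *m L' -> v *m Y = d *m L -> L *m J = 1%:M ->
  v *m X = v *m X *m Q + (d *m L *m J' *m L + d *m L').
Proof.
move=> E EQ e LJ; rewrite {1}E mulmxDr !mulmxA e EQ mulmxDr !mulmxA.
by rewrite -(mulmxA d L J) LJ mulmx1.
Qed.

(** * Flatness of the lift and integral manifolds *)

Section integrability.
Variables (R : realType) (n m : nat) (Mt : manifold R n) (M : manifold R m).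
Variables (gt : riem_metric Mt) (g : riem_metric M) (P : Mt -> M).
Hypothesis hP : riemannian_submersion setT setT gt g P.
Local Notation HP := (horizontal_bundle gt P).
Local Notation Jc := (jac_rep P).
Local Notation Lc := (lift_rep gt P).

(** Bootstrapping: ['d F x v] is v L(F x), so each class C^k of F gives C^k of its derivative. *)
Lemma flow_Coo (L : 'rV[R]_n -> 'M[R]_(m, n)) (U : set 'rV[R]_n) (B : set 'rV[R]_m)
    (F : 'rV[R]_m -> 'rV[R]_n) : open B -> Coo U L ->
  (forall x, B x -> U (F x) /\ is_diff x F (fun h => h *m L (F x))) -> Coo B F.
Proof.
move=> oB LU FP; elim=> [|k IH] /=.
  by move=> x /FP[_ [Fd _]]; exact: differentiable_continuous.
split=> [x /FP[_ []]//|v].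
have E x : B x -> v *m L (F x) = 'd F x v.
  move=> /FP[_ [_ FE]]; exact: esym (congr1 (fun l : 'rV[R]_m -> 'rV[R]_n => l v) FE).
apply: (Ck_ext oB E).
apply: (Ck_linear_comp oB (@mulmxl_linear R 1 m n v) (@mulmxl_continuous R 1 m n v)).
by apply: (@Ck_comp _ _ _ _ _ _ U F L) => // x /FP[].
Qed.

(** f o F - id has derivative L J - 1 = 0, hence is constant on the ball, and F is injective there.
    With f the coordinate expression of P, a leaf is a graph over coordinates of the base. *)
Lemma flow_section (f : 'rV[R]_n -> 'rV[R]_m) (F : 'rV[R]_m -> 'rV[R]_n)
    (L : 'rV[R]_n -> 'M[R]_(m, n)) (r : R) :
  (forall x, `|x| < r -> [/\ differentiable f (F x), L (F x) *m Jac f (F x) = 1%:M &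
     is_diff x F (fun h => h *m L (F x))]) ->
  forall x y, `|x| < r -> `|y| < r -> F x = F y -> x = y.
Proof.
move=> H x y xr yr Fxy; apply/rowP => i.
pose h z : R := (f (F z) - z) 0 i.
have dh z : `|z| < r -> is_diff z h (fun=> 0).
  move=> /H[fd LJ [Fd FE]].
  have fFd : differentiable (fun z => f (F z)) z by exact: differentiable_comp Fd fd.
  have gd := @is_diffB _ _ _ _ _ _ _ _ (differentiableP fFd) (is_diff_id z).
  have [g1 gE] := gd.
  have hd : differentiable h z.
    apply: (@differentiable_comp _ _ _ _ (fun z => f (F z) - z) (fun M : 'rV[R]_m => M 0 i : R)) => //.
    exact: differentiable_coord.
  apply: DiffDef => //; apply/funext => w.
  apply: eq_trans (@diff_coord _ _ 1 m (fun z => f (F z) - z) z w 0 i g1) _.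
  have -> : 'd (fun z => f (F z) - z) z w = 0; last by rewrite mxE.
  apply: eq_trans (congr1 (fun l : 'rV[R]_m -> 'rV[R]_m => l w) gE) _.
  have e1 : 'd (fun z => f (F z)) z w = w.
    apply: eq_trans (diff_compE w Fd fd) _.
    apply: eq_trans (diff_congr f (erefl (F z)) (congr1 (fun l : 'rV[R]_m -> 'rV[R]_n => l w) FE)) _.
    by rewrite JacE -mulmxA LJ mulmx1.
  by apply/eqP; rewrite subr_eq0; apply/eqP; exact: e1.
have [t t01|c c01 E] := @MVT_row R m h x y.
  have := @segment_ball R m 0 x y r t t01; rewrite !subr0 => /(_ xr yr) h1.
  by have [] := dh _ h1.
have := @segment_ball R m 0 x y r c c01; rewrite !subr0 => /(_ xr yr) h1.
have [_ h0] := dh _ h1.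
rewrite (congr1 (fun l : 'rV[R]_m -> R => l _) h0) in E.
by move/eqP: E; rewrite subr_eq0 /h Fxy !mxE => /eqP; lra.
Qed.

(** The leaf through x0 is a ball of R^m, included by [chart_inv phi] after F. Its tangent space at
    a point is the row space of L there, which is the horizontal space. *)
Theorem flat_integrable :
  (forall x, lift_flat gt P (chart_at x) (chart_at (P x)) (chart_map (chart_at x) x)) ->
  integrable_subbundle HP.
Proof.
move=> flat x0; have cp := chart_pair_at P x0.
set phi := chart_at x0 in cp *; set psi := chart_at (P x0) in cp.
set u0 := chart_map phi x0; pose L := Lc phi psi.
have LC : Coo_at L u0 by exact: lift_rep_Coo_at hP x0.
have [U [oU Uu0 UL]] := LC.
(* Passed to [flat_section] as the property N, this keeps the leaf inside the charts and where L is
   smooth. *)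
have nN : \forall u \near u0, [/\ U u, chart_pair P phi psi (chart_inv phi u) &
    chart_map phi (chart_inv phi u) = u].
  by apply: filterS2 (open_nbhs_nbhs (conj oU Uu0)) (near_chart_pair hP cp) => u ? [].
have [r [F [r0 F0 FP]]] := flat_section LC nN (near_lift_flat hP x0 flat).
pose B := [set x : 'rV[R]_m | `|x| < r].
have oB : open B.
  have -> : B = (fun y : 'rV[R]_m => `|y|) @^-1` [set t | t < r] by [].
  by apply: open_comp; [move=> y _; exact: norm_continuous|exact: open_lt].
have FC : Coo B F by apply: (flow_Coo oB UL) => x /FP[[]].
have B0 : B 0 by rewrite /B /= normr0.
pose z0 : set_type B := exist _ 0 (mem_set B0).
pose N := open_manifold z0 oB.
have valB (z : N) : `|set_val z| < r by exact: set_valP z.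
pose i (z : N) := chart_inv phi (F (set_val z)).
have iP (z : N) : [/\ chart_pair P phi psi (i z) & chart_map phi (i z) = F (set_val z)].
  by have [[_ h E] _] := FP _ (valB z).
have FCat (z : N) : Coo_at F (set_val z).
  by exists B; split => //; exact: valB z.
have valc : continuous (set_val : set_type B -> 'rV[R]_m) by exact: initial_continuous.
have ic (z : N) : {for z, continuous i}.
  have [[c1 c2] E] := iP z.
  have cF : {for z, continuous (fun z : N => F (set_val z))}.
    apply: (@continuous_comp _ _ _ (set_val : set_type B -> 'rV[R]_m) F); first exact: valc.
    exact: Coo_at_continuous (FCat z).
  apply: (@continuous_comp _ _ _ (fun z : N => F (set_val z)) (chart_inv phi)) => //.
  rewrite -E; have [ap dx] := c1; have [_ _ _ _ H] := manifold_chart ap; exact: H.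
have rep (z : N) : \forall u \near set_val z,
    transition phi (chart_at (i z)) (F u) =
    (chart_map (chart_at (i z)) \o i \o chart_inv (chart_at z)) u.
  apply: filterS (open_nbhs_nbhs (conj oB (valB z))) => u Bu.
  by rewrite /i /= open_chart_invK.
have tC (z : N) : Coo_at (transition phi (chart_at (i z))) (F (set_val z)).
  have [[c1 c2] E] := iP z; rewrite -E; apply: transition_smooth => //; exact: at_chart_at.
have is_ (z : N) : smooth_at i z.
  split; first exact: ic.
  by apply: Coo_at_ext (rep z) _; exact: Coo_at_comp (FCat z) (tC z).
have di (z : N) v : dmap i z v =
    dtransition phi (chart_at (i z)) (i z) (v *m L (chart_map phi (i z))).
  have [[c1 c2] E] := iP z.
  apply: eq_trans (esym (near_diffE v (rep z))) _.
  have Fd := Coo_at_differentiable (FCat z).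
  apply: eq_trans (diff_compE v Fd (Coo_at_differentiable (tC z))) _.
  rewrite /dtransition E; apply: diff_congr => //.
  have [_ [_ FE]] := FP _ (valB z).
  exact: (congr1 (fun l : 'rV[R]_m -> 'rV[R]_n => l v) FE).
exists m, N, i; split=> //.
- move=> y z /(congr1 (chart_map phi)); have [_ ->] := iP y; have [_ ->] := iP z.
  move=> E; apply: val_inj.
  apply: (@flow_section (local_rep P phi psi) F L r) E => // x xr.
  have [[_ h Eh] Fd] := FP x xr; split=> //.
    by rewrite -Eh; exact: Coo_at_differentiable (local_rep_Coo hP h).
  by rewrite -Eh; exact (lift_repK hP h).
- by exists z0; rewrite /i /= F0; have [c1 _] := cp; exact: chart_mapK.
- move=> z v w; rewrite !di => E; have [h _] := iP z.
  have [c1 _] := h.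
  have {}E : v *m L (chart_map phi (i z)) = w *m L (chart_map phi (i z)).
    by rewrite -[LHS](dtransitionK _ c1 (at_chart_at (i z))) E dtransitionK //; exact: at_chart_at.
  have LJ := lift_repK hP h.
  by rewrite -[v]mulmx1 -[w]mulmx1 -LJ !(mulmxA _ (Lc phi psi _) (Jc phi psi _)) -/L E.
move=> z; have [h _] := iP z; have [c1 c2] := h.
apply/seteqP; split=> [_ [v _ <-]|w].
  by rewrite /= di; exact: (horizontal_lift hP v h).
rewrite /= /horizontal_bundle /= /bundle_proj /= => Hw.
pose w' := dtransition (chart_at (i z)) phi (i z) w.
have ww : dtransition phi (chart_at (i z)) (i z) w' = w.
  by apply: dtransitionK => //; exact: at_chart_at.
have Hw' : w' = w' *m Jc phi psi (chart_map phi (i z)) *m L (chart_map phi (i z)).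
  by apply/(horizontal_liftE hP _ h); rewrite ww.
by exists (w' *m Jc phi psi (chart_map phi (i z))) => //; rewrite di -Hw'.
Qed.

(* The image of 'd i is fixed by the projector Q = J L.  Differentiating this along the leaf,
   the second derivatives of i and of P drop out by symmetry. *)
Theorem integrable_flat : integrable_subbundle HP ->
  forall x, lift_flat gt P (chart_at x) (chart_at (P x)) (chart_map (chart_at x) x).
Proof.
move=> hI x0; have [k [N [i [_ ismooth [z iz] _ irange]]]] := hI x0.
have cp := chart_pair_at P x0.
set phi := chart_at x0 in cp *; set psi := chart_at (P x0) in cp *.
set u0 := chart_map phi x0.
have cp1 : at_chart phi (i z) by rewrite iz; have [] := cp.
have cz := at_chart_at z; set lam := chart_at z in cz.
pose F := local_rep i lam phi; set t0 := chart_map lam z.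
have F0 : F t0 = u0 by rewrite /F /local_rep /= chart_mapK // iz.
have FC : Coo_at F t0 by exact: smooth_at_local_rep (ismooth z) cz cp1.
pose J := Jc phi psi; pose L := Lc phi psi; pose Q u := J u *m L u.
have JC : Coo_at J u0 by exact: jac_rep_Coo hP _ _ _ cp.
have LC : Coo_at L u0 by exact: lift_rep_Coo_at hP x0.
have QC : Coo_at Q (F t0) by rewrite F0; exact: Coo_at_mulmx.
have FJ := Jac_smooth FC.
have QF : Coo_at (fun t => Q (F t)) t0 by exact: Coo_at_comp.
have [ic _] := ismooth z.
have hor y (c1 : at_chart lam y) (c2 : chart_pair P phi psi (i y)) (v : 'rV[R]_k) :
    v *m Jac F (chart_map lam y) = v *m Jac F (chart_map lam y) *m Q (chart_map phi (i y)).
  rewrite -JacE (mulmxA _ (J _) (L _)); apply/(horizontal_liftE hP _ c2).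
  have [c3 _] := c2.
  have := irange y => /seteqP[/(_ (dmap i y (dtransition lam (chart_at y) y v))) H _].
  have {}H : HP (@TVec R n Mt (i y) (dmap i y (dtransition lam (chart_at y) y v))).
    by apply: H; exists (dtransition lam (chart_at y) y v).
  have -> : 'd F (chart_map lam y) v =
      dtransition (chart_at (i y)) phi (i y) (dmap i y (dtransition lam (chart_at y) y v)).
    exact: diff_local_rep_dmap (ismooth y) c1 c3.
  by rewrite dtransitionK //; exact: at_chart_at.
have nE : \forall t \near t0, Jac F t = Jac F t *m Q (F t).
  have c1z : chart_pair P phi psi (i z) by rewrite iz.
  have n2 : \forall t \near t0, chart_pair P phi psi (chart_inv phi (F t)).
    have H := near_chart_pair hP cp.
    apply: (near_comp (P := fun u => chart_pair P phi psi (chart_inv phi u)) (Coo_at_continuous FC)).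
    by rewrite F0; apply: filterS H => u [].
  apply: filterS3 (near_chart_invK cz) n2 (near_chart_image ic cz cp1) => t [h E] h2 h3.
  set y := chart_inv lam t in h E h3.
  have Ft : F t = chart_map phi (i y) by [].
  have hy : chart_pair P phi psi (i y) by move: h2; rewrite Ft chart_mapK.
  apply/row_matrixP => j; rewrite !rowE (mulmxA _ (Jac F t)).
  have := hor y h hy (delta_mx 0 j); rewrite E; exact.
have dE v : 'd (Jac F) t0 v = 'd (Jac F) t0 v *m Q (F t0) +
    Jac F t0 *m 'd Q (F t0) (v *m Jac F t0).
  apply: eq_trans (near_diffE v nE) _; apply: eq_trans (diff_mulmx v FJ QF) _.
  congr (_ + _ *m _).
  apply: eq_trans (diff_compE v (Coo_at_differentiable FC) (Coo_at_differentiable QC)) _.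
  by apply: diff_congr => //; exact: JacE.
have LJ : L u0 *m J u0 = 1%:M by exact: lift_repK hP _ _ _ cp.
have lift_range (a : 'rV[R]_m) : exists v : 'rV[R]_k, v *m Jac F t0 = a *m L u0.
  have := irange z => /seteqP[_ /(_ (dtransition phi (chart_at (i z)) (i z) (a *m L u0)))].
  case.
    by rewrite /= /horizontal_bundle /= /bundle_proj /= iz; exact: (horizontal_lift hP a cp).
  move=> v _ E; exists v; rewrite -JacE.
  apply: eq_trans (diff_local_rep_dmap v (ismooth z) cz cp1) _.
  have -> : dtransition lam (chart_at z) z v = v by exact: dtransition_id.
  by rewrite E; apply: dtransitionK => //; exact: at_chart_at.
have dQ v : 'd Q (F t0) v = 'd J u0 v *m L u0 + J u0 *m 'd L u0 v.
  by apply: eq_trans (diff_mulmx v JC LC); rewrite F0.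
have JS a b : b *m 'd J u0 a = a *m 'd J u0 b.
  by apply: Jac_schwarz; exact: local_rep_Coo hP _ _ _ cp.
move=> a b; have [v vE] := lift_range a; have [w wE] := lift_range b.
have h (c d : 'rV[R]_m) (v1 v2 : 'rV[R]_k) :
    v1 *m Jac F t0 = c *m L u0 -> v2 *m Jac F t0 = d *m L u0 ->
    v2 *m 'd (Jac F) t0 v1 = v2 *m 'd (Jac F) t0 v1 *m Q (F t0) +
      (d *m L u0 *m 'd J u0 (c *m L u0) *m L u0 + d *m 'd L u0 (c *m L u0)).
  move=> e1 e2.
  have E1 := dE v1; rewrite e1 in E1.
  exact: mulmx_projected E1 (dQ (c *m L u0)) e2 LJ.
have h1 := h a b v w vE wE; have h2 := h b a w v wE vE.
rewrite (Jac_schwarz v w FC) in h2.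
rewrite (JS (b *m L u0) (a *m L u0)) in h2.
have := eq_trans (esym h1) h2 => /addrI/addrI.
exact.
Qed.

End integrability.

(** * Unit bundles *)

Lemma diff_form (R : realType) (V : normedModType R) m (H : V -> 'M[R]_m) (b : V -> 'rV[R]_m)
    (x h : V) : Coo_at H x -> Coo_at b x -> (H x)^T = H x ->
  'd (fun y => form (H y) (b y) (b y)) x h =
  form ('d H x h) (b x) (b x) + 2 * form (H x) (b x) ('d b x h).
Proof.
move=> HC bC Hs.
have bT := Coo_at_trmx bC; have bH := Coo_at_mulmx bC HC.
have C := Coo_at_mulmx bH bT.
apply: eq_trans (diff_coord h 0 0 (Coo_at_differentiable C)) _.
have -> : 'd (fun y => b y *m H y *m (b y)^T) x h =
    ('d b x h *m H x + b x *m 'd H x h) *m (b x)^T + b x *m H x *m ('d b x h)^T.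
  apply: eq_trans (diff_mulmx h bH bT) _.
  exact (congr2 (fun (X : 'rV[R]_m) (Y : 'cV[R]_m) => X *m (b x)^T + b x *m H x *m Y)
    (diff_mulmx h bC HC) (diff_trmx h bC)).
rewrite mulmxDl mxE mxE -[(_ *m H x *m (b x)^T) 0 0]/(form (H x) _ _).
rewrite -[(_ *m ('d b x h)^T) 0 0]/(form (H x) _ _).
rewrite -[(_ *m 'd H x h *m (b x)^T) 0 0]/(form ('d H x h) _ _).
by rewrite (form_sym ('d b x h) _ Hs); ring.
Qed.

(** The derivative of r (r q) = 1 as two product rules deliver it: with q' = 0 and r = q = 1 it
    reads 2 r' = 0. *)
Lemma normalizer_deriv_eq0 (R : realType) (X Y c e k d : R) : X = k * c + d * e -> Y = k * X + d * (k * e) ->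
  Y = 0 -> c = 0 -> e = 1 -> k = 1 -> d = 0.
Proof. by move=> -> -> h c0 e1 k1; rewrite c0 e1 k1 in h; lra. Qed.

(** * Tangent vectors of a unit bundle in a moving frame *)

Section unit_frame.
Variables (R : realType) (n m : nat) (N : manifold R n).
Variables (S : set (tangent_bundle N)) (z : tangent_bundle N).
Local Notation x := (tbase z).
Local Notation phi := (chart_at (tbase z)).
Local Notation u0 := (chart_map (chart_at (tbase z)) (tbase z)).
Variables (L : 'rV[R]_n -> 'M[R]_(m, n)) (J : 'rV[R]_n -> 'M[R]_(n, m)).
Variables (H : 'rV[R]_n -> 'M[R]_m) (C : 'rV[R]_n -> 'M[R]_m) (s : 'rV[R]_m).
Hypotheses (LC : Coo_at L u0) (JC : Coo_at J u0) (HC : Coo_at H u0).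
Hypothesis zE : tvect z = s *m L u0.
Hypothesis LJ : L u0 *m J u0 = 1%:M.
Hypothesis Hs : (H u0)^T = H u0.
Hypothesis s1 : form (H u0) s s = 1.
Hypothesis dH : forall a, 'd H u0 a = C a *m H u0 + H u0 *m (C a)^T.
Hypothesis SP : \forall u \near u0, forall v,
  S (@TVec R n N (chart_inv phi u) (dchart_inv phi u v)) <->
  v = v *m J u *m L u /\ form (H u) (v *m J u) (v *m J u) = 1.
Hypothesis LJ_near : \forall u \near u0, L u *m J u = 1%:M.

Local Notation frame := (frame_vect z L s).

(** Metric compatibility along a curve: the derivative of the squared norm is twice the product of s
    with the covariant derivative b + s C(a). *)
Lemma form_dH a b : form ('d H u0 a) s s + 2 * form (H u0) s b =
  2 * form (H u0) s (b + s *m C a).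
Proof.
rewrite dH formDr mulrDr [RHS]addrC; congr (_ + _).
have -> : form (C a *m H u0 + H u0 *m (C a)^T) s s =
    form (H u0) (s *m C a) s + form (H u0) s (s *m C a).
  by rewrite /form mulmxDr mulmxDl mxE trmx_mul !mulmxA.
by rewrite (form_sym (s *m C a) _ Hs); ring.
Qed.

(** Along a curve in S the fibre part is b L with b of constant norm 1; differentiating the norm
    gives the constraint. *)
Lemma unit_tangent_param A : tangent_at S z A ->
  exists a b, A = frame a b /\ form (H u0) s (b + s *m C a) = 0.
Proof.
move=> /tangent_atP[W [WC W0 WA WS]].
pose a t : 'rV[R]_n := lsubmx (W t); pose v t : 'rV[R]_n := rsubmx (W t).
pose b t := v t *m J (a t).
have a0 : a 0 = u0 by rewrite /a W0 tcoordE row_mxKl.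
have v0 : v 0 = s *m L u0 by rewrite /v W0 tcoordE row_mxKr.
have b0 : b 0 = s by rewrite /b a0 v0 -mulmxA LJ mulmx1.
have aC : Coo_at a 0 by exact: Coo_at_lsubmx.
have vC : Coo_at v 0 by exact: Coo_at_rsubmx.
have JaC : Coo_at (fun t => J (a t)) 0 by apply: Coo_at_comp => //; rewrite a0.
have HaC : Coo_at (fun t => H (a t)) 0 by apply: Coo_at_comp => //; rewrite a0.
have bC : Coo_at b 0 by exact: Coo_at_mulmx.
have nS : \forall t \near (0 : R), v t = b t *m L (a t) /\ form (H (a t)) (b t) (b t) = 1.
  have h1 : \forall t \near (0 : R), forall v,
      S (@TVec R n N (chart_inv phi (a t)) (dchart_inv phi (a t) v)) <->
      v = v *m J (a t) *m L (a t) /\ form (H (a t)) (v *m J (a t)) (v *m J (a t)) = 1.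
    apply: (near_comp (P := fun u => forall v,
      S (@TVec R n N (chart_inv phi u) (dchart_inv phi u v)) <->
      v = v *m J u *m L u /\ form (H u) (v *m J u) (v *m J u) = 1) (Coo_at_continuous aC)).
    by rewrite a0.
  by apply: filterS2 h1 WS => t h st; apply/h.
have EW : \forall t \near (0 : R), row_mx (a t) (b t *m L (a t)) = W t.
  by apply: filterS nS => t [<- _]; rewrite hsubmxK.
(* [frame_curve] is taken for the full bundle [setT], as only the velocity is wanted here. *)
have [_ _ FE _] := @frame_curve R n m N setT z L s LC zE (filterS (fun u _ c => I) LJ_near) a b aC bC a0 b0.
exists ('d a 0 1), ('d b 0 1); split.
  rewrite -WA; apply: eq_trans FE; exact (esym (near_diffE (1 : R) EW)).
have E1 : 'd (fun t => form (H (a t)) (b t) (b t)) 0 (1 : R) = 0.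
  have n1 : \forall t \near (0 : R), form (H (a t)) (b t) (b t) = 1 by apply: filterS nS => t [].
  exact (eq_trans (near_diffE (1 : R) n1) (diff_cstE (1 : R) (0 : R) (1 : R))).
have Hs' : (H (a 0))^T = H (a 0) by rewrite a0.
have E2 := diff_form (1 : R) HaC bC Hs'.
have E3 : 'd (fun t => H (a t)) 0 (1 : R) = 'd H u0 ('d a 0 1).
  have d1 := Coo_at_differentiable aC.
  have d2 : differentiable H (a 0) by rewrite a0; exact: Coo_at_differentiable.
  rewrite -[in RHS]a0; exact (diff_compE (1 : R) d1 d2).
have E4 := eq_trans (esym E1) E2.
rewrite E3 a0 b0 form_dH in E4.
by move/eqP: E4; rewrite eq_sym mulf_eq0 pnatr_eq0 /= => /eqP.
Qed.

(* The affine curve with the prescribed velocity is rescaled to unit length. *)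
Lemma unit_tangent_curve a b : form (H u0) s (b + s *m C a) = 0 ->
  exists W : R -> 'rV[R]_(n + n), [/\ Coo_at W 0, W 0 = tcoord z, 'd W 0 1 = frame a b,
    forall t, lsubmx (W t) = u0 + t *: a &
    \forall t \near (0 : R), S (of_tcoord z (W t))].
Proof.
move=> sb; pose at_ (t : R) := u0 + t *: a; pose bh (t : R) := s + t *: b.
have aC : Coo_at at_ 0 by exact: Coo_at_affine.
have hC : Coo_at bh 0 by exact: Coo_at_affine.
have a0 : at_ 0 = u0 by rewrite /at_ scale0r addr0.
have h0 : bh 0 = s by rewrite /bh scale0r addr0.
have HaC : Coo_at (fun t => H (at_ t)) 0 by apply: Coo_at_comp => //; rewrite a0.
pose q t := form (H (at_ t)) (bh t) (bh t).
have qC : Coo_at q 0.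
  apply: (@Coo_at_coord _ _ 1 1 (fun t => bh t *m H (at_ t) *m (bh t)^T)).
  by apply: Coo_at_mulmx; [exact: Coo_at_mulmx|exact: Coo_at_trmx].
have q0 : q 0 = 1 by rewrite /q a0 h0.
have dq : 'd q 0 (1 : R) = 0.
  have Hs' : (H (at_ 0))^T = H (at_ 0) by rewrite a0.
  have E2 := diff_form (1 : R) HaC hC Hs'.
  have E3 : 'd (fun t => H (at_ t)) 0 (1 : R) = 'd H u0 a.
    have d1 := Coo_at_differentiable aC.
    have d2 : differentiable H (at_ 0) by rewrite a0; exact: Coo_at_differentiable.
    by apply: eq_trans (diff_compE (1 : R) d1 d2) _; apply: diff_congr => //; exact: diff_affine.
  have E5 : 'd bh 0 (1 : R) = b by exact: diff_affine.
  rewrite E3 a0 h0 E5 form_dH sb mulr0 in E2; exact: E2.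
pose r t := (Num.sqrt (q t))^-1.
have qpos : 0 < q 0 by rewrite q0.
have rC : Coo_at r 0 by exact: Coo_at_invsqrt.
have r0 : r 0 = 1 by rewrite /r q0 sqrtr1 invr1.
have nq : \forall t \near (0 : R), 0 < q t.
  exact: (Coo_at_continuous qC) (open_nbhs_nbhs (conj (@open_gt R 0) qpos)).
have rq : \forall t \near (0 : R), r t * (r t * q t) = 1.
  apply: filterS nq => t qt; rewrite /r mulrA -expr2 exprVn sqr_sqrtr ?ltW //.
  by rewrite mulVf // gt_eqF.
have dr : 'd r 0 (1 : R) = 0.
  have rqC : Coo_at (fun t => r t *: (q t : R^o)) 0 by exact: (@Coo_atZ R _ R r q).
  have e1 := diff_scaleE (1 : R) (Coo_at_differentiable rC) (Coo_at_differentiable qC).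
  have e2 := diff_scaleE (1 : R) (Coo_at_differentiable rC) (Coo_at_differentiable rqC).
  have e3 : 'd (fun t => r t *: (r t *: (q t : R))) 0 (1 : R) = 0.
    exact (eq_trans (near_diffE (1 : R) rq) (diff_cstE (1 : R) (0 : R) (1 : R))).
  exact (normalizer_deriv_eq0 e1 e2 e3 dq q0 r0).
pose bt t := r t *: bh t.
have bC : Coo_at bt 0 by exact: Coo_atZ.
have b0 : bt 0 = s by rewrite /bt r0 h0 scale1r.
have db : 'd bt 0 (1 : R) = b.
  apply: eq_trans (diff_scaleE (1 : R) (Coo_at_differentiable rC) (Coo_at_differentiable hC)) _.
  have E5 : 'd bh 0 (1 : R) = b by exact: diff_affine.
  by rewrite dr r0 scale0r addr0 scale1r.
have [F1 F2 F3 _] := @frame_curve R n m N setT z L s LC zE (filterS (fun u _ c => I) LJ_near) at_ bt aC bC a0 b0.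
exists (fun t => row_mx (at_ t) (bt t *m L (at_ t))); split=> //.
- by apply: eq_trans F3 _; rewrite db; congr frame_vect; exact: diff_affine.
- by move=> t; rewrite row_mxKl.
have h1 : \forall t \near (0 : R), (forall v,
    S (@TVec R n N (chart_inv phi (at_ t)) (dchart_inv phi (at_ t) v)) <->
    v = v *m J (at_ t) *m L (at_ t) /\ form (H (at_ t)) (v *m J (at_ t)) (v *m J (at_ t)) = 1) /\
    L (at_ t) *m J (at_ t) = 1%:M.
  apply: (near_comp (P := fun u => (forall v,
    S (@TVec R n N (chart_inv phi u) (dchart_inv phi u v)) <->
    v = v *m J u *m L u /\ form (H u) (v *m J u) (v *m J u) = 1) /\ L u *m J u = 1%:M)
    (Coo_at_continuous aC)).
  by rewrite a0; apply: filterS2 SP LJ_near.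
apply: filterS2 h1 rq => t [h LJt] rqt.
rewrite /of_tcoord /= row_mxKl row_mxKr; apply/h.
rewrite -(mulmxA (bt t)) LJt mulmx1; split=> //.
have -> : form (H (at_ t)) (bt t) (bt t) = r t * (r t * q t); last exact: rqt.
by rewrite /bt formZl /q /form [in LHS]linearZ /= -scalemxAr mxE.
Qed.

Lemma unit_tangentP A : tangent_at S z A <->
  exists a b, A = frame a b /\ form (H u0) s (b + s *m C a) = 0.
Proof.
split=> [|[a [b [-> sb]]]]; first exact: unit_tangent_param.
apply/tangent_atP; have [W [W1 W2 W3 _ W5]] := unit_tangent_curve sb.
by exists W.
Qed.

(** A curve in the fibre has constant base coordinates, so a = 0. Conversely, for a = 0 the rescaled
    curve of [unit_tangent_curve] has constant base point. *)
Lemma unit_fibre_tangentP A : C 0 = 0 ->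
  tangent_at (S `&` [set z' | bundle_proj z' = bundle_proj z]) z A <->
  exists b, A = frame 0 b /\ form (H u0) s b = 0.
Proof.
move=> C0; split=> [AT|[b [-> sb]]].
  have AS : tangent_at S z A.
    move: AT => [c [c0 cC cS cA]]; exists c; split=> //.
    by apply: filterS cS => t [].
  have [a [b [AE sb]]] := unit_tangent_param AS.
  suff a0 : a = 0 by exists b; rewrite AE a0; split=> //; move: sb; rewrite a0 C0 mulmx0 addr0.
  move: AT => /tangent_atP[W [WC W0 WA WS]].
  have -> : a = lsubmx A by rewrite AE row_mxKl.
  rewrite -WA.
  have d1 := Coo_at_differentiable WC.
  have e1 := diff_linear_comp (1 : R) (@lsubmx_linear R n n) (@lsubmx_continuous R n n) d1.
  suff nu : \forall t \near (0 : R), lsubmx (W t) = u0.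
    exact (eq_trans (esym e1) (eq_trans (near_diffE (1 : R) nu) (diff_cstE u0 (0 : R) (1 : R)))).
  have nI : \forall t \near (0 : R), at_chart phi (tbase (of_tcoord z (W t))) /\
      chart_map (tchart phi) (of_tcoord z (W t)) = W t.
    apply: (near_comp (P := fun w => at_chart phi (tbase (of_tcoord z w)) /\
      chart_map (tchart phi) (of_tcoord z w) = w) (Coo_at_continuous WC)).
    by rewrite W0; apply: near_tchart_invK; exact: at_chart_at.
  apply: filterS2 nI WS => t [h E] [_ hb].
  by rewrite -E /= row_mxKl; congr (chart_map _ _).
apply/tangent_atP.
have sb' : form (H u0) s (b + s *m C 0) = 0 by rewrite C0 mulmx0 addr0.
have [W [W1 W2 W3 W4 W5]] := unit_tangent_curve sb'.
exists W; split=> //; apply: filterS W5 => t h; split=> //.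
rewrite /bundle_proj /= W4 scaler0 addr0.
by apply: chart_mapK; exact: at_chart_at.
Qed.

End unit_frame.

(** * The unit tangent bundle SM *)

Section unit_sphere_bundle.
Variables (R : realType) (m : nat) (M : manifold R m) (g : riem_metric M).
Variables (nabla : covariant M) (K : tangent_bundle M -> 'rV[R]_(m + m) -> 'rV[R]_m).
Hypothesis nablaP : levi_civita g nabla.
Hypothesis KP : connection_map (@setT (tangent_bundle M)) nabla K.
Variable z : tangent_bundle M.
Local Notation psi := (chart_at (tbase z)).
Local Notation y0 := (chart_map (chart_at (tbase z)) (tbase z)).
Local Notation G := (gram g psi y0).
Local Notation SM := (unit_bundle g (@setT (tangent_bundle M))).
Hypothesis z1 : SM z.

(* The vector of T(TM) at z with base velocity c and covariant derivative k. *)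
Definition split_vect (c k : 'rV[R]_m) : 'rV[R]_(m + m) :=
  row_mx c (k - tvect z *m christoffel nabla (tbase z) c).

Lemma unit_form : form G (tvect z) (tvect z) = 1.
Proof. by have [_ <-] := z1; rewrite gram_form_at. Qed.

Lemma unit_neq0 : tvect z != 0.
Proof.
apply/eqP => E; have := unit_form; rewrite E form0l => /eqP.
by rewrite eq_sym oner_eq0.
Qed.

(** SM is the case L = J = 1 of the moving frame, so the general results on unit bundles and
    connection maps apply to it. *)
Lemma constant_frame_vect c b : frame_vect z (fun _ => 1%:M) (tvect z) c b = row_mx c b.
Proof.
have E : 'd (fun _ : 'rV[R]_m => (1%:M : 'M[R]_m)) y0 c = 0 by exact: diff_cstE.
rewrite /frame_vect mulmx1; congr row_mx.
apply: eq_trans (congr1 (fun X : 'M[R]_m => tvect z *m X + b) E) _.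
by rewrite mulmx0 add0r.
Qed.

Lemma unit_sphere_local : \forall u \near y0, forall v,
  SM (@TVec R m M (chart_inv psi u) (dchart_inv psi u v)) <->
  v = v *m 1%:M *m 1%:M /\ form (gram g psi u) (v *m 1%:M) (v *m 1%:M) = 1.
Proof.
apply: filterS (near_chart_invK (at_chart_at (tbase z))) => u [h E] v.
rewrite !mulmx1; rewrite -[in dchart_inv _ _ _]E dchart_invE //.
rewrite -[in gram _ _ _]E -gram_form //.
by split=> [[_ H]|[_ H]].
Qed.

Lemma sphere_tangentP B : tangent_at SM z B <->
  exists c k, B = split_vect c k /\ form G (tvect z) k = 0.
Proof.
have I1 : (1%:M : 'M[R]_m) *m 1%:M = 1%:M by rewrite mulmx1.
have In : \forall u \near y0, (1%:M : 'M[R]_m) *m 1%:M = 1%:M by apply: filterE.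
have H := @unit_tangentP R m m M SM z (fun _ => 1%:M) (fun _ => 1%:M) (gram g psi)
  (christoffel nabla (tbase z)) (tvect z) (Coo_at_cst _ _) (Coo_at_cst _ _) (gram_smooth g _)
  (esym (mulmx1 _)) I1 (gram_sym g _ _) unit_form (gram_deriv nablaP _) unit_sphere_local
  In B.
split=> [BT|[c [k [BE E]]]].
  have [c [b [-> E]]] := proj1 H BT.
  exists c, (b + tvect z *m christoffel nabla (tbase z) c); split=> //.
  by rewrite constant_frame_vect /split_vect addrK.
apply: (proj2 H); exists c, (k - tvect z *m christoffel nabla (tbase z) c).
by rewrite BE; split; [rewrite constant_frame_vect|rewrite subrK].
Qed.

Lemma sphere_connection c k : K z (split_vect c k) = k.
Proof.
have I1 : tvect z = tvect z *m 1%:M by rewrite mulmx1.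
have idl : linear (fun v : 'rV[R]_m => v) by [].
have In : \forall u \near y0, forall c : 'rV[R]_m,
  @setT (tangent_bundle M) (@TVec R m M (chart_inv psi u) (dchart_inv psi u (c *m 1%:M))) by apply: filterE.
have H := @connection_map_frame R m m M (@setT (tangent_bundle M)) z (fun _ => 1%:M) (tvect z)
  (Coo_at_cst _ _) I1 In nabla K (fun v => v)
  (christoffel nabla (tbase z)) KP idl (christoffel_linear nablaP _) unit_neq0
  (fun f a fC => nabla_chart_field nablaP a fC) c (k - tvect z *m christoffel nabla (tbase z) c).
have E : 'd (fun _ : 'rV[R]_m => (1%:M : 'M[R]_m)) y0 c = 0 by exact: diff_cstE.
rewrite constant_frame_vect in H; apply: eq_trans H _.
apply: eq_trans (congr1 (fun X : 'M[R]_m => tvect z *m X + (k - tvect z *m christoffel nabla (tbase z) c) *m 1%:M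
  + tvect z *m christoffel nabla (tbase z) c) E) _.
by rewrite mulmx0 add0r mulmx1 subrK.
Qed.

Lemma sphere_pq_metric p q c k c' k' :
  form G (tvect z) k = 0 -> form G (tvect z) k' = 0 ->
  pq_metric g K p q z (split_vect c k) (split_vect c' k') =
  form G c c' + ((1 + 1) `^ p)^-1 * form G k k'.
Proof.
move=> k0 k0'; have [_ s1] := z1.
rewrite /pq_metric !dmap_bundle_proj !sphere_connection s1 !row_mxKl !gram_form_at.
by rewrite (form_sym k (tvect z) (gram_sym g _ _)) k0 mulr0 mul0r addr0.
Qed.

End unit_sphere_bundle.

(** * O'Neill's tensor of the submersion P *)

Section submersion_tensor.
Variables (R : realType) (n m : nat) (Mt : manifold R n) (M : manifold R m).
Variables (gt : riem_metric Mt) (g : riem_metric M) (P : Mt -> M).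
Variables (nablat : covariant Mt) (nabla : covariant M).
Hypothesis hP : riemannian_submersion setT setT gt g P.
Hypothesis nablatP : levi_civita gt nablat.
Hypothesis nablaP : levi_civita g nabla.
Variable x : Mt.
Local Notation phi := (chart_at x).
Local Notation psi := (chart_at (P x)).
Local Notation u0 := (chart_map (chart_at x) x).
Local Notation y0 := (chart_map (chart_at (P x)) (P x)).
Local Notation J := (jac_rep P phi psi).
Local Notation L := (lift_rep gt P phi psi).
Local Notation A := (gram gt phi).
Local Notation G := (gram g psi).
Local Notation f := (local_rep P phi psi).
Local Notation CA := (christoffel nablat x).
Local Notation CG := (christoffel nabla (P x)).

Lemma local_rep0 : f u0 = y0.
Proof. by apply: local_rep_at; exact: at_chart_at. Qed.

Lemma gram_pull_Coo : Coo_at (fun u => G (f u)) u0.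
Proof.
apply: Coo_at_comp; first exact: local_rep_Coo hP _ _ _ (chart_pair_at P x).
by rewrite local_rep0; exact: gram_smooth.
Qed.

Lemma gram_pull_deriv v : 'd (fun u => G (f u)) u0 v =
  CG (v *m J u0) *m G (f u0) + G (f u0) *m (CG (v *m J u0))^T.
Proof.
have fd := Coo_at_differentiable (local_rep_Coo hP (chart_pair_at P x)).
have Gd : differentiable G (f u0) by rewrite local_rep0; exact: Coo_at_differentiable (gram_smooth g _).
apply: eq_trans (diff_compE v fd Gd) _.
rewrite local_rep0; apply: eq_trans (gram_deriv nablaP (P x) _).
by apply: diff_congr => //; exact: JacE.
Qed.

Lemma near_lift_repK : \forall u \near u0, L u *m J u = 1%:M.
Proof.
apply: filterS (near_chart_pair hP (chart_pair_at P x)) => u [h E _].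
by have := lift_repK hP h; rewrite E.
Qed.

Lemma near_lift_isometry : \forall u \near u0, L u *m A u = G (f u) *m (J u)^T.
Proof.
apply: filterS (near_chart_pair hP (chart_pair_at P x)) => u [h E1 E2].
by have := lift_rep_isometry hP h; rewrite E1 E2.
Qed.

Lemma lift_deriv_jac v : 'd L u0 v *m J u0 + L u0 *m 'd J u0 v = 0.
Proof.
have LC := lift_rep_Coo_at hP x; have JC := jac_rep_Coo hP (chart_pair_at P x).
apply: eq_trans (esym (diff_mulmx v LC JC)) _.
exact (eq_trans (near_diffE v near_lift_repK) (diff_cstE _ _ _)).
Qed.

(** The derivative of the identity L A = G(f) J^T, with the derivatives of both Gram matrices
    written through Christoffel matrices. Together with [lift_deriv_jac] it feeds the algebraic
    section on D. *)
Lemma lift_deriv_gram v :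
  'd L u0 v *m A u0 + L u0 *m (CA v *m A u0 + A u0 *m (CA v)^T) =
  (CG (v *m J u0) *m G y0 + G y0 *m (CG (v *m J u0))^T) *m (J u0)^T + G y0 *m ('d J u0 v)^T.
Proof.
have LC := lift_rep_Coo_at hP x; have JC := jac_rep_Coo hP (chart_pair_at P x).
rewrite -(gram_deriv nablatP) -[in RHS]local_rep0 -gram_pull_deriv.
apply: eq_trans (esym (diff_mulmx v LC (gram_smooth gt x))) _.
apply: eq_trans (near_diffE v near_lift_isometry) _.
apply: eq_trans (diff_mulmx v gram_pull_Coo (Coo_at_trmx JC)) _.
by congr (_ + _ *m _); exact: diff_trmx.
Qed.

Definition oneill_rep := oneill (J u0) (L u0) (fun v => 'd J u0 v) CA CG.

Let Ap : posdef (A u0) := gram_posdef gt (at_chart_at x).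
Let Gp : posdef (G y0) := gram_posdef g (at_chart_at (P x)).
Let LJ : L u0 *m J u0 = 1%:M := lift_repK hP (chart_pair_at P x).
Let LA : L u0 *m A u0 = G y0 *m (J u0)^T := lift_rep_isometry hP (chart_pair_at P x).
Let CAS := christoffel_sym nablatP x.
Let CGS := christoffel_sym nablaP (P x).
Let CAl := christoffel_linear nablatP x.
Let CGl := christoffel_linear nablaP (P x).
Let DJS (a b : 'rV[R]_n) : b *m 'd J u0 a = a *m 'd J u0 b :=
  Jac_schwarz b a (local_rep_Coo hP (chart_pair_at P x)).
Let DJl : linear (fun v => 'd J u0 v).
Proof. exact: linearP. Qed.

Lemma oneill_rep_linear : linear oneill_rep.
Proof. exact: oneill_linear. Qed.

Lemma form_oneill_rep s a : form (G y0) s (s *m oneill_rep a) = 0.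
Proof.
have := form_oneill_skew Ap Gp LJ LA lift_deriv_jac lift_deriv_gram a s s.
by rewrite -/oneill_rep; lra.
Qed.

Lemma oneill_rep0P : (forall a, oneill_rep a = 0) <-> lift_flat gt P phi psi u0.
Proof.
have H := oneill0P Ap Gp LJ LA lift_deriv_jac lift_deriv_gram CAS CGS DJS CAl CGl DJl.
split=> [D0 a b|F]; first exact (proj1 H D0 b a).
by apply: (proj2 H) => a b; exact: F.
Qed.

Lemma oneill_rep_isometry (s : 'rV[R]_m) (k : R) : 0 < k ->
  (forall (W : 'rV_n) (b : 'rV_m), W *m J u0 = 0 -> form (G y0) s b = 0 ->
     (forall U : 'rV_n, U *m J u0 = 0 ->
        form (A u0) W U + k * form (G y0) (b + s *m oneill_rep W) (s *m oneill_rep U) = 0) ->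
     k * form (G y0) b b =
     form (A u0) W W + k * form (G y0) (b + s *m oneill_rep W) (b + s *m oneill_rep W)) ->
  forall a, s *m oneill_rep a = 0.
Proof.
exact (oneill_isometry Ap Gp LJ LA lift_deriv_jac lift_deriv_gram CAS CGS DJS CAl CGl DJl (s := s) (k := k)).
Qed.

End submersion_tensor.

Lemma linear_at0 (R : nzRingType) (U V : lmodType R) (f : U -> V) : linear f -> f 0 = 0.
Proof. by move=> /(_ (-1) 0 0); rewrite scaler0 addr0 scaleN1r addNr. Qed.

(** The fibre coefficient k - s CG makes k the covariant derivative downstairs; projecting the
    covariant derivative upstairs by J gives k corrected by s D. *)
Lemma connection_frame_oneill (R : realType) n m (s k : 'rV[R]_m) (J DJ : 'M[R]_(n, m))
    (L DL : 'M[R]_(m, n)) (CA : 'M[R]_n) (CG : 'M[R]_m) : L *m J = 1%:M -> DL *m J = - (L *m DJ) ->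
  (s *m DL + (k - s *m CG) *m L + s *m L *m CA) *m J = k + s *m (L *m CA *m J - L *m DJ - CG).
Proof.
move=> LJ E; rewrite !mulmxDl -!mulmxA E !LJ !mulmx1 !mulmxBr mulmxN !mulmxA.
by apply/rowP => i; rewrite !mxE; ring.
Qed.

Section horizontal_bundle_fibre.
Variables (R : realType) (n m : nat) (Mt : manifold R n) (M : manifold R m).
Variables (gt : riem_metric Mt) (g : riem_metric M) (P : Mt -> M).
Hypothesis hP : riemannian_submersion setT setT gt g P.
Variable x : Mt.
Local Notation phi := (chart_at x).
Local Notation psi := (chart_at (P x)).
Local Notation u0 := (chart_map (chart_at x) x).
Local Notation y0 := (chart_map (chart_at (P x)) (P x)).
Local Notation J := (jac_rep P phi psi u0).
Local Notation L := (lift_rep gt P phi psi u0).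
Local Notation A := (gram gt phi u0).
Local Notation G := (gram g psi y0).

Lemma dmap_jac_rep v : dmap P x v = v *m J.
Proof. exact: JacE. Qed.

Lemma horizontal_atP v : horizontal setT gt P x v <-> v = v *m J *m L.
Proof.
have := horizontal_liftE hP v (chart_pair_at P x).
by rewrite dtransition_id //; exact: at_chart_at.
Qed.

Lemma form_lift (b : 'rV[R]_m) v : form A (b *m L) v = form G b (v *m J).
Proof.
have LA := lift_rep_isometry hP (chart_pair_at P x).
rewrite /form trmx_mul -(mulmxA b) LA !mulmxA //.
Qed.

(** [orth_proj] is a choice, so both facts are needed: v J L has the defining property, and
    nondegeneracy of G leaves no other candidate. *)
Lemma orth_proj_horizontal v : orth_proj gt (horizontal_bundle gt P) x v = v *m J *m L.
Proof.
have LJ := lift_repK hP (chart_pair_at P x).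
have As : A^T = A := gram_sym gt phi u0.
have lJ (c : 'rV[R]_m) : c *m L *m J = c by rewrite -mulmxA LJ mulmx1.
rewrite /orth_proj; set Q := [set w | _].
have Q1 : Q (v *m J *m L).
  split=> [|u /horizontal_atP /= uE]; first by apply/horizontal_atP; rewrite lJ.
  rewrite gram_form_at uE (form_sym _ _ As) form_lift mulmxBl lJ subrr.
  exact: form0r.
have [Q2 Q3] : Q (get Q) by apply: getPex; exists (v *m J *m L).
move/horizontal_atP: Q2 => /= Q2; rewrite Q2; congr (_ *m _).
apply/eqP; rewrite eq_sym -subr_eq0; apply/eqP.
apply: (form_nondegenerate (gram_posdef g (at_chart_at (P x)))) => b.
rewrite (form_sym _ _ (gram_sym g _ _)) -mulmxBl -form_lift (form_sym _ _ As) -gram_form_at.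
by apply: Q3; apply/horizontal_atP; rewrite lJ.
Qed.

End horizontal_bundle_fibre.

(** * The unit horizontal bundle and its metric *)

Section unit_horizontal_bundle.
Variables (R : realType) (n m : nat) (Mt : manifold R n) (M : manifold R m).
Variables (gt : riem_metric Mt) (g : riem_metric M) (P : Mt -> M).
Variables (nablat : covariant Mt) (nabla : covariant M).
Variable Kt : tangent_bundle Mt -> 'rV[R]_(n + n) -> 'rV[R]_n.
Hypothesis hP : riemannian_submersion setT setT gt g P.
Hypothesis nablatP : levi_civita gt nablat.
Hypothesis nablaP : levi_civita g nabla.
Local Notation HP := (horizontal_bundle gt P).
Hypothesis KtP : connection_map HP (induced_connection gt HP nablat) Kt.
Variable xi : tangent_bundle Mt.
Local Notation x := (tbase xi).
Local Notation phi := (chart_at (tbase xi)).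
Local Notation psi := (chart_at (P (tbase xi))).
Local Notation u0 := (chart_map (chart_at (tbase xi)) (tbase xi)).
Local Notation y0 := (chart_map (chart_at (P (tbase xi))) (P (tbase xi))).
Local Notation J := (jac_rep P phi psi).
Local Notation L := (lift_rep gt P phi psi).
Local Notation A := (gram gt phi u0).
Local Notation G := (gram g psi y0).
Local Notation f := (local_rep P phi psi).
Local Notation CG := (christoffel nabla (P (tbase xi))).
Local Notation Et1 := (unit_bundle gt HP).
Hypothesis xi1 : Et1 xi.

Let s := tvect xi *m J u0.
Let D := oneill_rep gt P nablat nabla x.
Let LJ : L u0 *m J u0 = 1%:M := lift_repK hP (chart_pair_at P x).
Let LC : Coo_at L u0 := lift_rep_Coo_at hP x.
Let JC : Coo_at J u0 := jac_rep_Coo hP (chart_pair_at P x).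

Lemma horizontal_fibre_vector : tvect xi = s *m L u0.
Proof. by have [h _] := xi1; apply/(horizontal_atP hP). Qed.

Let lJ (c : 'rV[R]_m) : c *m L u0 *m J u0 = c.
Proof. by rewrite -mulmxA LJ mulmx1. Qed.

Lemma unit_fibre_form : form G s s = 1.
Proof.
have [_ <-] := xi1; rewrite gram_form_at.
by rewrite [in RHS]horizontal_fibre_vector (form_lift hP) lJ.
Qed.

Lemma unit_horizontal_local : \forall u \near u0, forall v,
  Et1 (@TVec R n Mt (chart_inv phi u) (dchart_inv phi u v)) <->
  v = v *m J u *m L u /\ form (gram g psi (f u)) (v *m J u) (v *m J u) = 1.
Proof.
apply: filterS (near_chart_pair hP (chart_pair_at P x)) => u [h E1 E2] v.
have [c1 _] := h; set y := chart_inv phi u in h E1 E2 c1 *.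
rewrite -[in dchart_inv _ _ _]E1 dchart_invE //.
have := horizontal_liftE hP v h; rewrite E1 => H.
have nE : v = v *m J u *m L u -> gt y (dtransition phi (chart_at y) y v) (dtransition phi (chart_at y) y v) =
    form (gram g psi (f u)) (v *m J u) (v *m J u).
  move=> vE; rewrite gram_form // E1 {1}vE /form.
  have := lift_rep_isometry hP h; rewrite E1 E2 => LA.
  by rewrite -(mulmxA _ (L u)) LA trmx_mul !mulmxA.
split=> [[/H vE n1]|[vE n1]].
  by split=> //; rewrite -nE.
by split; [exact: (proj2 H)|rewrite -n1 -nE].
Qed.

(* The vector with base velocity a along which the projection of xi to TM has covariant
   derivative k. *)
Definition lifted_vect (a : 'rV[R]_n) (k : 'rV[R]_m) : 'rV[R]_(n + n) :=
  frame_vect xi L s a (k - s *m CG (a *m J u0)).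

Lemma lifted_vect_linear c a k a' k' :
  lifted_vect (c *: a + a') (c *: k + k') = c *: lifted_vect a k + lifted_vect a' k'.
Proof.
rewrite /lifted_vect -frame_vect_linear; congr frame_vect.
rewrite mulmxDl -scalemxAl (christoffel_linear nablaP) mulmxDr -scalemxAr.
by apply/rowP => i; rewrite !mxE; ring.
Qed.

Lemma lsubmx_lifted_vect a k : lsubmx (lifted_vect a k) = a.
Proof. exact: row_mxKl. Qed.

Let HC := gram_pull_Coo hP x.
Let Hs : (gram g psi (f u0))^T = gram g psi (f u0) := gram_sym g _ _.
Let s1 : form (gram g psi (f u0)) s s = 1.
Proof. by rewrite local_rep0 unit_fibre_form. Qed.

Lemma unit_horizontal_tangentP B : tangent_at Et1 xi B <->
  exists a k, B = lifted_vect a k /\ form G s k = 0.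
Proof.
have H := unit_tangentP LC JC HC horizontal_fibre_vector LJ Hs s1
  (@gram_pull_deriv _ _ _ _ _ _ _ _ _ hP nablaP x) unit_horizontal_local (near_lift_repK hP x) B.
rewrite local_rep0 in H.
split=> [BT|[a [k [BE E]]]].
  have [a [b [-> E]]] := proj1 H BT.
  by exists a, (b + s *m CG (a *m J u0)); rewrite /lifted_vect addrK.
apply: (proj2 H); exists a, (k - s *m CG (a *m J u0)).
by rewrite BE subrK.
Qed.

Lemma Hprime_lifted B : Hprime Et1 xi B <-> exists k, B = lifted_vect 0 k /\ form G s k = 0.
Proof.
have CG0 : CG (0 *m J u0) = 0.
  by rewrite mul0mx; exact: linear_at0 (christoffel_linear nablaP (P x)).
have H := unit_fibre_tangentP LC JC HC horizontal_fibre_vector LJ Hs s1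
  (@gram_pull_deriv _ _ _ _ _ _ _ _ _ hP nablaP x) unit_horizontal_local (near_lift_repK hP x) B CG0.
rewrite local_rep0 in H.
rewrite /lifted_vect CG0 mulmx0.
split=> [/(proj1 H)[b [-> E]]|[k [BE E]]]; first by exists b; rewrite subr0.
by apply: (proj2 H); exists k; rewrite BE subr0.
Qed.

Lemma near_horizontal_frame : \forall u \near u0, forall c : 'rV[R]_m,
  HP (@TVec R n Mt (chart_inv phi u) (dchart_inv phi u (c *m L u))).
Proof.
apply: filterS (near_chart_pair hP (chart_pair_at P x)) => u [h E1 _] c.
have [c1 _] := h.
have := horizontal_lift hP c h; rewrite E1 => H.
have E := dchart_invE (c *m L u) c1; rewrite E1 in E.
suff : horizontal setT gt P (chart_inv phi u) (dchart_inv phi u (c *m L u)) by [].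
by rewrite E.
Qed.

Lemma horizontal_connection a k : Kt xi (lifted_vect a k) = (k + s *m D a) *m L u0.
Proof.
have xin0 : tvect xi != 0.
  apply/eqP => E; have := unit_fibre_form; rewrite /s E mul0mx form0l => /eqP.
  by rewrite eq_sym oner_eq0.
have Hl : linear (fun v : 'rV[R]_n => v *m J u0 *m L u0).
  by move=> c v w; rewrite !mulmxDl -!scalemxAl.
have DH (F : 'rV[R]_n -> 'rV[R]_n) (v : 'rV[R]_n) : Coo_at F u0 ->
    induced_connection gt HP nablat (chart_field phi F) x v =
    ('d F u0 v + F u0 *m christoffel nablat x v) *m J u0 *m L u0.
  move=> FC; rewrite /induced_connection (orth_proj_horizontal hP).
  by rewrite (nabla_chart_field nablatP).
apply: eq_trans (connection_map_frame LC horizontal_fibre_vector near_horizontal_frame KtP Hl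
  (christoffel_linear nablatP x) xin0 DH a _) _.
congr (_ *m _).
have E := lift_deriv_jac hP x a; move/eqP: E; rewrite addr_eq0 => /eqP E.
rewrite [in LHS]horizontal_fibre_vector; exact: (connection_frame_oneill _ _ _ _ LJ E).
Qed.

Lemma horizontal_pq_metric p q a k a' k' :
  form G s k = 0 -> form G s k' = 0 ->
  pq_metric gt Kt p q xi (lifted_vect a k) (lifted_vect a' k') =
  form A a a' + ((1 + 1) `^ p)^-1 * form G (k + s *m D a) (k' + s *m D a').
Proof.
move=> k0 k0'; have [_ e1] := xi1.
have F1 b c : gt x (b *m L u0) (c *m L u0) = form G b c.
  by rewrite gram_form_at (form_lift hP) lJ.
have F2 b : gt x (b *m L u0) (tvect xi) = form G s b.
  by rewrite [tvect xi]horizontal_fibre_vector F1 (form_sym _ _ (gram_sym g _ _)).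
rewrite /pq_metric !dmap_bundle_proj !horizontal_connection e1 !lsubmx_lifted_vect.
rewrite -[bundle_proj xi]/x F1 !F2 gram_form_at.
(* Skewness of D makes the value of the connection map orthogonal to xi, so the q-term
   disappears. *)
have F3 : form G s (k + s *m D a) = 0.
  by rewrite formDr k0 add0r; exact: form_oneill_rep.
by rewrite F3 mulr0 mul0r addr0.
Qed.

End unit_horizontal_bundle.

Lemma frame_jacobian (R : realType) n m (s k : 'rV[R]_m) (J DJ : 'M[R]_(n, m))
    (L DL : 'M[R]_(m, n)) : L *m J = 1%:M -> DL *m J = - (L *m DJ) ->
  (s *m DL + k *m L) *m J + s *m L *m DJ = k.
Proof.
move=> LJ E; rewrite !mulmxDl -!mulmxA E LJ mulmx1 mulmxN.
by apply/rowP => i; rewrite !mxE; ring.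
Qed.

(** * Differential of the tangent map *)

Section tangent_map_submersion.
Variables (R : realType) (n m : nat) (Mt : manifold R n) (M : manifold R m).
Variables (gt : riem_metric Mt) (g : riem_metric M) (P : Mt -> M).
Hypothesis hP : riemannian_submersion setT setT gt g P.
Variable xi : tangent_bundle Mt.
Local Notation x := (tbase xi).
Local Notation phi := (chart_at (tbase xi)).
Local Notation psi := (chart_at (P (tbase xi))).
Local Notation u0 := (chart_map (chart_at (tbase xi)) (tbase xi)).
Local Notation J := (jac_rep P phi psi).
Local Notation L := (lift_rep gt P phi psi).
Local Notation f := (local_rep P phi psi).

Let W (w : 'rV[R]_(n + n)) : 'rV[R]_(m + m) := row_mx (f (lsubmx w)) (rsubmx w *m J (lsubmx w)).

Let w0 : lsubmx (tcoord xi) = u0.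
Proof. by rewrite tcoordE row_mxKl. Qed.

Lemma near_tangent_map_rep : \forall w \near tcoord xi,
  (chart_map (@chart_at _ _ (tangent_bundle M) (tangent_map P xi)) \o tangent_map P \o
   chart_inv (@chart_at _ _ (tangent_bundle Mt) xi)) w = W w.
Proof.
apply: filterS (tangent_map_local (submersion_smooth hP) (at_chart_at x) (at_chart_at (P x))).
move=> w E; apply: eq_trans E _; congr row_mx; exact: JacE.
Qed.

Let fC : Coo_at (fun w : 'rV[R]_(n + n) => f (lsubmx w)) (tcoord xi).
Proof.
apply: Coo_at_comp; first exact: Coo_at_lsubmx (Coo_at_id _).
by rewrite w0; exact: local_rep_Coo hP _ _ _ (chart_pair_at P x).
Qed.

Let JC : Coo_at J (lsubmx (tcoord xi)).
Proof. by rewrite w0; exact: jac_rep_Coo hP _ _ _ (chart_pair_at P x). Qed.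

Let JwC : Coo_at (fun w : 'rV[R]_(n + n) => rsubmx w *m J (lsubmx w)) (tcoord xi).
Proof.
apply: Coo_at_mulmx; first exact: Coo_at_rsubmx (Coo_at_id _).
by apply: Coo_at_comp => //; exact: Coo_at_lsubmx (Coo_at_id _).
Qed.

Lemma dmap_tangent_map B : dmap (tangent_map P) xi B =
  row_mx (lsubmx B *m J u0) (rsubmx B *m J u0 + tvect xi *m 'd J u0 (lsubmx B)).
Proof.
have lC : Coo_at (fun w : 'rV[R]_(n + n) => lsubmx w : 'rV[R]_n) (tcoord xi).
  exact: Coo_at_lsubmx (Coo_at_id _).
have rC : Coo_at (fun w : 'rV[R]_(n + n) => rsubmx w : 'rV[R]_n) (tcoord xi).
  exact: Coo_at_rsubmx (Coo_at_id _).
have dl : 'd (fun w : 'rV[R]_(n + n) => lsubmx w : 'rV[R]_n) (tcoord xi) B = lsubmx B.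
  by apply: diff_linearE; [exact: lsubmx_linear|exact: lsubmx_continuous].
have dr : 'd (fun w : 'rV[R]_(n + n) => rsubmx w : 'rV[R]_n) (tcoord xi) B = rsubmx B.
  by apply: diff_linearE; [exact: rsubmx_linear|exact: rsubmx_continuous].
apply: eq_trans (near_diffE B near_tangent_map_rep) _.
apply: eq_trans (diff_row_mx B fC JwC) _.
have fC' : Coo_at f (lsubmx (tcoord xi)).
  by rewrite w0; exact: local_rep_Coo hP _ _ _ (chart_pair_at P x).
have e1 := diff_compE B (Coo_at_differentiable lC) (Coo_at_differentiable fC').
have e2 := diff_mulmx_row B rC lC JC.
apply: eq_trans (congr2 (fun (a b : 'rV[R]_m) => row_mx a b) e1 e2) _.
have rE : rsubmx (tcoord xi) = tvect xi by rewrite tcoordE row_mxKr.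
have a1 := eq_trans (diff_congr f w0 dl) (JacE f u0 (lsubmx B)).
have a2 := congr2 (fun (a : 'rV[R]_n) (u : 'rV[R]_n) => a *m J u) dr w0.
have a3 := congr2 (fun (a : 'rV[R]_n) (X : 'M[R]_(n, m)) => a *m X) rE (diff_congr J w0 dl).
exact (congr2 (fun (a b : 'rV[R]_m) => row_mx a b) a1 (congr2 (fun (a b : 'rV[R]_m) => a + b) a2 a3)).
Qed.

Lemma tangent_map_smooth : smooth_at (tangent_map P) xi.
Proof.
split; last first.
  apply: Coo_at_ext (Coo_at_row_mx fC JwC).
  by apply: filterS near_tangent_map_rep => w ->.
(* Continuity refers to the topology of the bundle; it is recovered from the coordinate expression W
   composed with the chart at xi. *)
have Pc : {for x, continuous P} by have [] := submersion_smooth hP x.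
have nP : \forall z \near xi, at_chart psi (P (tbase z)).
  have tc : tbase z @[z --> xi] --> x := tbase_continuous (z := xi).
  exact: tc (Pc _ (near_at_chart (at_chart_at (P x)))).
apply: (@tangent_bundle_continuous R m M _ (tangent_map P) xi psi).
- exact: at_chart_at.
- by apply: filterS nP => z [].
have tc := tchart_continuous (at_chart_at x).
have E : \forall z \near xi, W (chart_map (tchart phi) z) = chart_map (tchart psi) (tangent_map P z).
  have n1 : \forall z \near xi, (chart_map (tchart psi) \o tangent_map P \o chart_inv (tchart phi))
     (chart_map (tchart phi) z) = W (chart_map (tchart phi) z).
    exact: (tc (fun w => (chart_map (tchart psi) \o tangent_map P \o chart_inv (tchart phi)) w = W w)
      near_tangent_map_rep).
  apply: filterS2 n1 (near_tbase_chart (at_chart_at x)) => z E1 h.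
  exact (eq_trans (esym E1) (congr1 (fun y : tangent_bundle Mt =>
    chart_map (tchart psi) (tangent_map P y)) (tchart_mapK h))).
have Wc : {for tcoord xi, continuous W} by exact: Coo_at_continuous (Coo_at_row_mx fC JwC).
have cc : {for xi, continuous (fun z => W (chart_map (tchart phi) z))}.
  by apply: (@continuous_comp _ _ _ (chart_map (tchart phi)) W).
rewrite /prop_for /continuous_at -(nbhs_singleton E).
apply: cvg_trans cc.
exact (near_eq_cvg E).
Qed.

Variable nabla : covariant M.
Hypothesis xi1 : unit_bundle gt (horizontal_bundle gt P) xi.

Lemma tangent_map_vect : tvect (tangent_map P xi) = tvect xi *m J u0.
Proof. exact: dmap_jac_rep. Qed.

(** Since DL J = - L DJ, the derivative of J cancels that of the frame. The fibre component that
    survives, k - s CG(a J), is the one prescribed by [split_vect]. *)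
Lemma dmap_lifted_vect a k : dmap (tangent_map P) xi (lifted_vect gt P nabla xi a k) =
  split_vect nabla (tangent_map P xi) (a *m J u0) k.
Proof.
have LJ : L u0 *m J u0 = 1%:M := lift_repK hP (chart_pair_at P x).
rewrite dmap_tangent_map lsubmx_lifted_vect /split_vect tangent_map_vect; congr row_mx.
rewrite /lifted_vect /frame_vect row_mxKr.
have E := lift_deriv_jac hP x a; move/eqP: E; rewrite addr_eq0 => /eqP E.
have vE := horizontal_fibre_vector hP xi1.
set s := tvect xi *m J u0 in vE *; rewrite vE.
exact: frame_jacobian LJ E.
Qed.

End tangent_map_submersion.

Lemma unit_bundle_image (R : realType) (n m : nat) (Mt : manifold R n) (M : manifold R m)
    (gt : riem_metric Mt) (g : riem_metric M) (P : Mt -> M) :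
  riemannian_submersion setT setT gt g P ->
  tangent_map P @` unit_bundle gt (horizontal_bundle gt P) =
  unit_bundle g (@setT (tangent_bundle M)).
Proof.
move=> hP; have [_ P1 _ iso] := hP.
apply/seteqP; split=> [_ [xi [xh x1] <-]|[y w] [_ w1]].
  by split=> //; apply: eq_trans x1; exact: iso.
have /= : (P @` setT) y by rewrite P1.
move=> [x _ xy]; move: w w1; rewrite -xy => w w1.
pose v := w *m lift_rep gt P (chart_at x) (chart_at (P x)) (chart_map (chart_at x) x).
have vJ : dmap P x v = w.
  rewrite dmap_jac_rep /v -mulmxA.
  by rewrite (lift_repK hP (chart_pair_at P x)) mulmx1.
have vh : horizontal setT gt P x v.
  by apply/(horizontal_atP hP); rewrite -dmap_jac_rep vJ.
exists (@TVec R n Mt x v); last by rewrite /tangent_map /= vJ.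
split=> //; apply: eq_trans w1; rewrite /= -vJ.
by apply: esym; exact: iso.
Qed.

Lemma horizontal_lift_at (R : realType) (n m : nat) (Mt : manifold R n) (M : manifold R m)
    (gt : riem_metric Mt) (g : riem_metric M) (P : Mt -> M) (x : Mt) (a : 'rV[R]_n) :
  riemannian_submersion setT setT gt g P ->
  (forall U : 'rV[R]_n, U *m jac_rep P (chart_at x) (chart_at (P x)) (chart_map (chart_at x) x) = 0 ->
    form (gram gt (chart_at x) (chart_map (chart_at x) x)) a U = 0) <->
  a = a *m jac_rep P (chart_at x) (chart_at (P x)) (chart_map (chart_at x) x) *m
      lift_rep gt P (chart_at x) (chart_at (P x)) (chart_map (chart_at x) x).
Proof.
move=> hP; have H1 := horizontalP hP a (chart_pair_at P x).
have H2 := horizontal_liftE hP a (chart_pair_at P x).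
by split=> [/(proj2 H1)/(proj1 H2)|/(proj2 H2)/(proj1 H1)].
Qed.

(** * Horizontal and vertical spaces of the tangent map *)

Section tangent_map_distributions.
Variables (R : realType) (n m : nat) (Mt : manifold R n) (M : manifold R m).
Variables (gt : riem_metric Mt) (g : riem_metric M) (P : Mt -> M) (p q : R).
Variables (nablat : covariant Mt) (nabla : covariant M).
Variable Kt : tangent_bundle Mt -> 'rV[R]_(n + n) -> 'rV[R]_n.
Variable K : tangent_bundle M -> 'rV[R]_(m + m) -> 'rV[R]_m.
Hypothesis hP : riemannian_submersion setT setT gt g P.
Hypothesis nablatP : levi_civita gt nablat.
Hypothesis nablaP : levi_civita g nabla.
Local Notation HP := (horizontal_bundle gt P).
Hypothesis KtP : connection_map HP (induced_connection gt HP nablat) Kt.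
Hypothesis KP : connection_map (@setT (tangent_bundle M)) nabla K.
Local Notation Et1 := (unit_bundle gt HP).
Local Notation SM := (unit_bundle g (@setT (tangent_bundle M))).
Local Notation ht := (pq_metric gt Kt p q).
Local Notation h := (pq_metric g K p q).
Local Notation Pt := (tangent_map P).
Local Notation D := (oneill_rep gt P nablat nabla).
Local Notation kp := (((1 + 1) `^ p)^-1 : R).

Let kp0 : 0 < kp.
Proof. by rewrite invr_gt0 powR_gt0. Qed.

Section at_unit_vector.
Variable xi : tangent_bundle Mt.
Hypothesis xi1 : Et1 xi.
Local Notation x := (tbase xi).
Local Notation J := (jac_rep P (chart_at (tbase xi)) (chart_at (P (tbase xi)))
  (chart_map (chart_at (tbase xi)) (tbase xi))).
Local Notation L := (lift_rep gt P (chart_at (tbase xi)) (chart_at (P (tbase xi)))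
  (chart_map (chart_at (tbase xi)) (tbase xi))).
Local Notation A := (gram gt (chart_at (tbase xi)) (chart_map (chart_at (tbase xi)) (tbase xi))).
Local Notation G := (gram g (chart_at (P (tbase xi)))
  (chart_map (chart_at (P (tbase xi))) (P (tbase xi)))).
Local Notation s := (tvect xi *m jac_rep P (chart_at (tbase xi)) (chart_at (P (tbase xi)))
  (chart_map (chart_at (tbase xi)) (tbase xi))).
Local Notation lifted := (lifted_vect gt P nabla xi).
Local Notation split := (split_vect nabla (Pt xi)).

Let LJ : L *m J = 1%:M := lift_repK hP (chart_pair_at P x).
Let liftP (a : 'rV[R]_n) : (forall U : 'rV[R]_n, U *m J = 0 -> form A a U = 0) <-> a = a *m J *m L :=
  horizontal_lift_at x a hP.
Let lJ (c : 'rV[R]_m) : c *m L *m J = c.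
Proof. by rewrite -mulmxA LJ mulmx1. Qed.

Let Ptxi1 : SM (Pt xi).
Proof. by rewrite -(unit_bundle_image hP); exists xi. Qed.

Let tangentP := unit_horizontal_tangentP hP nablaP xi1.

Lemma oneill_rep_at0 : D x 0 = 0.
Proof.
exact (linear_at0 (oneill_rep_linear P nablatP nablaP x)).
Qed.

Lemma lifted_vect0 : lifted 0 0 = 0.
Proof.
have := lifted_vect_linear gt P nablaP xi (-1) 0 0 0 0.
by rewrite !scaler0 !addr0 scaleN1r addNr.
Qed.

Lemma split_vect_eq0 c k : split c k = 0 -> c = 0 /\ k = 0.
Proof.
move=> E; have c0 : c = 0 by rewrite -[c](row_mxKl c (k - tvect (Pt xi) *m christoffel nabla (P x) c)) -/(split c k) E; apply/rowP => i; rewrite !mxE.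
have C0 := linear_at0 (christoffel_linear nablaP (tbase (Pt xi))).
split=> //; have : rsubmx (split c k) = 0 by rewrite E; apply/rowP => i; rewrite !mxE.
by rewrite /split_vect row_mxKr c0 C0 mulmx0 subr0.
Qed.

Lemma split_vect0 : split 0 0 = 0.
Proof.
have C0 := linear_at0 (christoffel_linear nablaP (tbase (Pt xi))).
rewrite /split_vect C0 mulmx0 subr0.
exact: row_mx0.
Qed.

Lemma vertical_liftedP B : vertical Et1 Pt xi B <-> exists a, B = lifted a 0 /\ a *m J = 0.
Proof.
split=> [[/tangentP[a [k [-> _]]]]|[a [-> aJ]]].
  by rewrite (dmap_lifted_vect hP) // => /split_vect_eq0[aJ k0]; exists a; rewrite k0.
split; first by apply/tangentP; exists a, 0; rewrite form0r.
by rewrite (dmap_lifted_vect hP) // aJ split_vect0.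
Qed.

Lemma horizontal_liftedP B : horizontal Et1 ht Pt xi B <->
  exists a k, [/\ B = lifted a k, form G s k = 0 &
    forall U, U *m J = 0 -> form A a U + kp * form G (k + s *m D x a) (s *m D x U) = 0].
Proof.
have E a k U : form G s k = 0 ->
    ht xi (lifted a k) (lifted U 0) = form A a U + kp * form G (k + s *m D x a) (s *m D x U).
  move=> k0; have z0 : form G s 0 = 0 by exact: form0r.
  have := horizontal_pq_metric hP nablatP nablaP KtP xi1 p q a U k0 z0.
  by rewrite add0r.
split=> [[/tangentP[a [k [-> k0]]] H]|[a [k [-> k0 H]]]].
  exists a, k; split=> // U UJ; rewrite -E //; apply: H.
  by apply/vertical_liftedP; exists U.
split; first by apply/tangentP; exists a, k.
by move=> w /vertical_liftedP[U [-> UJ]]; rewrite E // H.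
Qed.

(** Orthogonality to the fibre means that the connection map vanishes, that is k + s D(a) = 0. *)
Lemma horizontal_proj_liftedP B : horizontal Et1 ht (@bundle_proj R n Mt) xi B <->
  exists a, B = lifted a (- (s *m D x a)).
Proof.
have E a k k' : form G s k = 0 -> form G s k' = 0 ->
    ht xi (lifted a k) (lifted 0 k') = kp * form G (k + s *m D x a) k'.
  move=> k0 k0'.
  have := horizontal_pq_metric hP nablatP nablaP KtP xi1 p q a 0 k0 k0'.
  by rewrite form0r add0r oneill_rep_at0 mulmx0 addr0.
have V k' : form G s k' = 0 -> vertical Et1 (@bundle_proj R n Mt) xi (lifted 0 k').
  move=> k0; split; first by apply/tangentP; exists 0, k'.
  by rewrite dmap_bundle_proj lsubmx_lifted_vect.
have sD a : form G s (s *m D x a) = 0 by exact: form_oneill_rep.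
split=> [[/tangentP[a [k [-> k0]]] H]|[a ->]].
  exists a; congr lifted.
  (* k + s D(a) is itself admissible as a fibre vector, by skewness of D; testing against it gives
     zero norm. *)
  have c0 : form G s (k + s *m D x a) = 0 by rewrite formDr k0 sD addr0.
  have := H _ (V _ c0); rewrite E // => /eqP.
  rewrite mulf_eq0 gt_eqF //= => /eqP /(form_eq0 (gram_posdef g (at_chart_at (P x)))) /eqP.
  by rewrite addr_eq0 => /eqP.
have sN : form G s (- (s *m D x a)) = 0 by rewrite formNr sD oppr0.
split; first by apply/tangentP; exists a, (- (s *m D x a)).
move=> w [/tangentP[a' [k' [-> k0']]]].
rewrite dmap_bundle_proj lsubmx_lifted_vect => ->; rewrite E // addNr form0l.
exact: mulr0.
Qed.

Lemma pq_metric_image a k a' k' : form G s k = 0 -> form G s k' = 0 ->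
  h (Pt xi) (dmap Pt xi (lifted a k)) (dmap Pt xi (lifted a' k')) =
  form G (a *m J) (a' *m J) + kp * form G k k'.
Proof.
move=> k0 k0'; rewrite !(dmap_lifted_vect hP) //.
apply: sphere_pq_metric => //; rewrite tangent_map_vect; [exact: k0|exact: k0'].
Qed.

Lemma dmap_tangent_image : dmap Pt xi @` tangent_at Et1 xi = tangent_at SM (Pt xi).
Proof.
have SP := sphere_tangentP nablaP Ptxi1.
apply/seteqP; split=> [_ [B /tangentP[a [k [-> k0]]] <-]|B /SP[c [k [-> k0]]]].
  apply/SP; exists (a *m J), k; rewrite (dmap_lifted_vect hP) //; split=> //.
  by rewrite tangent_map_vect.
rewrite tangent_map_vect in k0.
exists (lifted (c *m L) k); first by apply/tangentP; exists (c *m L), k.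
by rewrite (dmap_lifted_vect hP) // lJ.
Qed.

(** It suffices to test the isometry on the diagonal B = C and on vectors whose base velocity is
    vertical. *)
Lemma isometry_oneill0 :
  (forall B C, horizontal Et1 ht Pt xi B -> horizontal Et1 ht Pt xi C ->
     h (Pt xi) (dmap Pt xi B) (dmap Pt xi C) = ht xi B C) ->
  forall a, s *m D x a = 0.
Proof.
move=> iso; apply: (oneill_rep_isometry hP nablatP nablaP kp0) => W b WJ b0 H.
have hB : horizontal Et1 ht Pt xi (lifted W b) by apply/horizontal_liftedP; exists W, b.
have := iso _ _ hB hB.
have e := horizontal_pq_metric hP nablatP nablaP KtP xi1 p q W W b0 b0.
by rewrite pq_metric_image // e WJ form0l add0r.
Qed.

Hypothesis Dx0 : forall a, D x a = 0.

Lemma horizontal_lifted_flatP B : horizontal Et1 ht Pt xi B <->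
  exists a k, [/\ B = lifted a k, form G s k = 0 & a = a *m J *m L].
Proof.
split=> [/horizontal_liftedP[a [k [-> k0 H]]]|[a [k [-> k0 H]]]].
  exists a, k; split=> //; apply: (proj1 (liftP a)) => U UJ.
  by have := H U UJ; rewrite !Dx0 mulmx0 form0r mulr0 addr0.
apply/horizontal_liftedP; exists a, k; split=> // U UJ.
rewrite !Dx0 mulmx0 form0r mulr0 addr0.
exact: (proj2 (liftP a) H).
Qed.

Lemma flat_isometry B C : horizontal Et1 ht Pt xi B -> horizontal Et1 ht Pt xi C ->
  h (Pt xi) (dmap Pt xi B) (dmap Pt xi C) = ht xi B C.
Proof.
move=> /horizontal_lifted_flatP[a [k [-> k0 aE]]] /horizontal_lifted_flatP[a' [k' [-> k0' _]]].
rewrite pq_metric_image //.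
have e := horizontal_pq_metric hP nablatP nablaP KtP xi1 p q a a' k0 k0'.
rewrite e !Dx0 !mulmx0 !addr0; congr (_ + _).
by rewrite [in RHS]aE (form_lift hP).
Qed.

Lemma horizontal_proj_flatP B : horizontal Et1 ht (@bundle_proj R n Mt) xi B <->
  exists a, B = lifted a 0.
Proof.
by split=> [/horizontal_proj_liftedP[a ->]|[a ->]]; last apply/horizontal_proj_liftedP;
  exists a; rewrite Dx0 mulmx0 oppr0.
Qed.

Lemma HsecondP B : Hsecond gt P Et1 ht xi B <-> exists a, B = lifted a 0 /\ a = a *m J *m L.
Proof.
split=> [[_ [wt [hw _ /horizontal_proj_flatP[a ->]]]]|[a [-> aE]]].
  rewrite dmap_bundle_proj lsubmx_lifted_vect => aw; exists a; split=> //.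
  by apply/(horizontal_atP hP); rewrite aw.
exists (dmap P x a), a; split=> //; first by apply/(horizontal_atP hP).
- by apply/horizontal_proj_flatP; exists a.
- by rewrite dmap_bundle_proj lsubmx_lifted_vect.
Qed.

(** Once D = 0 the horizontality of (a, k) restricts a and k separately, and (a, k) = (0, k) + (a,
    0) is the decomposition. *)
Lemma horizontal_direct_sum :
  is_direct_sum (Hprime Et1 xi) (Hsecond gt P Et1 ht xi) (horizontal Et1 ht Pt xi).
Proof.
have H' := Hprime_lifted hP nablaP xi1.
have add a k : lifted 0 k + lifted a 0 = lifted a k.
  have := lifted_vect_linear gt P nablaP xi 1 0 k a 0.
  by rewrite !scale1r add0r addr0.
split.
  apply/seteqP; split=> [B /horizontal_lifted_flatP[a [k [-> k0 aE]]]|].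
    exists (lifted 0 k); first by apply/H'; exists k.
    by exists (lifted a 0) => //; apply/HsecondP; exists a.
  move=> _ [_ /H'[k [-> k0]] [_ /HsecondP[a [-> aE]] <-]].
  by apply/horizontal_lifted_flatP; exists a, k.
apply/seteqP; split=> [B [/H'[k [BE k0]] /HsecondP[a [BE' _]]]|_ ->].
  have a0 : a = 0 by rewrite -(lsubmx_lifted_vect gt P nabla xi a 0) -BE' BE lsubmx_lifted_vect.
  by rewrite BE' a0 lifted_vect0.
split; first by apply/H'; exists 0; rewrite lifted_vect0 form0r.
by apply/HsecondP; exists 0; rewrite lifted_vect0 !mul0mx.
Qed.

Lemma vertical_flat : vertical Et1 Pt xi = Vbundle P Et1 ht xi.
Proof.
apply/seteqP; split=> [B /vertical_liftedP[a [-> aJ]]|B [/horizontal_proj_flatP[a ->]]].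
  split; first by apply/horizontal_proj_flatP; exists a.
  by rewrite dmap_bundle_proj lsubmx_lifted_vect dmap_jac_rep.
rewrite dmap_bundle_proj lsubmx_lifted_vect dmap_jac_rep => aJ.
by apply/vertical_liftedP; exists a.
Qed.

End at_unit_vector.

(** The isometry at a single xi yields only s D = 0 for its own s. Row i of D is reached by taking
    for xi the lift of the normalized i-th basis vector. *)
Lemma oneill_rep0 x : (forall xi, Et1 xi -> tbase xi = x ->
    forall B C, horizontal Et1 ht Pt xi B -> horizontal Et1 ht Pt xi C ->
      h (Pt xi) (dmap Pt xi B) (dmap Pt xi C) = ht xi B C) ->
  forall a, D x a = 0.
Proof.
move=> iso a; apply/row_matrixP => i; rewrite row0 rowE.
set e := delta_mx 0 i.
pose G := gram g (chart_at (P x)) (chart_map (chart_at (P x)) (P x)).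
pose L := lift_rep gt P (chart_at x) (chart_at (P x)) (chart_map (chart_at x) x).
pose J := jac_rep P (chart_at x) (chart_at (P x)) (chart_map (chart_at x) x).
have LJ : L *m J = 1%:M := lift_repK hP (chart_pair_at P x).
have e0 : e != 0.
  by apply/eqP => /matrixP/(_ 0 i); rewrite !mxE !eqxx => /eqP; rewrite oner_eq0.
have [_ Gp] := gram_posdef g (at_chart_at (P x)).
have r0 : 0 < form G e e by exact: Gp.
pose c := (Num.sqrt (form G e e))^-1.
have c0 : 0 < c by rewrite invr_gt0 sqrtr_gt0.
have ce : form G (c *: e) (c *: e) = 1.
  rewrite formZl [form _ _ (_ *: _)]/form linearZ /= -scalemxAr mxE -/(form G e e).
  by rewrite mulrA -expr2 exprVn sqr_sqrtr ?ltW // mulVf // gt_eqF.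
pose xi : tangent_bundle Mt := @TVec R n Mt x (c *: e *m L).
have xi1 : Et1 xi.
  have vJ : c *: e *m L *m J = c *: e by rewrite -(mulmxA (c *: e)) LJ mulmx1.
  split; first by apply/(horizontal_atP hP); rewrite -/J -/L /= vJ.
  by rewrite gram_form_at /= (form_lift hP) -/J vJ.
have := isometry_oneill0 xi1 (iso xi xi1 (erefl x)) a.
rewrite /= -/J -/L -(mulmxA (c *: e)) LJ mulmx1 -scalemxAl => /eqP.
by rewrite scaler_eq0 gt_eqF //= => /eqP.
Qed.

End tangent_map_distributions.

Theorem proposition1 (R : realType) (n m : nat)
    (Mt : manifold R n) (M : manifold R m)
    (gt : riem_metric Mt) (g : riem_metric M) (P : Mt -> M) (p q : R)
    (nablat : covariant Mt) (nabla : covariant M)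
    (Kt : tangent_bundle Mt -> 'rV[R]_(n + n) -> 'rV[R]_n)
    (K : tangent_bundle M -> 'rV[R]_(m + m) -> 'rV[R]_m)
    (hP : riemannian_submersion setT setT gt g P)
    (hq : 0 <= q)
    (hnablat : levi_civita gt nablat)
    (hnabla : levi_civita g nabla)
    (hKt : connection_map (horizontal_bundle gt P)
             (induced_connection gt (horizontal_bundle gt P) nablat) Kt)
    (hK : connection_map (@setT (tangent_bundle M)) nabla K) :
  let HP := horizontal_bundle gt P in
  let Et1 := unit_bundle gt HP in
  let SM := unit_bundle g (@setT (tangent_bundle M)) in
  let ht := pq_metric gt Kt p q in
  let h := pq_metric g K p q in
  let Pt := tangent_map P in
  (riemannian_submersion Et1 SM ht h Pt <-> integrable_subbundle HP) /\
  (integrable_subbundle HP -> forall xi, Et1 xi ->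
     is_direct_sum (Hprime Et1 xi) (Hsecond gt P Et1 ht xi)
       (horizontal Et1 ht Pt xi) /\
     vertical Et1 Pt xi = Vbundle P Et1 ht xi).
Proof.
move=> HP Et1 SM ht h Pt.
have int0 : integrable_subbundle HP -> forall x a, oneill_rep gt P nablat nabla x a = 0.
  move=> hI x; apply/(oneill_rep0P hP hnablat hnabla x).
  exact (integrable_flat hP hI x).
split; last first.
  move=> /int0 D0 xi xi1; split.
  - exact (horizontal_direct_sum p q hP hnablat hnabla hKt xi1 (D0 (tbase xi))).
  - exact (vertical_flat p q hP hnablat hnabla hKt xi1 (D0 (tbase xi))).
split=> [[_ _ _ iso]|/int0 D0].
  apply: (flat_integrable hP) => x; apply/(oneill_rep0P hP hnablat hnabla x).
  apply: (oneill_rep0 hP hnablat hnabla hKt hK) => xi xi1 _ B C hB hC.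
  exact: iso.
split=> [xi _||xi xi1|xi B C xi1].
- exact: tangent_map_smooth hP xi.
- exact: unit_bundle_image hP.
- exact (dmap_tangent_image hP hnabla xi1).
- exact (@flat_isometry _ _ _ _ _ _ _ _ p q _ _ _ _ hP hnablat hnabla hKt hK xi xi1 (D0 (tbase xi)) B C).
Qed.
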